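(* Let $0<\alpha<1$, $R>0$, $\beta := 1-\alpha$, and let $$K := \{ r e^{i\phi} : 0 \le r \le R,\ |\phi| \le \alpha\pi/2 \} \cup \{ r e^{i(\pi+\phi)} : 0 \le r \le R,\ |\phi| \le \alpha\pi/2 \}.$$ Let $f \in A(K)$ be a function that is not analytic at $z = 0$. (i) If $\alpha \le \beta$, then there exists a sequence of near-best polynomials for $f$ on $K$ that has geometric rate of convergence in the interior of $K$. (ii) If $\alpha > \beta$, then no sequence of near-best polynomials for $f$ on $K$ has geometric rate of convergence in the interior of $K$.
   Context: For a compact set $K\subset\mathbb{C}$, $A(K)$ is the set of complex-valued functions continuous on $K$ and analytic in the interior $\operatorname{Int} K$. $\mathbb{P}_n$ is the set of complex polynomials of degree at most $n$, $\|\cdot\|_{X}$ is the supremum norm over $X$, and $E_n(f) := \inf_{P \in \mathbb{P}_n} \|f - P\|_K$. A sequence of polynomials $\{p_n\}_{n\ge 1}$ with $p_n \in \mathbb{P}_n$ is called near-best (almost optimal) for $f$ on $K$ if there is a fixed constant $C > 1$ (independent of $n$) such that $\|f - p_n\|_K \le C E_n(f)$ for all $n \in \mathbb{N}$. A sequence $\{p_n\}$ has geometric rate of convergence (to $f$) in the interior of $K$ if for every compact set $E \subset \operatorname{Int} K$ there is $c = c(E) > 0$ with $\limsup_{n\to\infty} \|f - p_n\|_E\, e^{cn} = 0$. The function $f$ is not analytic at $z=0$ means that there are no open neighbourhood $U$ of $0$ and analytic function $g$ on $U$ with $g = f$ on $U \cap K$. *)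

(* Defs.v *)
From Stdlib Require Import Reals List.
From Coquelicot Require Import Coquelicot.
Open Scope R_scope.

(** Functions on a subset [X] of the plane are represented by total functions
    [C -> C] whose values outside [X] are never used.  Topological notions on
    [C] ([open], [locally], [continuous_on]) refer to [C_UniformSpace]. *)

Definition interior_C (X : C -> Prop) (z : C) : Prop := locally z X.

Definition compact_C (X : C -> Prop) : Prop :=
  forall (I : Type) (U : I -> C -> Prop),
    (forall i, open (U i)) ->
    (forall z, X z -> exists i, U i z) ->
    exists l : list I, forall z, X z -> exists i, In i l /\ U i z.

(** [ex_derive] over [C_AbsRing] is complex differentiability.  [U] is meant to
    be open. *)
Definition analytic_on (U : C -> Prop) (g : C -> C) : Prop :=
  forall z : C, U z -> @ex_derive C_AbsRing C_NormedModule g z.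

Definition class_A (K : C -> Prop) (f : C -> C) : Prop :=
  continuous_on K f /\ analytic_on (interior_C K) f.

Definition analytic_at (K : C -> Prop) (f : C -> C) (z0 : C) : Prop :=
  exists (U : C -> Prop) (g : C -> C),
    open U /\ U z0 /\ analytic_on U g /\
    (forall z, U z -> K z -> g z = f z).

(** [sum_n u n] has [n + 1] terms, [u 0] to [u n]. *)
Definition poly_le (n : nat) (P : C -> C) : Prop :=
  exists a : nat -> C,
    forall z : C, P z = sum_n (fun k => (a k * z ^ k)%C) n.

(** The projection [real] is harmless where [supnorm] and [best_error] are used:
    the functions involved are bounded on [X].  It gives the empty set norm [0]. *)
Definition supnorm (X : C -> Prop) (g : C -> C) : R :=
  real (Lub_Rbar (fun y => exists z, X z /\ y = Cmod (g z))).

Definition dist_on (X : C -> Prop) (f g : C -> C) : R :=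
  supnorm X (fun z => (f z - g z)%C).

Definition best_error (K : C -> Prop) (f : C -> C) (n : nat) : R :=
  real (Glb_Rbar (fun y => exists P, poly_le n P /\ y = dist_on K f P)).

(** Sequences start at [n = 1]; the value [p 0] is irrelevant. *)
Definition near_best (K : C -> Prop) (f : C -> C) (p : nat -> C -> C) : Prop :=
  (forall n, (1 <= n)%nat -> poly_le n (p n)) /\
  exists c0 : R, 1 < c0 /\
    forall n, (1 <= n)%nat -> dist_on K f (p n) <= c0 * best_error K f n.

Definition geometric_rate (K : C -> Prop) (f : C -> C) (p : nat -> C -> C)
  : Prop :=
  forall E : C -> Prop,
    compact_C E -> (forall z, E z -> interior_C K z) ->
    exists c : R, 0 < c /\
      LimSup_seq (fun n => dist_on E f (p n) * exp (c * INR n)) = Finite 0.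

Definition cis (t : R) : C := (cos t, sin t).

Definition double_sector (alpha rad : R) (z : C) : Prop :=
  exists r phi : R,
    0 <= r <= rad /\ Rabs phi <= alpha * PI / 2 /\
    (z = (RtoC r * cis phi)%C \/ z = (RtoC r * cis (PI + phi))%C).

(* Main.v *)
Require Import Defs.
From Stdlib Require Import Reals Lra Lia Classical ClassicalEpsilon List.
From Coquelicot Require Import Coquelicot.
Open Scope R_scope.

(* Part (ii).  Let [q = p_(n+1) - p_n], which has degree at most [n + 1] and is bounded on [K].
   In the complementary sectors, whose opening is smaller than [PI / 2], a Phragmen-Lindelof
   argument gives [|q z| <= M exp (n B |z|^2)]; geometric convergence inside, applied to
   [q z exp (n c z^k)] with [1 / alpha < k < 2], gives a decay [exp (- n c' |z|^k)] along the
   axis of the lobes.  Since [k < 2], on a small circle about 0 the decay beats the growth: for [z0]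
   near 0, the product of the rotates of [q] about [z0] is geometrically small on such a circle,
   hence so is [q z0] by the maximum principle, and [f] extends analytically to 0.

   Part (i).  Write [u = f - p_n] with [p_n] near-best and add to [p_n] the sum over the two lobes of
   the contour integrals of [u zeta (1 - S) / (zeta - z)], divided by the winding number, where
   [S] is a mean of high powers of [1 + X + X^2] and [X] is proportional to
   [nu (z^2 - zeta^2)].  As [alpha <= 1/2], the square of [K] is convex, so the conjugate [nu] of an
   outward normal at [zeta^2] makes [Re X <= 0] on all of [K]: [S] is bounded on [K] and exponentially small
   inside, and [(1 - S) / (zeta - z)] is a polynomial in [z].  On [K] the integral is bounded
   independently of [n], because subtracting [1 / (zeta - z')] with [z'] just outside the lobe
   leaves a Poisson type kernel. *)

(** The exponents in part (ii) come from the sign of a cosine: the factor [exp (b r^k cos (k phi))]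
    must be at most 1 wherever only the bound by [M] is known. In the complementary sectors exponent
    2 achieves this, as [cos (2 phi) < 0] there; on the edges of a lobe, with decay known only on a
    compact arc strictly inside, it forces [k > 1 / alpha]. This leaves room below 2 exactly when
    [alpha > 1 / 2]. In part (i) the obstacle is the bound on [K]. Since
    [z^2 - zeta^2 = (z - zeta) (z + zeta)], the kernel has width about [1 / (n |z|)] away from 0 but
    [1 / sqrt n] near 0; shifting [z'] by [1 / (n |z| + sqrt n)] gives a Poisson type kernel of mass
    bounded in [n]. As [f] is only continuous up to the boundary, each lobe is first contracted into
    its interior, by an amount that the bounds do not see. Non-analyticity makes the best error
    positive, so that some polynomial lies within twice the best error and a correction of that
    order is admissible. *)

Lemma Cmod_minus_sym (x y : C) : Cmod (x - y) = Cmod (y - x).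
Proof. rewrite <- (Cmod_opp (x - y)); f_equal; ring. Qed.

Lemma Cmod_minus_le (x y : C) : Cmod (x - y) <= Cmod x + Cmod y.
Proof. unfold Cminus; rewrite <- (Cmod_opp y); apply Cmod_triangle. Qed.

Lemma Cmod_triangle_rev (x y : C) : Cmod x - Cmod y <= Cmod (x - y).
Proof.
  generalize (Cmod_triangle (x - y) y); replace (x - y + y)%C with x by ring; lra.
Qed.

Lemma Rabs_Im_le_Cmod (z : C) : Rabs (Im z) <= Cmod z.
Proof. eapply Rle_trans; [apply Rmax_r | apply (Rmax_Cmod z)]. Qed.

Lemma Re_le_Cmod (z : C) : Re z <= Cmod z.
Proof. eapply Rle_trans; [apply Rle_abs | apply re_le_Cmod]. Qed.

Lemma Cmod_le_Rabs (z : C) : Cmod z <= Rabs (Re z) + Rabs (Im z).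
Proof.
  assert (Hz : z = (RtoC (Re z) + Ci * RtoC (Im z))%C)
    by (destruct z; apply injective_projections; simpl; ring).
  rewrite Hz at 1.
  eapply Rle_trans; [apply Cmod_triangle |].
  rewrite Cmod_mult, Cmod_Ci, !Cmod_R; lra.
Qed.

Lemma Cmod_sqr (z : C) : Cmod z * Cmod z = Re z * Re z + Im z * Im z.
Proof. generalize (Cmod2_alt z); simpl; rewrite !Rmult_1_r; auto. Qed.

Lemma Cmod_le_of_sqr (z : C) (m : R) :
  0 <= m -> Re z * Re z + Im z * Im z <= m * m -> Cmod z <= m.
Proof. rewrite <- Cmod_sqr; intros; apply Rsqr_incr_0_var; auto. Qed.

Lemma Cmod_ge_of_sqr (z : C) (m : R) :
  m * m <= Re z * Re z + Im z * Im z -> m <= Cmod z.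
Proof.
  rewrite <- Cmod_sqr; intros; apply Rsqr_incr_0_var; auto; apply Cmod_ge_0.
Qed.

(** * Compact sets in the plane *)

Definition closed_set (D : C -> Prop) : Prop :=
  forall z, ~ D z -> exists d, 0 < d /\ forall w, Cmod (w - z) < d -> ~ D w.

Definition bounded_set (B : R) (D : C -> Prop) : Prop :=
  forall z, D z -> Cmod z <= B.

(** Compactness of a square for a gauge: points of [D] carry the radius supplied by the hypothesis,
    the others a radius whose disc misses [D]. [Q] is left free so that Lebesgue numbers, extreme
    values and open covers all follow from this one statement. *)
Lemma closed_bounded_cover (D : C -> Prop) (B : R) (Q : C -> R -> Prop) :
  closed_set D -> bounded_set B D ->
  (forall u, D u -> exists d, 0 < d /\ Q u d) ->
  exists l : list (C * R), forall z, D z ->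
    exists u d, In (u, d) l /\ D u /\ 0 < d /\ Q u d /\ Cmod (z - u) < d.
Proof.
  intros Hc Hb HQ.
  assert (Hd : forall u : C, exists d, 0 < d /\
      ((D u /\ Q u d) \/ forall w, Cmod (w - u) < d -> ~ D w)).
  { intros u. destruct (classic (D u)) as [Hu | Hu].
    - destruct (HQ u Hu) as (d & H1 & H2); exists d; auto.
    - destruct (Hc u Hu) as (d & H1 & H2); exists d; auto. }
  pose (del := fun u => proj1_sig (constructive_indefinite_description _ (Hd u))).
  assert (Hdel : forall u, 0 < del u /\
      ((D u /\ Q u (del u)) \/ forall w, Cmod (w - u) < del u -> ~ D w)).
  { intros u; unfold del.
    destruct (constructive_indefinite_description _ (Hd u)); auto. }
  assert (Hp : forall u, 0 < del u / 2) by (intros u; destruct (Hdel u); lra).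
  pose (dl := fun t : Compactness.Tn 2 R =>
    let '(x, (y, _)) := t in mkposreal (del (x, y) / 2) (Hp (x, y))).
  (* The finite family comes only under a double negation. The gauge is half of [del] because the
     two coordinate distances are added to bound the modulus. *)
  destruct (NNPP _ (compactness_list 2 (- B, (- B, tt)) (B, (B, tt)) dl)) as [l Hl].
  exists (map (fun t : Compactness.Tn 2 R =>
    let '(x, (y, _)) := t in ((x, y) : C, del (x, y))) l).
  intros [x y] Hz.
  assert (Hxy := Hb _ Hz).
  assert (Hx := re_le_Cmod (x, y)). assert (Hy := Rabs_Im_le_Cmod (x, y)).
  simpl in Hx, Hy. apply Rabs_le_between in Hx. apply Rabs_le_between in Hy.
  destruct (Hl (x, (y, tt))) as ([u [v []]] & Hin & _ & Hcl).
  { simpl; repeat split; lra. }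
  simpl in Hcl; destruct Hcl as (H1 & H2 & _).
  assert (Hm : Cmod ((x, y) - (u, v)) < del (u, v)).
  { eapply Rle_lt_trans; [apply Cmod_le_Rabs |]; simpl.
    replace (x + - u) with (x - u) by ring. replace (y + - v) with (y - v) by ring. lra. }
  destruct (Hdel (u, v)) as [H3 [[H4 H5] | H4]].
  - exists (u, v), (del (u, v)); repeat split; auto.
    apply in_map_iff; exists (u, (v, tt)); auto.
  - exfalso; exact (H4 _ Hm Hz).
Qed.

(** The minimum of the positive radii of the finite cover. In the applications the desired bound is
    encoded in [Q] as a condition on the radius. *)
Lemma lebesgue_number (D : C -> Prop) (B : R) (Q : C -> R -> Prop) :
  closed_set D -> bounded_set B D ->
  (forall u, D u -> exists d, 0 < d /\ Q u d) ->
  exists d0, 0 < d0 /\ forall z, D z ->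
    exists u d, D u /\ d0 <= d /\ Q u d /\ Cmod (z - u) < d.
Proof.
  intros Hc Hb HQ.
  destruct (closed_bounded_cover D B Q Hc Hb HQ) as [l Hl].
  assert (H : exists d0, 0 < d0 /\ forall (u : C) d, In (u, d) l -> 0 < d -> d0 <= d).
  { clear. induction l as [| [u d] l (d0 & H0 & H1)].
    - exists 1; split; [lra | intros u d []].
    - destruct (Rlt_dec 0 d) as [Hd | Hd].
      + exists (Rmin d0 d); split; [apply Rmin_pos; auto |].
        intros u' d' [E | E] Hd'; [injection E; intros; subst; apply Rmin_r |].
        eapply Rle_trans; [apply Rmin_l | eauto].
      + exists d0; split; auto. intros u' d' [E | E] Hd'; [| eauto].
        injection E; intros; subst; lra. }
  destruct H as (d0 & H0 & H1). exists d0; split; auto.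
  intros z Hz. destruct (Hl z Hz) as (u & d & H2 & H3 & H4 & H5 & H6).
  exists u, d; eauto 6.
Qed.

Definition cont_on_set (D : C -> Prop) (g : C -> R) : Prop :=
  forall z, D z -> forall eps, 0 < eps ->
    exists d, 0 < d /\ forall w, D w -> Cmod (w - z) < d -> Rabs (g w - g z) < eps.

Lemma cont_bounded (D : C -> Prop) (B : R) (g : C -> R) :
  closed_set D -> bounded_set B D -> cont_on_set D g ->
  exists M, 0 <= M /\ forall z, D z -> g z <= M.
Proof.
  intros Hc Hb Hg.
  (* Radii at most [/ (1 + |g u|)] turn a uniform lower bound on the radii into an upper bound on
     [g]. *)
  destruct (lebesgue_number D B (fun u d => d <= / (1 + Rabs (g u)) /\
     forall w, D w -> Cmod (w - u) < d -> g w <= g u + 1) Hc Hb) as (d0 & H0 & H1).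
  { intros u Hu. destruct (Hg u Hu 1 Rlt_0_1) as (d & Hd & H).
    assert (0 < / (1 + Rabs (g u)))
      by (apply Rinv_0_lt_compat; generalize (Rabs_pos (g u)); lra).
    exists (Rmin d (/ (1 + Rabs (g u)))); repeat split.
    - apply Rmin_pos; auto.
    - apply Rmin_r.
    - intros w Hw Hwd. assert (Hx : Cmod (w - u) < d)
        by (eapply Rlt_le_trans; [exact Hwd | apply Rmin_l]).
      generalize (Rle_abs (g w - g u)) (H w Hw Hx); lra. }
  assert (0 < / d0) by (apply Rinv_0_lt_compat; auto).
  exists (/ d0 + 1); split; [lra |]. intros z Hz.
  destruct (H1 z Hz) as (u & d & H2 & H3 & [H4 H5] & H6).
  assert (1 + Rabs (g u) <= / d0).
  { rewrite <- (Rinv_inv (1 + Rabs (g u))). apply Rinv_le_contravar; lra. }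
  generalize (H5 z Hz H6) (Rle_abs (g u)); lra.
Qed.

Lemma cont_max (D : C -> Prop) (B : R) (g : C -> R) (z1 : C) :
  closed_set D -> bounded_set B D -> cont_on_set D g -> D z1 ->
  exists z2, D z2 /\ forall z, D z -> g z <= g z2.
Proof.
  intros Hc Hb Hg Hz1.
  destruct (cont_bounded D B g Hc Hb Hg) as (M & HM0 & HM).
  destruct (completeness (fun y => exists z, D z /\ y = g z)) as [S [HS1 HS2]].
  { exists M; intros y (z & Hz & ->); auto. }
  { exists (g z1), z1; auto. }
  apply NNPP; intros HN.
  assert (HS : forall z, D z -> g z < S).
  { intros z Hz. destruct (Rle_lt_or_eq_dec (g z) S) as [|E]; auto.
    - apply HS1; exists z; auto.
    - exfalso; apply HN; exists z; split; auto.
      intros w Hw; rewrite E; apply HS1; exists w; auto. }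
  (* If the supremum [S] is not attained, radii at most [(S - g u) / 2] turn the Lebesgue number
     into a gap below [S]. *)
  destruct (lebesgue_number D B (fun u d => d <= (S - g u) / 2 /\
     forall w, D w -> Cmod (w - u) < d -> g w <= (S + g u) / 2) Hc Hb) as (d0 & H0 & H1).
  { intros u Hu. assert (Hs := HS u Hu).
    destruct (Hg u Hu ((S - g u) / 2)) as (d & Hd & H); [lra |].
    exists (Rmin d ((S - g u) / 2)); repeat split.
    - apply Rmin_pos; lra.
    - apply Rmin_r.
    - intros w Hw Hwd. assert (Hx : Cmod (w - u) < d)
        by (eapply Rlt_le_trans; [exact Hwd | apply Rmin_l]).
      generalize (Rle_abs (g w - g u)) (H w Hw Hx); lra. }
  assert (S <= S - d0); [| lra].
  apply HS2; intros y (z & Hz & ->).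
  destruct (H1 z Hz) as (u & d & H2 & H3 & [H4 H5] & H6).
  generalize (H5 z Hz H6); lra.
Qed.

(** The passage from explicit sets to the covering notion that [geometric_rate] quantifies over. *)
Lemma closed_bounded_compact (D : C -> Prop) (B : R) :
  closed_set D -> bounded_set B D -> compact_C D.
Proof.
  intros Hc Hb I U HU Hcov.
  destruct (closed_bounded_cover D B
    (fun u d => exists i, forall w, Cmod (w - u) < d -> U i w) Hc Hb) as [l Hl].
  { intros u Hu. destruct (Hcov u Hu) as [i Hi].
    destruct (HU i u Hi) as [d Hd]. exists d; split; [apply cond_pos |].
    exists i; intros w Hw; apply Hd. apply C_NormedModule_mixin_compat1; exact Hw. }
  assert (H : exists l' : list I, forall u d z, In (u, d) l -> 0 < d ->
     (exists i, forall w, Cmod (w - u) < d -> U i w) -> Cmod (z - u) < d ->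
     exists i, In i l' /\ U i z).
  { clear Hl. induction l as [| [u d] l [l' IH]].
    - exists nil; intros u d z [].
    - destruct (classic (exists i, forall w, Cmod (w - u) < d -> U i w)) as [[i Hi] | Hi].
      + exists (i :: l'). intros u' d' z [E | E] Hd Hex Hz.
        * injection E; intros; subst. exists i; simpl; auto.
        * destruct (IH u' d' z E Hd Hex Hz) as (j & Hj & Hj'); exists j; simpl; auto.
      + exists l'. intros u' d' z [E | E] Hd Hex Hz; [| eauto].
        injection E; intros; subst; contradiction. }
  destruct H as [l' Hl']. exists l'. intros z Hz.
  destruct (Hl z Hz) as (u & d & H1 & H2 & H3 & H4 & H5); eauto.
Qed.

(** * The maximum principle *)

Definition bounded_near_0 (r : C -> C) : Prop :=
  exists c d, 0 < d /\ forall h, Cmod h <= d -> Cmod (r h) <= c.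

Lemma bounded_near_0_const (a : C) : bounded_near_0 (fun _ => a).
Proof. exists (Cmod a), 1; split; [lra | intros; lra]. Qed.

Lemma bounded_near_0_id : bounded_near_0 (fun h => h).
Proof. exists 1, 1; split; [lra | auto]. Qed.

Lemma bounded_near_0_plus (r s : C -> C) :
  bounded_near_0 r -> bounded_near_0 s -> bounded_near_0 (fun h => r h + s h)%C.
Proof.
  intros (c & d & Hd & H) (c' & d' & Hd' & H').
  exists (c + c'), (Rmin d d'); split; [apply Rmin_pos; auto |].
  intros h Hh. eapply Rle_trans; [apply Cmod_triangle |].
  apply Rplus_le_compat; [apply H | apply H'];
    (eapply Rle_trans; [exact Hh |]); [apply Rmin_l | apply Rmin_r].
Qed.

Lemma bounded_near_0_mult (r s : C -> C) :
  bounded_near_0 r -> bounded_near_0 s -> bounded_near_0 (fun h => r h * s h)%C.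
Proof.
  intros (c & d & Hd & H) (c' & d' & Hd' & H').
  exists (c * c'), (Rmin d d'); split; [apply Rmin_pos; auto |].
  intros h Hh. rewrite Cmod_mult.
  apply Rmult_le_compat; try apply Cmod_ge_0; [apply H | apply H'];
    (eapply Rle_trans; [exact Hh |]); [apply Rmin_l | apply Rmin_r].
Qed.

Lemma bounded_near_0_comp (r s : C -> C) :
  bounded_near_0 r -> bounded_near_0 s -> bounded_near_0 (fun h => r (h * s h))%C.
Proof.
  intros (c & d & Hd & H) (c' & d' & Hd' & H').
  assert (Hc' : 0 <= c').
  { eapply Rle_trans; [apply Cmod_ge_0 | apply (H' 0%C)]; rewrite Cmod_0; lra. }
  exists c, (Rmin d' (d / (1 + c'))); split.
  { apply Rmin_pos; auto. apply Rdiv_lt_0_compat; lra. }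
  intros h Hh. apply H. rewrite Cmod_mult.
  assert (H1 : Cmod (s h) <= c') by
    (apply H'; eapply Rle_trans; [exact Hh | apply Rmin_l]).
  assert (H2 : Cmod h <= d / (1 + c')) by (eapply Rle_trans; [exact Hh | apply Rmin_r]).
  apply Rle_trans with (d / (1 + c') * (1 + c')).
  - apply Rmult_le_compat; try apply Cmod_ge_0; lra.
  - right; field; lra.
Qed.

Ltac bnd :=
  repeat first [ assumption | apply bounded_near_0_const | apply bounded_near_0_id
               | apply bounded_near_0_plus | apply bounded_near_0_mult ].

(** A second order complex expansion with cubic remainder. It is stable under products, polynomials
    and the exponential, and it is all the analyticity that the maximum principle uses. *)
Definition taylor3 (F : C -> C) (z : C) : Prop :=
  exists (a b : C) (r : C -> C), bounded_near_0 r /\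
    forall h, F (z + h)%C = (F z + a * h + b * h * h + h * h * h * r h)%C.

Lemma taylor3_ext (F G : C -> C) (z : C) :
  (forall w, F w = G w) -> taylor3 F z -> taylor3 G z.
Proof.
  intros E (a & b & r & H1 & H2); exists a, b, r; split; auto.
  intros h; rewrite <- !E; auto.
Qed.

Lemma taylor3_const (c z : C) : taylor3 (fun _ => c) z.
Proof. exists 0%C, 0%C, (fun _ => 0%C); split; [bnd | intros; ring]. Qed.

Lemma taylor3_id (z : C) : taylor3 (fun w => w) z.
Proof. exists 1%C, 0%C, (fun _ => 0%C); split; [bnd | intros; ring]. Qed.

Lemma taylor3_plus (F G : C -> C) (z : C) :
  taylor3 F z -> taylor3 G z -> taylor3 (fun w => F w + G w)%C z.
Proof.
  intros (a & b & r & H1 & H2) (a' & b' & r' & H1' & H2').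
  exists (a + a')%C, (b + b')%C, (fun h => r h + r' h)%C; split; [bnd |].
  intros h; rewrite H2, H2'; ring.
Qed.

Lemma taylor3_mult (F G : C -> C) (z : C) :
  taylor3 F z -> taylor3 G z -> taylor3 (fun w => F w * G w)%C z.
Proof.
  intros (a & b & r & H1 & H2) (a' & b' & r' & H1' & H2').
  exists (a * G z + F z * a')%C, (a * a' + b * G z + F z * b')%C,
    (fun h => a * b' + b * a' + h * (b * b') + r h * (G z + h * (a' + h * b'))
       + r' h * (F z + h * (a + h * b)) + h * h * h * (r h * r' h))%C; split; [bnd |].
  intros h; rewrite H2, H2'; ring.
Qed.

Lemma taylor3_pow (F : C -> C) (n : nat) (z : C) :
  taylor3 F z -> taylor3 (fun w => F w ^ n)%C z.
Proof.
  intros HF; induction n as [| n IH].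
  - apply taylor3_ext with (fun _ => 1%C); [reflexivity | apply taylor3_const].
  - apply taylor3_ext with (fun w => F w * F w ^ n)%C.
    + intros; rewrite Cpow_S; auto.
    + apply taylor3_mult; auto.
Qed.

(** * The complex exponential *)

Definition cexp (z : C) : C := (RtoC (exp (Re z)) * cis (Im z))%C.

Lemma cis_plus (s t : R) : cis (s + t) = (cis s * cis t)%C.
Proof.
  unfold cis; apply injective_projections; simpl; [rewrite cos_plus | rewrite sin_plus]; ring.
Qed.

Lemma Cmod_cis (t : R) : Cmod (cis t) = 1.
Proof.
  apply Rle_antisym; [apply Cmod_le_of_sqr | apply Cmod_ge_of_sqr]; simpl;
    generalize (sin2_cos2 t); unfold Rsqr; lra.
Qed.

Lemma cis_0 : cis 0 = 1%C.
Proof. unfold cis; rewrite cos_0, sin_0; reflexivity. Qed.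

Lemma cis_opp_mult (t : R) : (cis (- t) * cis t)%C = 1%C.
Proof. rewrite <- cis_plus, <- cis_0; f_equal; ring. Qed.

Lemma cexp_plus (z w : C) : cexp (z + w) = (cexp z * cexp w)%C.
Proof.
  unfold cexp; rewrite re_plus, im_plus, exp_plus, cis_plus, RtoC_mult; ring.
Qed.

Lemma Cmod_cexp (z : C) : Cmod (cexp z) = exp (Re z).
Proof.
  unfold cexp; rewrite Cmod_mult, Cmod_R, Cmod_cis, Rabs_pos_eq; [ring |].
  left; apply exp_pos.
Qed.

(** The mean value theorem raises the order of a bound by one and keeps its constant; iterated, it
    yields the elementary expansions of [exp], [sin] and [cos]. *)
Lemma Rabs_le_pow_of_derive (g dg : R -> R) (c x : R) (k : nat) :
  g 0 = 0 -> (forall t, is_derive g t (dg t)) -> 0 <= c ->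
  (forall t, Rabs t <= Rabs x -> Rabs (dg t) <= c * Rabs t ^ k) ->
  Rabs (g x) <= c * Rabs x ^ S k.
Proof.
  intros H0 Hd Hc Hb.
  destruct (MVT_gen g 0 x dg) as (y & Hy & E).
  { intros; auto. }
  { intros t _. apply derivable_continuous_pt. exists (dg t).
    apply is_derive_Reals; auto. }
  rewrite H0, !Rminus_0_r in E; rewrite E, Rabs_mult.
  assert (Hyx : Rabs y <= Rabs x).
  { revert Hy; unfold Rmin, Rmax, Rabs.
    destruct (Rle_dec 0 x), (Rcase_abs y), (Rcase_abs x); lra. }
  assert (H1 := Hb y Hyx). assert (H2 := pow_incr (Rabs y) (Rabs x) k (conj (Rabs_pos y) Hyx)).
  simpl. rewrite (Rmult_comm (Rabs x)), <- Rmult_assoc.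
  apply Rmult_le_compat_r; [apply Rabs_pos |].
  eapply Rle_trans; [exact H1 |]. apply Rmult_le_compat_l; auto.
Qed.

Lemma exp_taylor2 (x : R) :
  Rabs x <= 1 -> Rabs (exp x - (1 + x + x * x / 2)) <= 3 * Rabs x ^ 3.
Proof.
  intros Hx.
  apply (Rabs_le_pow_of_derive (fun x => exp x - (1 + x + x * x / 2))
    (fun x => exp x - (1 + x))).
  { rewrite exp_0; lra. } { intros t; auto_derive; auto; lra. } { lra. }
  intros t Ht. apply (Rabs_le_pow_of_derive (fun x => exp x - (1 + x)) (fun x => exp x - 1)).
  { rewrite exp_0; lra. } { intros; auto_derive; auto; lra. } { lra. }
  intros u Hu. apply (Rabs_le_pow_of_derive (fun x => exp x - 1) exp).
  { rewrite exp_0; lra. } { intros; auto_derive; auto; lra. } { lra. }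
  intros v Hv. simpl. rewrite Rabs_pos_eq by (left; apply exp_pos).
  rewrite Rmult_1_r. eapply Rle_trans; [| apply exp_le_3].
  assert (v <= 1) by (generalize (Rle_abs v); lra).
  destruct (Rle_lt_or_eq_dec v 1) as [|E]; auto.
  - left; apply exp_increasing; auto.
  - rewrite E; lra.
Qed.

Lemma sin_le_Rabs (x : R) : Rabs (sin x) <= Rabs x.
Proof.
  assert (H : Rabs (sin x) <= 1 * Rabs x ^ 1); [| simpl in H; lra].
  apply (Rabs_le_pow_of_derive sin cos); [apply sin_0 | | lra |].
  - intros; auto_derive; auto; ring.
  - intros; simpl; rewrite Rmult_1_r. apply Rabs_le; apply COS_bound.
Qed.

Lemma cos_taylor1 (x : R) : Rabs (cos x - 1) <= Rabs x ^ 2.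
Proof.
  assert (H : Rabs (cos x - 1) <= 1 * Rabs x ^ 2); [| lra].
  apply (Rabs_le_pow_of_derive (fun x => cos x - 1) (fun x => - sin x));
    [rewrite cos_0; ring | | lra |].
  - intros; auto_derive; auto; ring.
  - intros; rewrite Rabs_Ropp; simpl; generalize (sin_le_Rabs t); lra.
Qed.

Lemma sin_taylor2 (x : R) : Rabs (sin x - x) <= Rabs x ^ 3.
Proof.
  assert (H : Rabs (sin x - x) <= 1 * Rabs x ^ 3); [| lra].
  apply (Rabs_le_pow_of_derive (fun x => sin x - x) (fun x => cos x - 1));
    [rewrite sin_0; ring | | lra |].
  - intros; auto_derive; auto; ring.
  - intros; generalize (cos_taylor1 t); lra.
Qed.

Lemma cos_taylor2 (x : R) : Rabs (cos x - (1 - x * x / 2)) <= Rabs x ^ 4.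
Proof.
  assert (H : Rabs (cos x - (1 - x * x / 2)) <= 1 * Rabs x ^ 4); [| lra].
  apply (Rabs_le_pow_of_derive (fun x => cos x - (1 - x * x / 2)) (fun x => - (sin x - x)));
    [rewrite cos_0; field | | lra |].
  - intros; auto_derive; auto; field.
  - intros; rewrite Rabs_Ropp; generalize (sin_taylor2 t); lra.
Qed.

(** The real expansions of [exp], [cos] and [sin] are multiplied out so that every leftover term has
    order three. The constant is crude; only the order matters. *)
Lemma cexp_taylor2 (w : C) :
  Cmod w <= 1 -> Cmod (cexp w - (1 + w + w * w / 2)) <= 60 * Cmod w ^ 3.
Proof.
  intros Hw. set (m := Cmod w) in *.
  assert (Hm : 0 <= m) by apply Cmod_ge_0.
  destruct w as [x y].
  assert (Hx : Rabs x <= m) by apply (re_le_Cmod (x, y)).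
  assert (Hy : Rabs y <= m) by apply (Rabs_Im_le_Cmod (x, y)).
  assert (Ha : Rabs (exp x - (1 + x + x * x / 2)) <= 3 * m ^ 3).
  { eapply Rle_trans; [apply exp_taylor2; lra |].
    apply Rmult_le_compat_l; [lra |]. apply pow_incr; split; [apply Rabs_pos | auto]. }
  assert (Hb : Rabs (cos y - (1 - y * y / 2)) <= m ^ 3).
  { eapply Rle_trans; [apply cos_taylor2 |].
    apply Rle_trans with (m ^ 4); [apply pow_incr; split; [apply Rabs_pos | auto] |].
    assert (0 <= m ^ 3) by (apply pow_le; auto). simpl in *. nra. }
  assert (Hc : Rabs (sin y - y) <= m ^ 3).
  { eapply Rle_trans; [apply sin_taylor2 |]. apply pow_incr; split; [apply Rabs_pos | auto]. }
  set (a := exp x - (1 + x + x * x / 2)) in *.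
  set (b := cos y - (1 - y * y / 2)) in *.
  set (c := sin y - y) in *.
  assert (Hm3 : 0 <= m ^ 3 <= 1).
  { split; [apply pow_le; auto |]. rewrite <- (pow1 3); apply pow_incr; lra. }
  assert (Hxx : Rabs (x * x) <= m * m).
  { rewrite Rabs_mult; apply Rmult_le_compat; auto using Rabs_pos. }
  assert (Hyy : Rabs (y * y) <= m * m).
  { rewrite Rabs_mult; apply Rmult_le_compat; auto using Rabs_pos. }
  assert (Hm2 : m * m <= 1) by nra.
  assert (He : Rabs (1 + x + x * x / 2) <= 3).
  { apply Rabs_le. apply Rabs_le_between in Hx. apply Rabs_le_between in Hxx. lra. }
  eapply Rle_trans; [apply Cmod_le_Rabs |].
  assert (E1 : Re (cexp (x, y) - (1 + (x, y) + (x, y) * (x, y) / 2)) =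
     a * cos y + (1 + x + x * x / 2) * b - (x * (y * y) / 2 + x * x * (y * y) / 4)).
  { unfold cexp, cis, a, b; simpl. field. }
  assert (E2 : Im (cexp (x, y) - (1 + (x, y) + (x, y) * (x, y) / 2)) =
     a * sin y + (1 + x + x * x / 2) * c + x * x * y / 2).
  { unfold cexp, cis, a, c; simpl. field. }
  rewrite E1, E2.
  assert (Hca : Rabs (a * cos y) <= 3 * m ^ 3).
  { rewrite Rabs_mult. rewrite <- (Rmult_1_r (3 * m ^ 3)).
    apply Rmult_le_compat; auto using Rabs_pos. apply Rabs_le, COS_bound. }
  assert (Hsa : Rabs (a * sin y) <= 3 * m ^ 3).
  { rewrite Rabs_mult. rewrite <- (Rmult_1_r (3 * m ^ 3)).
    apply Rmult_le_compat; auto using Rabs_pos. apply Rabs_le, SIN_bound. }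
  assert (Hb' : Rabs ((1 + x + x * x / 2) * b) <= 3 * m ^ 3).
  { rewrite Rabs_mult. apply Rmult_le_compat; auto using Rabs_pos. }
  assert (Hc' : Rabs ((1 + x + x * x / 2) * c) <= 3 * m ^ 3).
  { rewrite Rabs_mult. apply Rmult_le_compat; auto using Rabs_pos. }
  assert (Hp1 : Rabs (x * (y * y)) <= m ^ 3).
  { rewrite Rabs_mult. simpl; rewrite Rmult_1_r.
    apply Rmult_le_compat; auto using Rabs_pos. }
  assert (Hp2 : Rabs (x * x * y) <= m ^ 3).
  { rewrite Rabs_mult. replace (m ^ 3) with (m * m * m) by ring.
    apply Rmult_le_compat; auto using Rabs_pos. }
  assert (Hp3 : Rabs (x * x * (y * y)) <= m ^ 3).
  { rewrite Rabs_mult. replace (m ^ 3) with (m * m * m) by ring.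
    apply Rmult_le_compat; auto using Rabs_pos. nra. }
  clearbody a b c.
  repeat match goal with H : Rabs _ <= _ |- _ => apply Rabs_le_between in H end.
  assert (forall u v p q : R, - p <= u <= p -> - q <= v <= q -> Rabs u + Rabs v <= p + q).
  { intros u v p q H1 H2. apply Rplus_le_compat; apply Rabs_le; auto. }
  apply Rle_trans with (30 * m ^ 3 + 30 * m ^ 3); [| lra].
  match goal with H : forall u v p q : R, _ |- _ => apply H; lra end.
Qed.

Lemma cexp_0 : cexp 0 = 1%C.
Proof. unfold cexp; simpl; rewrite exp_0, cis_0; ring. Qed.

Lemma taylor3_cexp (F : C -> C) (z : C) :
  taylor3 F z -> taylor3 (fun w => cexp (F w)) z.
Proof.
  intros (a & b & r & H1 & H2).
  (* The cubic quotient of the exponential. At 0 the numerator vanishes, so the quotient is 0 there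
     by convention, and [HEe] multiplies it by [w^3] anyway. *)
  set (E := fun w : C => ((cexp w - (1 + w + w * w / 2)) / (w * w * w))%C).
  assert (HE : bounded_near_0 E).
  { exists 60, 1; split; [lra |]. intros h Hh. unfold E.
    destruct (classic (h = 0%C)) as [-> | Hn].
    - replace (cexp 0 - (1 + 0 + 0 * 0 / 2))%C with (RtoC 0).
      + unfold Cdiv; rewrite !Cmult_0_l, Cmod_0; lra.
      + rewrite cexp_0; field.
    - assert (Hp := proj1 (Cmod_gt_0 _) Hn).
      assert (Hn3 : (h * h * h)%C <> 0%C) by (repeat apply Cmult_neq_0; auto).
      rewrite Cmod_div, !Cmod_mult by auto.
      apply Rle_div_l; [repeat apply Rmult_lt_0_compat; auto |].
      eapply Rle_trans; [apply cexp_taylor2; auto |]. simpl; lra. }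
  assert (HEe : forall w, cexp w = (1 + w + w * w / 2 + w * w * w * E w)%C).
  { intros w; unfold E. destruct (classic (w = 0%C)) as [-> | Hn].
    - rewrite cexp_0; unfold Cdiv; ring.
    - field; auto. }
  set (k := fun h : C => (a + h * b + h * h * r h)%C).
  assert (Hk : bounded_near_0 k) by (unfold k; bnd).
  assert (HEk : bounded_near_0 (fun h => E (h * k h)%C)) by (apply bounded_near_0_comp; auto).
  exists (cexp (F z) * a)%C, (cexp (F z) * (b + a * a / 2))%C,
    (fun h => cexp (F z) * (r h + (b + h * r h) * (a + k h) * (/ 2) + k h * k h * k h * E (h * k h)))%C.
  split.
  - clearbody E k; bnd.
  - intros h. rewrite H2.
    replace (F z + a * h + b * h * h + h * h * h * r h)%C with (F z + h * k h)%C by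
      (unfold k; ring).
    rewrite cexp_plus, (HEe (h * k h)%C).
    generalize (E (h * k h)%C); intros e. unfold k. field.
Qed.

Lemma taylor3_continuous (F : C -> C) (z : C) :
  taylor3 F z -> forall eps, 0 < eps ->
  exists d, 0 < d /\ forall w, Cmod (w - z) < d -> Cmod (F w - F z) < eps.
Proof.
  intros (a & b & r & H1 & H2) eps He.
  assert (Hk : bounded_near_0 (fun h => a + h * b + h * h * r h)%C) by bnd.
  destruct Hk as (c & d & Hd & Hk).
  assert (Hc : 0 <= c).
  { eapply Rle_trans; [apply Cmod_ge_0 | apply (Hk 0%C)]; rewrite Cmod_0; lra. }
  exists (Rmin d (eps / (1 + c))); split.
  { apply Rmin_pos; auto. apply Rdiv_lt_0_compat; lra. }
  intros w Hw. set (h := (w - z)%C) in *.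
  replace w with (z + h)%C by (unfold h; ring). rewrite H2.
  replace (_ - F z)%C with (h * (a + h * b + h * h * r h))%C by ring.
  rewrite Cmod_mult.
  assert (Hh1 : Cmod h <= d) by (left; eapply Rlt_le_trans; [exact Hw | apply Rmin_l]).
  assert (Hh2 : Cmod h < eps / (1 + c)) by (eapply Rlt_le_trans; [exact Hw | apply Rmin_r]).
  apply Rle_lt_trans with (Cmod h * (1 + c)).
  - apply Rmult_le_compat_l; [apply Cmod_ge_0 |]. generalize (Hk h Hh1); lra.
  - apply Rlt_div_r in Hh2; lra.
Qed.

(* Averaging over [h = d, -d, i d, -i d] kills the terms in [h] and [h^2] of a complex
   Taylor expansion, but not the increment of [eps |z|^2]; so [|F| + eps |z|^2] has no
   local maximum. *)
Lemma maximum_principle (D : C -> Prop) (B : R) (F : C -> C) (M : R) :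
  closed_set D -> bounded_set B D -> (forall z, taylor3 F z) ->
  (forall z, D z -> Cmod (F z) <= M \/
     exists d, 0 < d /\ forall w, Cmod (w - z) < d -> D w) ->
  forall z, D z -> Cmod (F z) <= M.
Proof.
  intros Hc Hb HT HD z1 Hz1. apply Rnot_lt_le; intros HM.
  assert (HB : 0 <= B) by (eapply Rle_trans; [apply Cmod_ge_0 | apply (Hb _ Hz1)]).
  (* So small that a maximum point of the perturbed function still has [|F| > M]; such a point has a
     whole disc inside [D]. *)
  set (eps := (Cmod (F z1) - M) / 2 / (B * B + 1)).
  assert (He : 0 < eps) by (unfold eps; apply Rdiv_lt_0_compat; nra).
  assert (HeB : eps * (B * B) < Cmod (F z1) - M).
  { apply Rle_lt_trans with (eps * (B * B + 1)); [nra |].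
    unfold eps; field_simplify; nra. }
  destruct (cont_max D B (fun z => Cmod (F z) + eps * (Cmod z * Cmod z)) z1)
    as (z2 & Hz2 & Hmax); auto.
  { intros z Hz e Hepos.
    destruct (taylor3_continuous F z (HT z) (e / 2)) as (d1 & Hd1 & H1); [lra |].
    assert (HT2 : taylor3 (fun w => RtoC eps * (w * w))%C z).
    { repeat apply taylor3_mult; auto using taylor3_const, taylor3_id. }
    destruct (taylor3_continuous _ z HT2 (e / 2)) as (d2 & Hd2 & H2); [lra |].
    exists (Rmin d1 d2); split; [apply Rmin_pos; auto |]. intros w Hw Hwz.
    assert (K1 := H1 w (Rlt_le_trans _ _ _ Hwz (Rmin_l _ _))).
    assert (K2 := H2 w (Rlt_le_trans _ _ _ Hwz (Rmin_r _ _))).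
    assert (L1 := Cmod_triangle_rev (F w) (F z)). assert (L2 := Cmod_triangle_rev (F z) (F w)).
    rewrite Cmod_minus_sym in L2.
    assert (L3 := Cmod_triangle_rev (eps * (w * w)) (eps * (z * z))).
    assert (L4 := Cmod_triangle_rev (eps * (z * z)) (eps * (w * w))).
    rewrite Cmod_minus_sym in L4. rewrite !Cmod_mult, Cmod_R, (Rabs_pos_eq eps) in L3, L4 by lra.
    apply Rabs_def1; lra. }
  assert (Hbig : M < Cmod (F z2)).
  { assert (H1 := Hmax z1 Hz1). assert (H2 := Hb z2 Hz2).
    assert (H3 : Cmod z2 * Cmod z2 <= B * B)
      by (apply Rmult_le_compat; auto using Cmod_ge_0).
    assert (0 <= Cmod z1 * Cmod z1) by (apply Rmult_le_pos; apply Cmod_ge_0). nra. }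
  destruct (HD z2 Hz2) as [H | (d & Hd & HI)]; [lra |].
  destruct (HT z2) as (a & b & r & (c & d' & Hd' & Hr) & HF).
  assert (Hc0 : 0 <= c).
  { eapply Rle_trans; [apply Cmod_ge_0 | apply (Hr 0%C)]; rewrite Cmod_0; lra. }
  (* The three bounds keep the four points in [D], control the remainder, and make the cubic error
     [4 c t^3] at most [2 eps t^2], half of the gain [4 eps t^2]. *)
  set (t := Rmin (Rmin (d / 2) d') (eps / (2 * (c + 1)))).
  assert (Ht : 0 < t).
  { repeat apply Rmin_pos; try lra. apply Rdiv_lt_0_compat; lra. }
  assert (Ht1 : t <= d / 2) by (eapply Rle_trans; [apply Rmin_l | apply Rmin_l]).
  assert (Ht2 : t <= d') by (eapply Rle_trans; [apply Rmin_l | apply Rmin_r]).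
  assert (Ht3 : t * (2 * (c + 1)) <= eps).
  { assert (H : t <= eps / (2 * (c + 1))) by apply Rmin_r.
    apply Rle_div_r in H; lra. }
  assert (Hstep : forall h, Cmod h = t ->
    Cmod (F (z2 + h)%C) + eps * (Cmod (z2 + h) * Cmod (z2 + h)) <=
      Cmod (F z2) + eps * (Cmod z2 * Cmod z2) /\ Cmod (r h) <= c).
  { intros h Hh; split; [apply Hmax, HI | apply Hr; lra].
    replace (z2 + h - z2)%C with h by ring. lra. }
  assert (HtR : Cmod (RtoC t) = t) by (rewrite Cmod_R; apply Rabs_pos_eq; lra).
  assert (HtI : Cmod (Ci * RtoC t) = t) by (rewrite Cmod_mult, Cmod_Ci, HtR; ring).
  destruct (Hstep (RtoC t)) as [S1 R1]; auto.
  destruct (Hstep (- RtoC t)%C) as [S2 R2]; [rewrite Cmod_opp; auto |].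
  destruct (Hstep (Ci * RtoC t)%C) as [S3 R3]; auto.
  destruct (Hstep (- (Ci * RtoC t))%C) as [S4 R4]; [rewrite Cmod_opp; auto |].
  assert (HS : 4 * Cmod (F z2) <= Cmod (F (z2 + RtoC t)%C) + Cmod (F (z2 + - RtoC t)%C) +
    Cmod (F (z2 + Ci * RtoC t)%C) + Cmod (F (z2 + - (Ci * RtoC t))%C) + 4 * c * (t * t * t)).
  { assert (E : (RtoC 4 * F z2)%C = (F (z2 + RtoC t) + F (z2 + - RtoC t) + F (z2 + Ci * RtoC t) +
       F (z2 + - (Ci * RtoC t)) + (RtoC t * RtoC t * RtoC t) *
       (- r (RtoC t) + r (- RtoC t) + Ci * r (Ci * RtoC t) - Ci * r (- (Ci * RtoC t))))%C).
    { rewrite !HF.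
      generalize (r (RtoC t)) (r (- RtoC t)%C) (r (Ci * RtoC t)%C) (r (- (Ci * RtoC t))%C) (F z2).
      intros. clear. apply injective_projections; simpl; ring. }
    apply (f_equal Cmod) in E. rewrite Cmod_mult, Cmod_R, Rabs_pos_eq in E by lra.
    rewrite E.
    eapply Rle_trans; [apply Cmod_triangle |].
    apply Rplus_le_compat.
    - eapply Rle_trans; [apply Cmod_triangle |]. apply Rplus_le_compat_r.
      eapply Rle_trans; [apply Cmod_triangle |]. apply Rplus_le_compat_r.
      apply Cmod_triangle.
    - rewrite !Cmod_mult, HtR, (Rmult_comm (4 * c)).
      apply Rmult_le_compat_l; [repeat apply Rmult_le_pos; lra |].
      eapply Rle_trans; [apply Cmod_minus_le |].
      rewrite Cmod_mult, Cmod_Ci.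
      assert (Q1 := Cmod_triangle (- r (RtoC t) + r (- RtoC t))%C (Ci * r (Ci * RtoC t))%C).
      assert (Q2 := Cmod_triangle (- r (RtoC t))%C (r (- RtoC t)%C)).
      rewrite Cmod_mult, Cmod_Ci in Q1. rewrite Cmod_opp in Q2. lra. }
  assert (HN : Cmod (z2 + RtoC t) * Cmod (z2 + RtoC t) + Cmod (z2 + - RtoC t) * Cmod (z2 + - RtoC t)
    + Cmod (z2 + Ci * RtoC t) * Cmod (z2 + Ci * RtoC t)
    + Cmod (z2 + - (Ci * RtoC t)) * Cmod (z2 + - (Ci * RtoC t)) =
    4 * (Cmod z2 * Cmod z2) + 4 * (t * t)).
  { rewrite !Cmod_sqr; unfold Re, Im; simpl; ring. }
  assert (c * (t * t * t) <= eps / 2 * (t * t)).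
  { replace (c * (t * t * t)) with ((c * t) * (t * t)) by ring.
    apply Rmult_le_compat_r; nra. }
  assert (0 < eps * (t * t)) by (apply Rmult_lt_0_compat; [lra | apply Rmult_lt_0_compat; lra]).
  nra.
Qed.

(** * Polynomials *)

Lemma sum_n_C_0 (u : nat -> C) : (sum_n u 0 : C) = u 0%nat.
Proof. apply sum_O. Qed.

Lemma sum_n_C_S (u : nat -> C) (n : nat) : (sum_n u (S n) : C) = (sum_n u n + u (S n))%C.
Proof. apply (sum_Sn u n). Qed.

Lemma sum_n_C_scal (c : C) (u : nat -> C) (n : nat) :
  (sum_n (fun k => c * u k)%C n : C) = (c * sum_n u n)%C.
Proof.
  induction n as [| n IH]; [rewrite !sum_n_C_0; auto |].
  rewrite !sum_n_C_S, IH; ring.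
Qed.

Lemma sum_n_C_ext (u v : nat -> C) (n : nat) :
  (forall k, (k <= n)%nat -> u k = v k) -> (sum_n u n : C) = sum_n v n.
Proof.
  induction n as [| n IH]; intros H.
  - rewrite !sum_n_C_0; apply H; auto.
  - rewrite !sum_n_C_S, IH, (H (S n)); auto.
Qed.

Lemma sum_n_C_shift (u : nat -> C) (n : nat) :
  (sum_n u (S n) : C) = (u 0%nat + sum_n (fun k => u (S k)) n)%C.
Proof.
  induction n as [| n IH].
  - rewrite sum_n_C_S, !sum_n_C_0; auto.
  - rewrite sum_n_C_S, IH, sum_n_C_S; ring.
Qed.

Lemma poly_le_ext (n : nat) (P Q : C -> C) :
  (forall z, P z = Q z) -> poly_le n P -> poly_le n Q.
Proof. intros E [a Ha]; exists a; intros z; rewrite <- E; auto. Qed.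

Lemma poly_le_0_inv (P : C -> C) : poly_le 0 P -> exists c, forall z, P z = c.
Proof.
  intros [a Ha]; exists (a 0%nat); intros z. rewrite Ha, sum_n_C_0; simpl; ring.
Qed.

Lemma poly_le_S_inv (n : nat) (P : C -> C) : poly_le (S n) P ->
  exists c Q, poly_le n Q /\ forall z, P z = (c + z * Q z)%C.
Proof.
  intros [a Ha]. exists (a 0%nat), (fun z => sum_n (fun k => a (S k) * z ^ k)%C n).
  split; [exists (fun k => a (S k)); auto |].
  intros z. rewrite Ha, sum_n_C_shift, <- sum_n_C_scal. f_equal; [simpl; ring |].
  apply sum_n_C_ext; intros; rewrite Cpow_S; ring.
Qed.

Lemma poly_le_const_0 (c : C) : poly_le 0 (fun _ => c).
Proof. exists (fun _ => c); intros z; rewrite sum_n_C_0; simpl; ring. Qed.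

Lemma poly_le_cons (n : nat) (c : C) (Q : C -> C) :
  poly_le n Q -> poly_le (S n) (fun z => c + z * Q z)%C.
Proof.
  intros [a Ha]. exists (fun k => match k with O => c | S k => a k end). intros z.
  rewrite sum_n_C_shift, Ha, <- sum_n_C_scal. f_equal; [simpl; ring |].
  apply sum_n_C_ext; intros; rewrite Cpow_S; ring.
Qed.

(** Induction along Horner's scheme. The first premise, invariance under pointwise equality, stands
    in for functional extensionality. *)
Lemma poly_le_ind (I : nat -> (C -> C) -> Prop) :
  (forall n P Q, (forall z, P z = Q z) -> I n P -> I n Q) ->
  (forall c, I 0%nat (fun _ => c)) ->
  (forall n c Q, poly_le n Q -> I n Q -> I (S n) (fun z => c + z * Q z)%C) ->
  forall n P, poly_le n P -> I n P.
Proof.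
  intros HE H0 HS n. induction n as [| n IH]; intros P HP.
  - destruct (poly_le_0_inv P HP) as [c Hc].
    apply HE with (fun _ => c); auto.
  - destruct (poly_le_S_inv n P HP) as (c & Q & HQ & E).
    apply HE with (fun z => c + z * Q z)%C; auto.
Qed.

Lemma poly_le_const (n : nat) (c : C) : poly_le n (fun _ => c).
Proof.
  revert c; induction n as [| n IH]; intros c; [apply poly_le_const_0 |].
  apply poly_le_ext with (fun z => c + z * 0)%C; [intros; ring |].
  apply poly_le_cons; auto.
Qed.

Lemma poly_le_S (n : nat) (P : C -> C) : poly_le n P -> poly_le (S n) P.
Proof.
  revert n P; apply poly_le_ind.
  - intros n P Q E; apply poly_le_ext; auto.
  - apply poly_le_const.
  - intros; apply poly_le_cons; auto.
Qed.

Lemma poly_le_mono (n m : nat) (P : C -> C) : (n <= m)%nat -> poly_le n P -> poly_le m P.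
Proof. induction 1; auto using poly_le_S. Qed.

Lemma poly_le_plus (n : nat) (P Q : C -> C) :
  poly_le n P -> poly_le n Q -> poly_le n (fun z => P z + Q z)%C.
Proof.
  intros HP; revert n P HP Q; apply (poly_le_ind (fun n P => forall Q, poly_le n Q ->
    poly_le n (fun z => P z + Q z)%C)).
  - intros n P P' E H Q HQ. eapply poly_le_ext; [| apply H, HQ].
    intros; simpl; rewrite E; auto.
  - intros c Q HQ. destruct (poly_le_0_inv Q HQ) as [c' Hc'].
    apply poly_le_ext with (fun _ => c + c')%C; [intros; rewrite Hc'; auto |].
    apply poly_le_const.
  - intros n c P HP IH Q HQ. destruct (poly_le_S_inv n Q HQ) as (c' & Q' & HQ' & E).
    apply poly_le_ext with (fun z => (c + c') + z * (P z + Q' z))%C;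
      [intros; rewrite E; ring |].
    apply poly_le_cons; auto.
Qed.

Lemma poly_le_scal (n : nat) (c : C) (P : C -> C) :
  poly_le n P -> poly_le n (fun z => c * P z)%C.
Proof.
  intros [a Ha]; exists (fun k => c * a k)%C; intros z.
  rewrite Ha, <- sum_n_C_scal; apply sum_n_C_ext; intros; ring.
Qed.

Lemma poly_le_minus (n : nat) (P Q : C -> C) :
  poly_le n P -> poly_le n Q -> poly_le n (fun z => P z - Q z)%C.
Proof.
  intros HP HQ. apply poly_le_ext with (fun z => P z + (- (1)) * Q z)%C; [intros; ring |].
  auto using poly_le_plus, poly_le_scal.
Qed.

Lemma poly_le_mult (n m : nat) (P Q : C -> C) :
  poly_le n P -> poly_le m Q -> poly_le (n + m) (fun z => P z * Q z)%C.
Proof.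
  intros HP HQ; revert n P HP; apply poly_le_ind.
  - intros n P P' E H. eapply poly_le_ext; [| apply H].
    intros; simpl; rewrite E; auto.
  - intros c; apply poly_le_scal; auto.
  - intros n c P HP IH.
    apply poly_le_ext with (fun z => c * Q z + (0 + z * (P z * Q z)))%C; [intros; ring |].
    apply poly_le_plus.
    + apply poly_le_mono with m; [lia |]; apply poly_le_scal; auto.
    + apply (poly_le_cons (n + m)); auto.
Qed.

Lemma poly_le_affine (a b : C) : poly_le 1 (fun z => a + b * z)%C.
Proof.
  apply poly_le_ext with (fun z => a + z * b)%C; [intros; ring |].
  apply poly_le_cons, poly_le_const.
Qed.

Lemma poly_le_comp_affine (a b : C) (n : nat) (P : C -> C) :
  poly_le n P -> poly_le n (fun z => P (a + b * z)%C).
Proof.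
  revert n P; apply poly_le_ind.
  - intros n P Q E; apply poly_le_ext; auto.
  - intros; apply poly_le_const.
  - intros n c Q _ IH.
    apply poly_le_plus; [apply poly_le_const |].
    apply (poly_le_mult 1 n); auto using poly_le_affine.
Qed.

Lemma poly_le_opp (n : nat) (P : C -> C) : poly_le n P -> poly_le n (fun z => P (- z)%C).
Proof.
  intros HP. apply poly_le_ext with (fun z => P (0 + - (1) * z)%C);
    [intros; f_equal; ring | apply poly_le_comp_affine; auto].
Qed.

Lemma poly_le_pow (n m : nat) (P : C -> C) :
  poly_le n P -> poly_le (m * n) (fun z => P z ^ m)%C.
Proof.
  intros HP; induction m as [| m IH]; simpl; [apply poly_le_const |].
  apply poly_le_mult; auto.
Qed.

Lemma poly_le_taylor3 (F : C -> C) (z : C) (n : nat) (P : C -> C) :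
  poly_le n P -> taylor3 F z -> taylor3 (fun w => P (F w)) z.
Proof.
  intros HP HF; revert n P HP; apply poly_le_ind.
  - intros n P Q E; apply taylor3_ext; auto.
  - intros; apply taylor3_const.
  - intros; apply taylor3_plus; [apply taylor3_const | apply taylor3_mult; auto].
Qed.

Lemma poly_le_continuous (n : nat) (P : C -> C) (z : C) : poly_le n P ->
  forall eps, 0 < eps ->
  exists d, 0 < d /\ forall w, Cmod (w - z) < d -> Cmod (P w - P z) < eps.
Proof.
  intros HP; apply taylor3_continuous.
  apply (poly_le_taylor3 (fun w => w) z n P); auto using taylor3_id.
Qed.

Lemma poly_le_factor (a : C) (n : nat) (P : C -> C) : poly_le (S n) P ->
  exists Q, poly_le n Q /\ forall z, P z = (P a + (z - a) * Q z)%C.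
Proof.
  revert P; induction n as [| n IH]; intros P HP;
    destruct (poly_le_S_inv _ _ HP) as (c & Q & HQ & E).
  - destruct (poly_le_0_inv Q HQ) as [c' Hc'].
    exists (fun _ => c'); split; [apply poly_le_const |].
    intros z; rewrite !E, !Hc'; ring.
  - destruct (IH Q HQ) as (Q' & HQ' & E').
    exists (fun z => Q a + z * Q' z)%C; split; [apply poly_le_cons; auto |].
    intros z; rewrite !E, (E' z); ring.
Qed.

(** Lagrange's formula, obtained by adding one node [b] through [P = P b + (z - b) Q]. It determines
    a polynomial from finitely many values, which handles both integrals of polynomials over a
    parameter and functions approximated arbitrarily well in a fixed degree. *)
Lemma poly_le_interpolation (x : nat -> C) (n : nat) :
  (forall i j, i <> j -> x i <> x j) ->
  exists l : nat -> C -> C, (forall i, poly_le n (l i)) /\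
    forall P z, poly_le n P -> P z = sum_n (fun i => P (x i) * l i z)%C n.
Proof.
  intros Hx; induction n as [| n (l & Hl & IH)].
  - exists (fun _ _ => 1%C); split; [intros; apply poly_le_const |].
    intros P z HP. destruct (poly_le_0_inv P HP) as [c Hc].
    rewrite sum_n_C_0, !Hc; ring.
  - pose (b := x (S n)).
    pose (m := fun i z => (/ (x i - b) * ((z - b) * l i z))%C).
    assert (Hm : forall i, poly_le (S n) (m i)).
    { intros i; apply poly_le_scal, (poly_le_mult 1 n); auto.
      apply poly_le_ext with (fun z => - b + 1 * z)%C; [intros; ring | apply poly_le_affine]. }
    (* The basis function of the new node is one minus the sum of the others, because constants must
       be reproduced. *)
    exists (fun i => if Nat.leb i n then m i else
      fun z => 1 - sum_n (fun j => m j z) n)%C; split.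
    + intros i; destruct (Nat.leb i n); auto.
      apply poly_le_minus; [apply poly_le_const |].
      generalize n at 2; intros k; induction k as [| k IHk].
      * eapply poly_le_ext; [| apply (Hm 0%nat)]; intros; rewrite sum_n_C_0; auto.
      * apply poly_le_ext with (fun z => sum_n (fun j => m j z) k + m (S k) z)%C;
          [intros; rewrite sum_n_C_S; auto | apply poly_le_plus; auto].
    + intros P z HP. destruct (poly_le_factor b n P HP) as (Q & HQ & E).
      rewrite sum_n_C_S.
      replace (Nat.leb (S n) n) with false by (symmetry; apply Nat.leb_gt; lia).
      rewrite (sum_n_C_ext _ (fun i => P (x i) * m i z)%C).
      2:{ intros i Hi; replace (Nat.leb i n) with true by (symmetry; apply Nat.leb_le; lia); auto. }
      rewrite (E z), (IH Q z HQ), <- sum_n_C_scal.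
      rewrite (sum_n_C_ext (fun k => (z - b) * (Q (x k) * l k z))%C
        (fun i => P (x i) * m i z + (- P b) * m i z)%C).
      * assert (HH : forall u v : nat -> C, forall k, (sum_n (fun i => u i + v i)%C k : C) =
          (sum_n u k + sum_n v k)%C).
        { intros u v k; induction k as [| k IHk]; [rewrite !sum_n_C_0; auto |].
          rewrite !sum_n_C_S, IHk; ring. }
        rewrite HH, sum_n_C_scal; unfold b; ring.
      * intros i Hi. unfold m. rewrite (E (x i)).
        assert (Hb0 : (x i - b)%C <> RtoC 0).
        { intros H0. apply (Hx i (S n)); [lia |].
          replace (x i) with (x i - b + b)%C by ring. rewrite H0; unfold b; ring. }
        field; auto.
Qed.

(** The reversed polynomial extends [w^n P (1 / w)] across 0, which carries the exterior of a disc
    to a bounded domain for the maximum principle. *)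
Lemma poly_le_reverse (n : nat) (P : C -> C) : poly_le n P ->
  exists Q, (forall z, taylor3 Q z) /\
    forall w : C, w <> 0%C -> Q w = (w ^ n * P (/ w))%C.
Proof.
  revert n P; apply poly_le_ind.
  - intros n P P' E (Q & H1 & H2); exists Q; split; auto.
    intros; rewrite <- E; auto.
  - intros c; exists (fun _ => c); split; [intros; apply taylor3_const |].
    intros; simpl; ring.
  - intros n c P HP (Q & H1 & H2). exists (fun w => c * w ^ S n + Q w)%C; split.
    + intros z; apply taylor3_plus; auto.
      apply taylor3_mult; auto using taylor3_const, taylor3_pow, taylor3_id.
    + intros w Hw; rewrite H2 by auto. rewrite Cpow_S. field; auto.
Qed.

(** * Lipschitz functions, discs and growth outside a disc *)

Definition lipschitz_C (g : C -> R) (k : R) : Prop :=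
  forall z w, g w <= g z + k * Cmod (w - z).

Lemma lipschitz_lt_near (g : C -> R) (k c : R) (z : C) :
  lipschitz_C g k -> g z < c ->
  exists d, 0 < d /\ forall w, Cmod (w - z) < d -> g w < c.
Proof.
  intros Hg Hz. exists ((c - g z) / (Rabs k + 1)); split.
  { apply Rdiv_lt_0_compat; [lra |]. generalize (Rabs_pos k); lra. }
  intros w Hw. assert (H := Hg z w). assert (Hk := Rabs_pos k). assert (Hk' := Rle_abs k).
  assert (H0 := Cmod_ge_0 (w - z)). apply Rlt_div_r in Hw; nra.
Qed.

Lemma lipschitz_closed (g : C -> R) (k c : R) :
  lipschitz_C g k -> closed_set (fun z => g z <= c).
Proof.
  intros Hg z Hz.
  destruct (lipschitz_lt_near (fun w => - g w) k (- c) z) as (d & Hd & H).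
  - intros u w. assert (Q := Hg w u). rewrite Cmod_minus_sym in Q. lra.
  - lra.
  - exists d; split; auto. intros w Hw; generalize (H w Hw); lra.
Qed.

Lemma closed_set_and (D E : C -> Prop) :
  closed_set D -> closed_set E -> closed_set (fun z => D z /\ E z).
Proof.
  intros HD HE z Hz. destruct (classic (D z)) as [H | H].
  - destruct (HE z) as (d & Hd & Hw); [tauto |].
    exists d; split; auto. intros w H1 [_ H2]; exact (Hw w H1 H2).
  - destruct (HD z H) as (d & Hd & Hw).
    exists d; split; auto. intros w H1 [H2 _]; exact (Hw w H1 H2).
Qed.

Lemma lipschitz_dist (a : C) : lipschitz_C (fun z => Cmod (z - a)) 1.
Proof.
  intros z w. rewrite Rmult_1_l.
  replace (w - a)%C with ((z - a) + (w - z))%C by ring. apply Cmod_triangle.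
Qed.

(* The linear form [z |-> Re (a z)] subsumes half-planes in any direction. *)
Lemma lipschitz_linear (a : C) : lipschitz_C (fun z => Re (a * z)) (Cmod a).
Proof.
  intros z w. rewrite <- Cmod_mult.
  replace (a * w)%C with (a * z + a * (w - z))%C by ring.
  rewrite re_plus. generalize (Re_le_Cmod (a * (w - z))%C); lra.
Qed.

Lemma maximum_principle_disc (F : C -> C) (a : C) (b M : R) :
  (forall z, taylor3 F z) -> (forall z, Cmod (z - a) = b -> Cmod (F z) <= M) ->
  forall z, Cmod (z - a) <= b -> Cmod (F z) <= M.
Proof.
  intros HF HM. apply (maximum_principle (fun z => Cmod (z - a) <= b) (b + Cmod a)); auto.
  - apply (lipschitz_closed _ 1), lipschitz_dist.
  - intros z Hz. replace z with ((z - a) + a)%C by ring.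
    eapply Rle_trans; [apply Cmod_triangle | lra].
  - intros z Hz. destruct (Rle_lt_or_eq_dec _ _ Hz) as [H | H]; [right | left; auto].
    destruct (lipschitz_lt_near _ 1 b z (lipschitz_dist a) H) as (d & Hd & Hw).
    exists d; split; auto. intros w Hwz; left; auto.
Qed.

(** The Bernstein-Walsh inequality for a disc: the reversed polynomial is at most [M] on the unit
    circle, hence also at [b / (z - a)]. *)
Lemma bernstein_walsh_disc (n : nat) (P : C -> C) (a : C) (b M : R) :
  poly_le n P -> 0 < b -> (forall z, Cmod (z - a) <= b -> Cmod (P z) <= M) ->
  forall z, b <= Cmod (z - a) -> Cmod (P z) <= M * (Cmod (z - a) / b) ^ n.
Proof.
  intros HP Hb HM z Hz.
  destruct (poly_le_reverse n (fun u => P (a + b * u)%C)) as (Q & HQ & E).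
  { apply poly_le_comp_affine; auto. }
  assert (Hza : (z - a)%C <> RtoC 0) by (apply Cmod_gt_0; lra).
  assert (Hb0 : RtoC b <> 0%C) by (intros H; apply (f_equal fst) in H; simpl in H; lra).
  assert (HbR : Cmod (RtoC b) = b) by (rewrite Cmod_R; apply Rabs_pos_eq; lra).
  set (w := (b / (z - a))%C).
  assert (Hw0 : w <> 0%C).
  { unfold w; intros H. apply (f_equal Cmod) in H.
    rewrite Cmod_div, HbR, Cmod_0 in H by auto.
    apply Rdiv_lt_0_compat with (r1 := b) (r2 := Cmod (z - a)) in Hb; lra. }
  assert (Hw : Cmod w = b / Cmod (z - a)) by (unfold w; rewrite Cmod_div, HbR; auto).
  assert (HQw : Cmod (Q w) <= M).
  { apply (maximum_principle_disc Q 0 1); auto.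
    - intros u Hu. replace (u - 0)%C with u in Hu by ring.
      assert (Hu0 : u <> 0%C) by (apply Cmod_gt_0; lra).
      rewrite E, Cmod_mult, Cmod_pow, Hu, pow1, Rmult_1_l by auto.
      apply HM. replace (a + b * / u - a)%C with (b * / u)%C by ring.
      rewrite Cmod_mult, HbR, Cmod_inv, Hu by auto. lra.
    - replace (w - 0)%C with w by ring. rewrite Hw. apply Rle_div_l; lra. }
  rewrite E in HQw by auto.
  replace (a + b * / w)%C with z in HQw by (unfold w; field; auto).
  rewrite Cmod_mult, Cmod_pow, Hw in HQw.
  apply Rmult_le_reg_l with ((b / Cmod (z - a)) ^ n).
  - apply pow_lt, Rdiv_lt_0_compat; lra.
  - eapply Rle_trans; [exact HQw |]. right.
    replace (_ * (M * _)) with (M * ((b / Cmod (z - a)) ^ n * (Cmod (z - a) / b) ^ n)) by ring.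
    rewrite <- Rpow_mult_distr.
    replace (b / Cmod (z - a) * (Cmod (z - a) / b)) with 1 by (field; lra).
    rewrite pow1; ring.
Qed.

Lemma locally_C_Cmod (X : C -> Prop) (z : C) :
  locally (T := C_UniformSpace) z X <->
  exists d, 0 < d /\ forall w, Cmod (w - z) < d -> X w.
Proof.
  split.
  - intros [d Hd]; exists d; split; [apply cond_pos |]. intros w Hw; apply Hd.
    apply C_NormedModule_mixin_compat1; exact Hw.
  (* Balls of the uniform structure are squares, so a factor [sqrt 2 <= 2] is lost. *)
  - intros (d & Hd & H). assert (Hd2 : 0 < d / 2) by lra.
    exists (mkposreal _ Hd2). intros w Hw; apply H.
    apply C_NormedModule_mixin_compat2 in Hw; simpl in Hw.
    assert (Hs : sqrt 2 <= 2).
    { rewrite <- (sqrt_square 2) at 2 by lra. apply sqrt_le_1; lra. }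
    eapply Rlt_le_trans; [exact Hw | nra].
Qed.

(** * Sectors *)

(** The sector [|arg z| <= t] written without arguments: 0 belongs to it, and for [0 < t < PI / 2]
    it is a disc cut by two half-planes. *)
Definition sector (t rad : R) (z : C) : Prop :=
  Rabs (Im z) * cos t <= Re z * sin t /\ Cmod z <= rad.

Definition open_sector (t rad : R) (z : C) : Prop :=
  Rabs (Im z) * cos t < Re z * sin t /\ Cmod z < rad.

Lemma polar_right (z : C) :
  0 < Re z -> z = (RtoC (Cmod z) * cis (atan (Im z / Re z)))%C.
Proof.
  intros Hx. set (x := Re z) in *. set (y := Im z).
  assert (Hs : sqrt (1 + (y / x)²) = Cmod z / x).
  { apply sqrt_lem_1.
    - generalize (Rle_0_sqr (y / x)); lra.
    - apply Rdiv_le_0_compat; [apply Cmod_ge_0 | lra].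
    - replace (Cmod z / x * (Cmod z / x)) with (Cmod z * Cmod z / (x * x)) by (field; lra).
      rewrite Cmod_sqr. fold x y. unfold Rsqr; field; lra. }
  assert (Hz : 0 < Cmod z) by (eapply Rlt_le_trans; [exact Hx | apply Re_le_Cmod]).
  unfold cis. rewrite cos_atan, sin_atan, Hs.
  apply injective_projections; simpl; [change (fst z) with x | change (snd z) with y];
    field; lra.
Qed.

Lemma Rabs_atan_le (x t : R) : 0 < t < PI / 2 -> Rabs x * cos t <= sin t -> Rabs (atan x) <= t.
Proof.
  intros Ht Hx.
  assert (Hc : 0 < cos t) by (apply cos_gt_0; lra).
  assert (Hm : forall y, y <= tan t -> atan y <= t).
  { intros y Hy. rewrite <- (atan_tan t) by lra.
    destruct (Rle_lt_or_eq_dec _ _ Hy) as [H | H];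
      [left; apply atan_increasing; auto | rewrite H; lra]. }
  assert (Hb : Rabs x <= tan t) by (unfold tan; apply Rle_div_r; auto).
  apply Rabs_le_between in Hb. apply Rabs_le; split.
  - rewrite <- (Ropp_involutive (atan x)), <- atan_opp. apply Ropp_le_contravar, Hm; lra.
  - apply Hm; lra.
Qed.

Lemma sector_pos (t rad : R) (z : C) :
  0 < t < PI / 2 -> sector t rad z -> z <> 0%C -> 0 < Re z.
Proof.
  intros Ht [H _] Hz.
  assert (0 < cos t) by (apply cos_gt_0; lra).
  assert (0 < sin t) by (apply sin_gt_0; lra).
  apply Rnot_le_lt; intros Hx. apply Hz.
  assert (Hy := Rabs_pos (Im z)).
  assert (Hx0 : Re z = 0) by nra.
  assert (Hy0 : Rabs (Im z) = 0) by nra.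
  apply injective_projections; [exact Hx0 |].
  simpl. change (Im z = 0). destruct (Req_dec (Im z) 0) as [|Hn]; auto.
  apply Rabs_no_R0 in Hn; contradiction.
Qed.

Lemma sector_polar (t rad : R) (z : C) : 0 < t < PI / 2 -> sector t rad z <->
  exists r phi, 0 <= r <= rad /\ Rabs phi <= t /\ z = (RtoC r * cis phi)%C.
Proof.
  intros Ht.
  assert (Hc : 0 < cos t) by (apply cos_gt_0; lra).
  assert (Hs : 0 < sin t) by (apply sin_gt_0; lra).
  split.
  - intros Hz. destruct (classic (z = 0%C)) as [-> | Hn].
    + destruct Hz as [_ Hz]; rewrite Cmod_0 in Hz.
      exists 0, 0; rewrite Rabs_R0; repeat split; try lra. ring.
    + assert (Hx := sector_pos t rad z Ht Hz Hn).
      exists (Cmod z), (atan (Im z / Re z)). destruct Hz as [H1 H2]; repeat split; auto.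
      * apply Cmod_ge_0.
      * apply Rabs_atan_le; auto. unfold Rdiv; rewrite Rabs_mult, Rabs_inv, (Rabs_pos_eq (Re z)) by lra.
        apply Rmult_le_reg_r with (Re z); auto. field_simplify; lra.
      * apply polar_right; auto.
  - intros (r & phi & Hr & Hphi & ->). split.
    + unfold cis; simpl. apply Rabs_le_between in Hphi.
      replace (r * cos phi - 0 * sin phi) with (r * cos phi) by ring.
      replace (r * sin phi + 0 * cos phi) with (r * sin phi) by ring.
      rewrite Rabs_mult, (Rabs_pos_eq r) by lra.
      rewrite !Rmult_assoc. apply Rmult_le_compat_l; [lra |].
      assert (H1 : 0 <= sin (t - phi)) by (apply sin_ge_0; lra).
      assert (H2 : 0 <= sin (t + phi)) by (apply sin_ge_0; lra).
      rewrite sin_minus in H1. rewrite sin_plus in H2.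
      unfold Rabs; destruct (Rcase_abs (sin phi)); nra.
    + rewrite Cmod_mult, Cmod_R, Cmod_cis, Rabs_pos_eq; lra.
Qed.

Lemma cis_PI_plus (t : R) : cis (PI + t) = (- cis t)%C.
Proof.
  unfold cis; apply injective_projections; simpl;
    [rewrite cos_plus | rewrite sin_plus]; rewrite cos_PI, sin_PI; ring.
Qed.

Lemma double_sector_iff (alpha rad : R) (z : C) : 0 < alpha < 1 ->
  double_sector alpha rad z <->
  sector (alpha * PI / 2) rad z \/ sector (alpha * PI / 2) rad (- z).
Proof.
  intros Ha. assert (HP := PI_RGT_0).
  assert (Ht : 0 < alpha * PI / 2 < PI / 2) by nra.
  rewrite !sector_polar by auto. split.
  - intros (r & phi & Hr & Hphi & [-> | ->]); [left | right]; exists r, phi; repeat split; try lra.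
    rewrite cis_PI_plus; ring.
  - intros [(r & phi & Hr & Hphi & E) | (r & phi & Hr & Hphi & E)]; exists r, phi;
      repeat split; try lra; [left; auto | right].
    rewrite cis_PI_plus. replace z with (- - z)%C by ring. rewrite E; ring.
Qed.

Lemma sector_linear (t rad : R) (z : C) : 0 < t < PI / 2 ->
  sector t rad z <->
    (Re ((- sin t, cos t) * z) <= 0 /\ Re ((- sin t, - cos t) * z) <= 0) /\ Cmod z <= rad.
Proof.
  intros Ht. assert (Hc : 0 < cos t) by (apply cos_gt_0; lra).
  unfold sector. apply and_iff_compat_r.
  unfold Re, Im; simpl. generalize (fst z) (snd z); intros x y.
  unfold Rabs; destruct (Rcase_abs y); nra.
Qed.

Lemma open_sector_linear (t rad : R) (z : C) : 0 < t < PI / 2 ->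
  open_sector t rad z <->
    (Re ((- sin t, cos t) * z) < 0 /\ Re ((- sin t, - cos t) * z) < 0) /\ Cmod z < rad.
Proof.
  intros Ht. assert (Hc : 0 < cos t) by (apply cos_gt_0; lra).
  unfold open_sector. apply and_iff_compat_r.
  unfold Re, Im; simpl. generalize (fst z) (snd z); intros x y.
  unfold Rabs; destruct (Rcase_abs y); nra.
Qed.

Lemma lipschitz_Cmod : lipschitz_C Cmod 1.
Proof.
  intros z w. replace w with (z + (w - z))%C at 1 by ring.
  rewrite Rmult_1_l; apply Cmod_triangle.
Qed.

Lemma closed_set_ext (D E : C -> Prop) :
  (forall z, D z <-> E z) -> closed_set D -> closed_set E.
Proof.
  intros H HD z Hz. destruct (HD z) as (d & Hd & Hw); [rewrite H; auto |].
  exists d; split; auto. intros w; rewrite <- H; auto.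
Qed.

Lemma sector_closed (t rad : R) : 0 < t < PI / 2 -> closed_set (sector t rad).
Proof.
  intros Ht. eapply closed_set_ext; [intros z; symmetry; apply sector_linear; auto |].
  repeat apply closed_set_and; eapply lipschitz_closed;
    auto using lipschitz_linear, lipschitz_Cmod.
Qed.

Lemma sector_bounded (t rad : R) : bounded_set rad (sector t rad).
Proof. intros z Hz; apply Hz. Qed.

Lemma open_sector_open (t rad : R) (z : C) : 0 < t < PI / 2 -> open_sector t rad z ->
  exists d, 0 < d /\ forall w, Cmod (w - z) < d -> open_sector t rad w.
Proof.
  intros Ht Hz. apply open_sector_linear in Hz; auto. destruct Hz as [[H1 H2] H3].
  destruct (lipschitz_lt_near _ _ _ _ (lipschitz_linear (- sin t, cos t)) H1) as (d1 & D1 & N1).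
  destruct (lipschitz_lt_near _ _ _ _ (lipschitz_linear (- sin t, - cos t)) H2) as (d2 & D2 & N2).
  destruct (lipschitz_lt_near _ _ _ _ lipschitz_Cmod H3) as (d3 & D3 & N3).
  exists (Rmin d1 (Rmin d2 d3)); split; [repeat apply Rmin_pos; auto |].
  intros w Hw.
  assert (L1 := Rmin_l d1 (Rmin d2 d3)). assert (L2 := Rmin_r d1 (Rmin d2 d3)).
  assert (L3 := Rmin_l d2 d3). assert (L4 := Rmin_r d2 d3).
  apply open_sector_linear; auto. repeat split; [apply N1 | apply N2 | apply N3]; lra.
Qed.

Lemma open_sector_sector (t rad : R) (z : C) : open_sector t rad z -> sector t rad z.
Proof. intros [H1 H2]; split; lra. Qed.

(** The idea is needed only for points of the interior: a point of the boundary of a lobe can be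
    displaced, by less than the available radius, in a direction that leaves both lobes. *)
Lemma interior_double_sector (alpha rad : R) (z : C) : 0 < alpha < 1 ->
  interior_C (double_sector alpha rad) z <->
  open_sector (alpha * PI / 2) rad z \/ open_sector (alpha * PI / 2) rad (- z).
Proof.
  intros Ha. assert (HP := PI_RGT_0).
  assert (Ht : 0 < alpha * PI / 2 < PI / 2) by nra.
  set (t := alpha * PI / 2) in *.
  assert (Hc : 0 < cos t) by (apply cos_gt_0; lra).
  assert (Hs : 0 < sin t) by (apply sin_gt_0; lra).
  unfold interior_C; rewrite locally_C_Cmod. split.
  - intros (d & Hd & H).
    assert (key : forall z : C, z <> 0%C -> sector t rad z ->
      (forall w, Cmod (w - z) < d -> sector t rad w \/ sector t rad (- w)) -> open_sector t rad z).
    { clear z H. intros z Hz0 Hz H. assert (Hx := sector_pos t rad z Ht Hz Hz0).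
      assert (Hpos := proj1 (Cmod_gt_0 z) Hz0). split.
      (* Moving left by [e] stays in the right half-plane, so the displaced point lies in the same
         lobe; this makes the edge inequality strict at [z]. *)
      - set (e := Rmin (d / 2) (Re z / 2)).
        assert (He : 0 < e) by (apply Rmin_pos; lra).
        assert (He1 : e <= d / 2) by apply Rmin_l. assert (He2 : e <= Re z / 2) by apply Rmin_r.
        destruct (H (z - RtoC e)%C) as [[K _] | [K _]].
        + replace (z - e - z)%C with (- RtoC e)%C by ring.
          rewrite Cmod_opp, Cmod_R, Rabs_pos_eq; lra.
        + unfold Re, Im in *; simpl in K. rewrite Ropp_0, Rplus_0_r in K. nra.
        + unfold Re, Im in *; simpl in K.
          assert (H0 := Rabs_pos (- (snd z + - 0))). nra.
      - destruct Hz as [_ Hz]. destruct (Rle_lt_or_eq_dec _ _ Hz) as [|E]; auto.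
        exfalso. set (e := d / 2 / Cmod z).
        assert (He : 0 < e) by (unfold e; apply Rdiv_lt_0_compat; lra).
        assert (HR : Cmod (RtoC (1 + e) * z) = (1 + e) * Cmod z).
        { rewrite Cmod_mult, Cmod_R, Rabs_pos_eq; lra. }
        destruct (H (RtoC (1 + e) * z)%C) as [[_ K] | [_ K]].
        + replace (RtoC (1 + e) * z - z)%C with (RtoC e * z)%C by (rewrite RtoC_plus; ring).
          rewrite Cmod_mult, Cmod_R, Rabs_pos_eq by lra.
          unfold e; field_simplify; lra.
        + nra.
        + rewrite Cmod_opp in K; nra. }
    assert (H' : forall w, Cmod (w - z) < d -> sector t rad w \/ sector t rad (- w)).
    { intros w Hw; apply (double_sector_iff alpha rad w); auto. }
    destruct (classic (z = 0%C)) as [E | Hz0].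
    (* Arbitrarily close to 0 the imaginary axis lies outside both lobes. *)
    { exfalso. assert (Hm : Cmod (Ci * RtoC (d / 2)) = d / 2).
      { rewrite Cmod_mult, Cmod_Ci, Cmod_R, Rabs_pos_eq; lra. }
      destruct (H' (Ci * RtoC (d / 2))%C) as [[K _] | [K _]].
      - rewrite E. replace (Ci * RtoC (d / 2) - 0)%C with (Ci * RtoC (d / 2))%C by ring. lra.
      - simpl in K. match type of K with Rabs ?u * _ <= _ =>
          replace u with (d / 2) in K by field end.
        rewrite Rabs_pos_eq in K by lra. nra.
      - simpl in K. match type of K with Rabs ?u * _ <= _ =>
          replace u with (- (d / 2)) in K by field end.
        rewrite Rabs_Ropp, Rabs_pos_eq in K by lra. nra. }
    destruct (H' z) as [Hz | Hz].
    { replace (z - z)%C with (RtoC 0) by ring. rewrite Cmod_0; auto. }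
    + left; apply key; auto.
    + right; apply key; auto.
      * intros E; apply Hz0. replace z with (- - z)%C by ring. rewrite E; ring.
      * intros w Hw. destruct (H' (- w)%C) as [K | K].
        -- replace (- w - z)%C with (- (w - - z))%C by ring. rewrite Cmod_opp; auto.
        -- right; auto.
        -- left; replace w with (- - w)%C by ring; auto.
  - intros [Hz | Hz]; destruct (open_sector_open _ _ _ Ht Hz) as (d & Hd & H);
      exists d; split; auto; intros w Hw; apply double_sector_iff; auto.
    + left; apply open_sector_sector; auto.
    + right; apply open_sector_sector, H.
      replace (- w - - z)%C with (- (w - z))%C by ring. rewrite Cmod_opp; auto.
Qed.

(** * Growth and decay of polynomials in sectors *)

Lemma cexp_polar (s phi : R) : cexp (s, phi) = (RtoC (exp s) * cis phi)%C.
Proof. reflexivity. Qed.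

Lemma Rpower_small (k t : R) : 0 < k -> 0 < t ->
  exists r, 0 < r /\ forall r', 0 < r' <= r -> Rpower r' k <= t.
Proof.
  intros Hk Ht. exists (exp (ln t / k)); split; [apply exp_pos |].
  intros r' [H0 H1]. unfold Rpower. rewrite <- (exp_ln t) by auto.
  assert (H2 : ln r' <= ln t / k).
  { rewrite <- (ln_exp (ln t / k)). apply ln_le; auto. }
  apply Rle_div_r in H2; auto.
  destruct (Rle_lt_or_eq_dec (k * ln r') (ln t)) as [H | ->]; try lra.
  left; apply exp_increasing; auto.
Qed.

Lemma exp_mono (x y : R) : x <= y -> exp x <= exp y.
Proof.
  intros H; destruct (Rle_lt_or_eq_dec _ _ H) as [H1 | ->]; [| lra].
  left; apply exp_increasing; auto.
Qed.

(* In the logarithmic variable [s = ln r + i phi], the function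
   [P (e^s) exp (b e^(k s))] is entire and its modulus is
   [|P| exp (b r^k cos (k phi))]; the sector becomes a half-strip. *)
Lemma sector_growth (n : nat) (P : C -> C) (a1 a2 r1 k b M : R) :
  poly_le n P -> 0 < r1 -> 0 < k ->
  (forall r, 0 < r <= r1 ->
     Cmod (P (RtoC r * cis a1)%C) * exp (b * Rpower r k * cos (k * a1)) <= M) ->
  (forall r, 0 < r <= r1 ->
     Cmod (P (RtoC r * cis a2)%C) * exp (b * Rpower r k * cos (k * a2)) <= M) ->
  (forall phi, a1 <= phi <= a2 ->
     Cmod (P (RtoC r1 * cis phi)%C) * exp (b * Rpower r1 k * cos (k * phi)) <= M) ->
  Cmod (P 0%C) <= M ->
  forall r phi, 0 < r <= r1 -> a1 <= phi <= a2 ->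
    Cmod (P (RtoC r * cis phi)%C) * exp (b * Rpower r k * cos (k * phi)) <= M.
Proof.
  intros HP Hr1 Hk H1 H2 H3 H0 r phi Hr Hphi.
  assert (HM : 0 <= M) by (eapply Rle_trans; [apply Cmod_ge_0 | exact H0]).
  apply le_epsilon; intros eta Heta.
  (* The half-strip is truncated at [ln r0], where the slack [eta] makes the new edge harmless: near
     0, [|P| <= M + eta / 2] and the exponential is at most [(M + eta) / (M + eta / 2)]. *)
  destruct (poly_le_continuous n P 0%C HP (eta / 2)) as (d & Hd & Hcont); [lra |].
  assert (Hq : 1 < (M + eta) / (M + eta / 2)) by (apply Rlt_div_r; lra).
  assert (Hl : 0 < ln ((M + eta) / (M + eta / 2))) by (rewrite <- ln_1; apply ln_increasing; lra).
  assert (Hb := Rabs_pos b).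
  destruct (Rpower_small k (ln ((M + eta) / (M + eta / 2)) / (Rabs b + 1)) Hk) as (r2 & Hr2 & Hpow).
  { apply Rdiv_lt_0_compat; lra. }
  set (r0 := Rmin r (Rmin (d / 2) r2)).
  assert (Hr0 : 0 < r0) by (repeat apply Rmin_pos; lra).
  assert (Hr0r : r0 <= r) by apply Rmin_l.
  assert (Hr0d : r0 <= d / 2) by (eapply Rle_trans; [apply Rmin_r | apply Rmin_l]).
  assert (Hr02 : r0 <= r2) by (eapply Rle_trans; [apply Rmin_r | apply Rmin_r]).
  set (F := fun s : C => (P (cexp s) * cexp (RtoC b * cexp (RtoC k * s)))%C).
  assert (HF : forall x y, 0 < x ->
    Cmod (F (ln x, y)) = Cmod (P (RtoC x * cis y)%C) * exp (b * Rpower x k * cos (k * y))).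
  { intros x y Hx. unfold F. rewrite Cmod_mult, Cmod_cexp, cexp_polar, exp_ln by auto.
    f_equal. f_equal. unfold cexp, Rpower; simpl.
    replace (k * ln x - 0 * y) with (k * ln x) by ring.
    replace (k * y + 0 * ln x) with (k * y) by ring. ring. }
  rewrite <- HF by lra.
  apply (maximum_principle (fun s => (- Re s <= - ln r0 /\ Re s <= ln r1) /\
     (- Im s <= - a1 /\ Im s <= a2))
     (Rabs (ln r0) + Rabs (ln r1) + (Rabs a1 + Rabs a2))).
  - assert (L : forall a : C, lipschitz_C (fun s => Re (a * s)) (Cmod a)) by apply lipschitz_linear.
    apply closed_set_ext with (fun s => (Re (- (1) * s) <= - ln r0 /\ Re (1 * s) <= ln r1) /\
     (Re (Ci * s) <= - a1 /\ Re (- Ci * s) <= a2)).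
    { intros s. unfold Re, Im; simpl.
      split; intros [[K1 K2] [K3 K4]]; repeat split; lra. }
    repeat apply closed_set_and; eapply lipschitz_closed; apply L.
  - intros s [[K1 K2] [K3 K4]].
    eapply Rle_trans; [apply Cmod_le_Rabs |].
    apply Rplus_le_compat; apply Rabs_le; unfold Rabs; repeat destruct (Rcase_abs); lra.
  - intros z. apply taylor3_mult.
    + apply (poly_le_taylor3 _ _ n P); auto. apply taylor3_cexp, taylor3_id.
    + apply taylor3_cexp, taylor3_mult; [apply taylor3_const |].
      apply taylor3_cexp, taylor3_mult; [apply taylor3_const | apply taylor3_id].
  - intros [x y] [[K1 K2] [K3 K4]]. simpl in *.
    assert (Hx : exists u, 0 < u /\ x = ln u) by
      (exists (exp x); split; [apply exp_pos | symmetry; apply ln_exp]).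
    destruct Hx as (u & Hu & ->).
    assert (Hur1 : u <= r1) by (apply Rnot_lt_le; intros K; apply ln_increasing in K; lra).
    assert (Hur0 : r0 <= u) by (apply Rnot_lt_le; intros K; apply ln_increasing in K; lra).
    destruct (Req_dec u r0) as [E0 | N0].
    { left. rewrite HF by auto. rewrite E0.
      assert (Hz : Cmod (P (RtoC r0 * cis y)%C) <= M + eta / 2).
      { assert (HC : Cmod (RtoC r0 * cis y - 0) < d).
        { replace (r0 * cis y - 0)%C with (r0 * cis y)%C by ring.
          rewrite Cmod_mult, Cmod_cis, Cmod_R, Rabs_pos_eq; lra. }
        apply Hcont in HC.
        generalize (Cmod_triangle_rev (P (RtoC r0 * cis y)%C) (P 0%C)); lra. }
      assert (He : exp (b * Rpower r0 k * cos (k * y)) <= (M + eta) / (M + eta / 2)).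
      { rewrite <- (exp_ln ((M + eta) / (M + eta / 2))) by lra. apply exp_mono.
        eapply Rle_trans; [apply Rle_abs |]. rewrite !Rabs_mult.
        assert (HR : 0 < Rpower r0 k) by apply exp_pos.
        rewrite (Rabs_pos_eq (Rpower r0 k)) by lra.
        assert (HR2 := Hpow r0 (conj Hr0 Hr02)). apply Rle_div_r in HR2; [| lra].
        assert (Hcb : Rabs (cos (k * y)) <= 1) by apply Rabs_le, COS_bound.
        assert (Hcp := Rabs_pos (cos (k * y))).
        apply Rle_trans with (Rabs b * Rpower r0 k * 1); [| nra].
        apply Rmult_le_compat_l; [nra | auto]. }
      apply Rle_trans with ((M + eta / 2) * ((M + eta) / (M + eta / 2))).
      - apply Rmult_le_compat; auto using Cmod_ge_0. left; apply exp_pos.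
      - right; field; lra. }
    destruct (Req_dec u r1) as [E1 | N1].
    { left. rewrite HF by auto. rewrite E1. generalize (H3 y); lra. }
    destruct (Req_dec y a1) as [E2 | N2].
    { left. rewrite HF by auto. rewrite E2. generalize (H1 u); lra. }
    destruct (Req_dec y a2) as [E3 | N3].
    { left. rewrite HF by auto. rewrite E3. generalize (H2 u); lra. }
    right.
    assert (Hlu0 : ln r0 < ln u) by (apply ln_increasing; lra).
    assert (Hlu1 : ln u < ln r1) by (apply ln_increasing; lra).
    set (e := Rmin (Rmin (ln u - ln r0) (ln r1 - ln u)) (Rmin (y - a1) (a2 - y))).
    assert (He : 0 < e) by (repeat apply Rmin_pos; lra).
    assert (He1 : e <= ln u - ln r0) by (eapply Rle_trans; [apply Rmin_l | apply Rmin_l]).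
    assert (He2 : e <= ln r1 - ln u) by (eapply Rle_trans; [apply Rmin_l | apply Rmin_r]).
    assert (He3 : e <= y - a1) by (eapply Rle_trans; [apply Rmin_r | apply Rmin_l]).
    assert (He4 : e <= a2 - y) by (eapply Rle_trans; [apply Rmin_r | apply Rmin_r]).
    exists e; split; auto. intros w Hw.
    assert (W1 := re_le_Cmod (w - (ln u, y))). assert (W2 := Rabs_Im_le_Cmod (w - (ln u, y))).
    unfold Re, Im in *; simpl in W1, W2.
    apply Rabs_le_between in W1. apply Rabs_le_between in W2. lra.
  - simpl. assert (ln r0 <= ln r) by (apply ln_le; auto).
    assert (ln r <= ln r1) by (apply ln_le; lra). lra.
Qed.

Lemma cexp_surj (z : C) : z <> 0%C -> exists phi, - PI <= phi <= PI /\ z = (RtoC (Cmod z) * cis phi)%C.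
Proof.
  intros Hz. assert (Hp := proj1 (Cmod_gt_0 z) Hz).
  assert (H := Cmod_sqr z).
  set (r := Cmod z) in *. assert (HP := PI_RGT_0).
  assert (Hb : -1 <= Re z / r <= 1).
  { assert (R1 := re_le_Cmod z). fold r in R1. apply Rabs_le_between in R1.
    split; [apply Rle_div_r | apply Rle_div_l]; lra. }
  assert (Hs : sin (acos (Re z / r)) = Rabs (Im z) / r).
  { rewrite sin_acos by auto. apply sqrt_lem_1.
    - unfold Rsqr; nra.
    - apply Rdiv_le_0_compat; auto using Rabs_pos.
    - replace (Rabs (Im z) / r * (Rabs (Im z) / r)) with (Rabs (Im z) * Rabs (Im z) / (r * r))
        by (field; lra).
      rewrite <- Rabs_mult, Rabs_pos_eq by nra.
      replace (Im z * Im z) with (r * r - Re z * Re z) by lra.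
      unfold Rsqr; field; lra. }
  assert (Hc : cos (acos (Re z / r)) = Re z / r) by (apply cos_acos; auto).
  assert (Ha := acos_bound (Re z / r)).
  destruct (Rle_dec 0 (Im z)) as [Hy | Hy].
  - exists (acos (Re z / r)); split; [lra |]. unfold cis; rewrite Hc, Hs, Rabs_pos_eq by auto.
    apply injective_projections; simpl;
      [change (fst z) with (Re z) | change (snd z) with (Im z)]; field; lra.
  - exists (- acos (Re z / r)); split; [lra |].
    unfold cis; rewrite cos_neg, sin_neg, Hc, Hs, Rabs_left by lra.
    apply injective_projections; simpl;
      [change (fst z) with (Re z) | change (snd z) with (Im z)]; field; lra.
Qed.

Lemma sector_cis (t rad r phi : R) : 0 < t < PI / 2 -> 0 <= r <= rad -> Rabs phi <= t ->
  sector t rad (RtoC r * cis phi).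
Proof. intros Ht Hr Hphi; apply sector_polar; auto. exists r, phi; auto. Qed.

Lemma Cmod_polar (r phi : R) : 0 <= r -> Cmod (RtoC r * cis phi) = r.
Proof. intros; rewrite Cmod_mult, Cmod_cis, Cmod_R, Rabs_pos_eq; lra. Qed.

Lemma Rpower_2 (r : R) : 0 < r -> Rpower r 2 = r * r.
Proof. intros; change 2 with (INR 2); rewrite Rpower_pow by auto; simpl; ring. Qed.

Lemma PI_bounds : 3 < PI <= 4.
Proof. generalize PI2_3_2 PI_4; lra. Qed.

Lemma sin_lt_cos_quarter (t : R) : PI / 4 < t < PI / 2 -> 0 < cos t < sin t.
Proof.
  intros Ht. split; [apply cos_gt_0; lra |].
  rewrite <- sin_shift. apply sin_increasing_1; lra.
Qed.

(** As [t > PI / 4], [cos (2 phi) <= - eta < 0] for [t <= phi <= PI - t]. The factor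
    [exp (N B r^2 cos (2 phi))] is therefore at most 1 on the edges, and on the outer arc it absorbs
    the crude Bernstein-Walsh growth [6^N]. Dividing by it gives the bound. *)
Lemma exterior_growth (t rad : R) : PI / 4 < t < PI / 2 -> 0 < rad ->
  exists B, 0 < B /\ forall (N : nat) (P : C -> C) (M : R), poly_le N P ->
    (forall z, sector t rad z \/ sector t rad (- z) -> Cmod (P z) <= M) ->
    forall z, Cmod z <= rad -> Cmod (P z) <= M * exp (INR N * B * (Cmod z * Cmod z)).
Proof.
  intros Ht Hrad. assert (HPI := PI_RGT_0).
  destruct (sin_lt_cos_quarter t Ht) as [Hc Hs].
  set (eta := - cos (2 * t)).
  assert (Heta : 0 < eta).
  { unfold eta; rewrite cos_2a; nra. }
  assert (Hln : 0 < ln 6) by (rewrite <- ln_1; apply ln_increasing; lra).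
  (* The solution [B] of [exp (- B rad^2 eta) = 1 / 6]. *)
  exists (ln 6 / (rad * rad * eta)).
  assert (HB : 0 < ln 6 / (rad * rad * eta)).
  { apply Rdiv_lt_0_compat; auto. repeat apply Rmult_lt_0_compat; auto. }
  split; auto.
  set (B := ln 6 / (rad * rad * eta)) in *.
  intros N.
  (* The disc of centre [rad / 2] and radius [rad / 4] lies in the right lobe, and every point with
     [|z| <= rad] is within [3 rad / 2] of its centre: the ratio is 6. *)
  assert (Hcrude : forall (P : C -> C) M, poly_le N P ->
    (forall z, sector t rad z \/ sector t rad (- z) -> Cmod (P z) <= M) ->
    forall z, Cmod z <= rad -> Cmod (P z) <= M * 6 ^ N).
  { intros P M HP HM z Hz.
    assert (HM0 : 0 <= M).
    { eapply Rle_trans; [apply Cmod_ge_0 | apply (HM 0%C)]. left; split; [simpl; rewrite Rabs_R0; lra |].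
      rewrite Cmod_0; lra. }
    assert (Hdisc : forall w, Cmod (w - RtoC (rad / 2)) <= rad / 4 -> Cmod (P w) <= M).
    { intros w Hw. apply HM; left.
      assert (W1 := re_le_Cmod (w - RtoC (rad / 2))).
      assert (W2 := Rabs_Im_le_Cmod (w - RtoC (rad / 2))).
      assert (W3 := Cmod_triangle (w - RtoC (rad / 2)) (RtoC (rad / 2))).
      replace (w - RtoC (rad / 2) + RtoC (rad / 2))%C with w in W3 by ring.
      rewrite Cmod_R, Rabs_pos_eq in W3 by lra.
      unfold Re, Im in *; simpl in W1, W2.
      rewrite Ropp_0, Rplus_0_r in W2. apply Rabs_le_between in W1.
      split; [unfold Re, Im | lra].
      apply Rle_trans with (rad / 4 * sin t); [| nra].
      assert (H0 := Rabs_pos (snd w)). nra. }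
    assert (H6 : 1 <= 6 ^ N) by (apply pow_R1_Rle; lra).
    destruct (Rle_dec (Cmod (z - RtoC (rad / 2))) (rad / 4)) as [Hd | Hd].
    - generalize (Hdisc z Hd); nra.
    - eapply Rle_trans; [apply (bernstein_walsh_disc N P (RtoC (rad / 2)) (rad / 4) M); auto; lra |].
      apply Rmult_le_compat_l; auto. apply pow_incr; split.
      + apply Rdiv_le_0_compat; [apply Cmod_ge_0 | lra].
      + apply Rle_div_l; [lra |]. eapply Rle_trans; [apply Cmod_minus_le |].
        rewrite Cmod_R, Rabs_pos_eq; lra. }
  assert (Hcos : forall phi, t <= phi <= PI - t -> cos (2 * phi) <= - eta).
  { intros phi Hphi. unfold eta. rewrite Ropp_involutive, !cos_2a_sin.
    assert (H1 : sin t <= sin phi).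
    { destruct (Rle_dec phi (PI / 2)).
      - apply sin_incr_1; lra.
      - rewrite <- (sin_PI_x phi). apply sin_incr_1; lra. }
    nra. }
  assert (Hup : forall (P : C -> C) M, poly_le N P ->
    (forall z, sector t rad z \/ sector t rad (- z) -> Cmod (P z) <= M) ->
    forall r phi, 0 < r <= rad -> 0 <= phi <= PI ->
      Cmod (P (RtoC r * cis phi)%C) <= M * exp (INR N * B * (r * r))).
  { intros P M HP HM r phi Hr Hphi.
    assert (HM0 : 0 <= M).
    { eapply Rle_trans; [apply Cmod_ge_0 | apply (HM 0%C)]. left; split; [simpl; rewrite Rabs_R0; lra |].
      rewrite Cmod_0; lra. }
    assert (HN := pos_INR N).
    assert (HNB : 0 <= INR N * B) by nra.
    assert (Hexp : 1 <= exp (INR N * B * (r * r))).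
    { rewrite <- exp_0. apply exp_mono. nra. }
    assert (Hopp : forall p, PI - t <= p <= PI -> forall q, 0 < q <= rad ->
       sector t rad (- (RtoC q * cis p))).
    { intros p Hp q Hq. replace p with (PI + (p - PI)) by ring. rewrite cis_PI_plus.
      replace (- (q * - cis (p - PI)))%C with (RtoC q * cis (p - PI))%C by ring.
      apply sector_cis; try lra. apply Rabs_le; lra. }
    destruct (Rle_dec phi t) as [H1 | H1].
    { apply Rle_trans with M; [| nra]. apply HM; left.
      apply sector_cis; try lra. apply Rabs_le; lra. }
    destruct (Rle_dec (PI - t) phi) as [H2 | H2].
    { apply Rle_trans with M; [| nra]. apply HM; right; apply Hopp; lra. }
    assert (HS := sector_growth N P t (PI - t) rad 2 (INR N * B) M HP Hrad Rlt_0_2).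
    assert (HS' : Cmod (P (RtoC r * cis phi)%C) *
       exp (INR N * B * Rpower r 2 * cos (2 * phi)) <= M).
    { apply HS; try lra.
      - intros q Hq. rewrite Rpower_2 by lra.
        assert (K : exp (INR N * B * (q * q) * cos (2 * t)) <= 1).
        { rewrite <- exp_0. apply exp_mono.
          assert (0 <= INR N * B * (q * q)) by (apply Rmult_le_pos; nra).
          unfold eta in Heta; nra. }
        assert (K' : Cmod (P (RtoC q * cis t)%C) <= M).
        { apply HM; left; apply sector_cis; try lra. apply Rabs_le; lra. }
        generalize (Cmod_ge_0 (P (RtoC q * cis t)%C)) (exp_pos (INR N * B * (q * q) * cos (2 * t))); nra.
      - intros q Hq. rewrite Rpower_2 by lra.
        assert (K : exp (INR N * B * (q * q) * cos (2 * (PI - t))) <= 1).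
        { rewrite <- exp_0. apply exp_mono.
          assert (0 <= INR N * B * (q * q)) by (apply Rmult_le_pos; nra).
          assert (cos (2 * (PI - t)) <= - eta) by (apply Hcos; lra). nra. }
        assert (K' : Cmod (P (RtoC q * cis (PI - t))%C) <= M).
        { apply HM; right; apply Hopp; lra. }
        generalize (Cmod_ge_0 (P (RtoC q * cis (PI - t))%C))
          (exp_pos (INR N * B * (q * q) * cos (2 * (PI - t)))); nra.
      - intros p Hp. rewrite Rpower_2 by lra.
        assert (K : exp (INR N * B * (rad * rad) * cos (2 * p)) <= / 6 ^ N).
        { rewrite <- Rpower_pow by lra. unfold Rpower. rewrite <- exp_Ropp. apply exp_mono.
          assert (Hcp := Hcos p Hp).
          replace (- (INR N * ln 6)) with (INR N * B * (rad * rad) * (- eta)).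
          - apply Rmult_le_compat_l; auto. apply Rmult_le_pos; nra.
          - unfold B; field. split; apply Rgt_not_eq; auto. }
        assert (K' : Cmod (P (RtoC rad * cis p)%C) <= M * 6 ^ N).
        { apply Hcrude; auto. rewrite Cmod_polar; lra. }
        assert (H6 : 0 < 6 ^ N) by (apply pow_lt; lra).
        apply Rle_trans with (M * 6 ^ N * / 6 ^ N).
        + apply Rmult_le_compat; auto using Cmod_ge_0. left; apply exp_pos.
        + right; field; lra.
      - apply HM; left; split; [simpl; rewrite Rabs_R0; lra |]. rewrite Cmod_0; lra. }
    rewrite Rpower_2 in HS' by lra.
    set (X := INR N * B * (r * r)) in *.
    assert (HX : 0 <= X) by (apply Rmult_le_pos; nra).
    assert (HE : exp (- X) <= exp (X * cos (2 * phi))).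
    { apply exp_mono. generalize (COS_bound (2 * phi)); nra. }
    apply Rmult_le_reg_r with (exp (- X)); [apply exp_pos |].
    rewrite Rmult_assoc, <- exp_plus. replace (X + - X) with 0 by ring.
    rewrite exp_0, Rmult_1_r. eapply Rle_trans; [| exact HS'].
    apply Rmult_le_compat_l; auto using Cmod_ge_0. }
  intros P M HP HM z Hz.
  destruct (classic (z = 0%C)) as [-> | Hz0].
  { rewrite Cmod_0, !Rmult_0_r, exp_0, Rmult_1_r. apply HM; left.
    split; [simpl; rewrite Rabs_R0; lra |]. rewrite Cmod_0; lra. }
  assert (Hpos := proj1 (Cmod_gt_0 z) Hz0).
  destruct (cexp_surj z Hz0) as (phi & Hphi & E).
  destruct (Rle_dec 0 phi) as [H | H].
  - rewrite E at 1. apply Hup; auto; lra.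
  (* The lower half-plane reduces to the upper one by the symmetry [z -> - z] of the double
     sector. *)
  - assert (E' : z = (- (RtoC (Cmod z) * cis (PI + phi)))%C)
      by (rewrite cis_PI_plus; rewrite E at 1; ring).
    rewrite E' at 1.
    apply (Hup (fun w => P (- w)%C) M); auto using poly_le_opp; try lra.
    intros w Hw. apply HM. replace (- - w)%C with w by ring. tauto.
Qed.

(** The conditions on [k] make [cos (k phi)] nonpositive for [PI / (2 k) <= |phi| <= t], where only
    the bound [M] is known. On the rest of the arc the assumed decay [exp (- c N)] pays for the
    exponential factor if [c' = c / rad^k]; in the middle of the sector that factor becomes the
    gain. *)
Lemma interior_decay (t rad k c : R) : 0 < t < PI / 2 -> 0 < rad -> 0 < k ->
  PI / (2 * k) <= t -> k * t <= PI -> 0 < c ->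
  exists c', 0 < c' /\ forall (N : nat) (P : C -> C) (M : R), poly_le N P ->
    (forall z, sector t rad z -> Cmod (P z) <= M) ->
    (forall phi, Rabs phi <= PI / (2 * k) ->
       Cmod (P (RtoC rad * cis phi)%C) <= M * exp (- c * INR N)) ->
    forall r phi, 0 < r <= rad -> Rabs phi <= t ->
      Cmod (P (RtoC r * cis phi)%C) <= M * exp (- (INR N * c' * Rpower r k * cos (k * phi))).
Proof.
  intros Ht Hrad Hk Hk1 Hk2 Hc.
  assert (HR : 0 < Rpower rad k) by apply exp_pos.
  exists (c / Rpower rad k); split; [apply Rdiv_lt_0_compat; auto |].
  intros N P M HP HM HA r phi Hr Hphi.
  set (c' := c / Rpower rad k).
  assert (Hc' : 0 < c') by (apply Rdiv_lt_0_compat; auto).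
  assert (HN := pos_INR N).
  assert (HM0 : 0 <= M).
  { eapply Rle_trans; [apply Cmod_ge_0 | apply (HM 0%C)]. split; [simpl; rewrite Rabs_R0; lra |].
    rewrite Cmod_0; lra. }
  assert (Hneg : forall q p, 0 < q <= rad -> Rabs p <= t -> cos (k * p) <= 0 ->
    Cmod (P (RtoC q * cis p)%C) * exp (INR N * c' * Rpower q k * cos (k * p)) <= M).
  { intros q p Hq Hp Hcos.
    assert (K : exp (INR N * c' * Rpower q k * cos (k * p)) <= 1).
    { rewrite <- exp_0. apply exp_mono. assert (0 < Rpower q k) by apply exp_pos.
      assert (0 <= INR N * c' * Rpower q k) by (apply Rmult_le_pos; [apply Rmult_le_pos |]; lra). nra. }
    assert (K' : Cmod (P (RtoC q * cis p)%C) <= M).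
    { apply HM, sector_cis; try lra. }
    generalize (Cmod_ge_0 (P (RtoC q * cis p)%C)) (exp_pos (INR N * c' * Rpower q k * cos (k * p))); nra. }
  assert (Hcos : forall p, PI / (2 * k) <= Rabs p <= t -> cos (k * p) <= 0).
  { intros p [Hp1 Hp2]. apply Rle_div_l in Hp1; [| lra].
    assert (Hkp : k * Rabs p <= k * t) by (apply Rmult_le_compat_l; lra).
    replace (cos (k * p)) with (cos (k * Rabs p)).
    - apply cos_le_0; lra.
    - unfold Rabs; destruct (Rcase_abs p); auto.
      rewrite <- (cos_neg (k * p)); f_equal; ring. }
  assert (HS : Cmod (P (RtoC r * cis phi)%C) * exp (INR N * c' * Rpower r k * cos (k * phi)) <= M).
  { apply Rabs_le_between in Hphi.
    apply (sector_growth N P (- t) t rad k (INR N * c') M); auto; try lra.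
    - intros q Hq. apply Hneg; auto; [| apply Hcos]; rewrite Rabs_Ropp, Rabs_pos_eq; lra.
    - intros q Hq. apply Hneg; auto; [| apply Hcos]; rewrite Rabs_pos_eq; lra.
    - intros p Hp. destruct (Rle_dec (Rabs p) (PI / (2 * k))) as [H | H].
      + assert (K : exp (INR N * c' * Rpower rad k * cos (k * p)) <= exp (c * INR N)).
        { apply exp_mono. replace (INR N * c' * Rpower rad k) with (c * INR N)
            by (unfold c'; field; lra).
          assert (0 <= c * INR N) by nra. generalize (COS_bound (k * p)); nra. }
        apply Rle_trans with (M * exp (- c * INR N) * exp (c * INR N)).
        * apply Rmult_le_compat; auto using Cmod_ge_0. left; apply exp_pos.
        * rewrite Rmult_assoc, <- exp_plus. replace (- c * INR N + c * INR N) with 0 by ring.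
          rewrite exp_0; lra.
      + apply Hneg; try lra; [apply Rabs_le; lra |]. apply Hcos; split; [lra | apply Rabs_le; lra].
    - apply HM. split; [simpl; rewrite Rabs_R0; lra |]. rewrite Cmod_0; lra. }
  set (X := INR N * c' * Rpower r k * cos (k * phi)) in *.
  apply Rmult_le_reg_r with (exp X); [apply exp_pos |].
  rewrite Rmult_assoc, <- exp_plus. replace (- X + X) with 0 by ring. rewrite exp_0; lra.
Qed.

(** * Decay near the origin *)

Fixpoint Cprod (u : nat -> C) (n : nat) : C :=
  match n with O => 1%C | S k => (Cprod u k * u k)%C end.

Lemma Cmod_Cprod_le (u : nat -> C) (b : R) (n : nat) :
  (forall k, (k < n)%nat -> Cmod (u k) <= b) -> Cmod (Cprod u n) <= b ^ n.
Proof.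
  induction n as [| n IH]; intros H; simpl; [rewrite Cmod_1; lra |].
  rewrite Cmod_mult, Rmult_comm. apply Rmult_le_compat; auto using Cmod_ge_0.
Qed.

Lemma Cmod_Cprod_le_one_small (u : nat -> C) (b s : R) (n j : nat) :
  (forall k, (k < S n)%nat -> Cmod (u k) <= b) -> (j < S n)%nat -> Cmod (u j) <= s ->
  Cmod (Cprod u (S n)) <= b ^ n * s.
Proof.
  revert j; induction n as [| n IH]; intros j H Hj Hs.
  - replace j with 0%nat in Hs by lia. simpl. rewrite Cmod_mult, Cmod_1; lra.
  - assert (Hb : 0 <= b) by (eapply Rle_trans; [apply Cmod_ge_0 | apply (H 0%nat); lia]).
    change (Cprod u (S (S n))) with (Cprod u (S n) * u (S n))%C. rewrite Cmod_mult.
    destruct (Nat.eq_dec j (S n)) as [-> | Hn].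
    + apply Rmult_le_compat; auto using Cmod_ge_0. apply Cmod_Cprod_le; auto.
    + replace (b ^ S n * s) with (b ^ n * s * b) by (simpl; ring).
      apply Rmult_le_compat; auto using Cmod_ge_0. apply IH with j; auto; lia.
Qed.

Lemma Cprod_const (c : C) (n : nat) : Cprod (fun _ => c) n = (c ^ n)%C.
Proof. induction n as [| n IH]; simpl; auto. rewrite IH; ring. Qed.

Lemma taylor3_Cprod (F : nat -> C -> C) (z : C) (n : nat) :
  (forall k, taylor3 (F k) z) -> taylor3 (fun w => Cprod (fun k => F k w) n) z.
Proof.
  intros H; induction n as [| n IH]; simpl; [apply taylor3_const | apply taylor3_mult; auto].
Qed.

Lemma Rabs_atan_le_Rabs (x : R) : Rabs (atan x) <= Rabs x.
Proof.
  assert (H : Rabs (atan x) <= 1 * Rabs x ^ 1); [| simpl in H; lra].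
  apply (Rabs_le_pow_of_derive atan (fun x => / (1 + x ^ 2))); [apply atan_0 | | lra |].
  - intros; auto_derive; auto; field. nra.
  - intros u _; simpl. rewrite Rabs_inv, Rabs_pos_eq by nra.
    rewrite !Rmult_1_r, <- Rinv_1. apply Rinv_le_contravar; nra.
Qed.

(** The 32 multiples of [PI / 16] go once around the circle in steps shorter than [1 / 4], so one of
    them brings a given unit vector close to 1. *)
Lemma rotation_near_1 (z : C) : Cmod z = 1 ->
  exists (k : nat) (d : R), (k < 32)%nat /\ Rabs d <= / 4 /\
    (cis (PI * INR k / 16) * z)%C = cis d.
Proof.
  intros Hz. assert (HP := PI_bounds).
  assert (Hz0 : z <> 0%C) by (apply Cmod_gt_0; lra).
  destruct (cexp_surj z Hz0) as (phi & Hphi & E). rewrite Hz, Cmult_1_l in E.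
  assert (H : exists psi, 0 <= psi < 2 * PI /\ z = cis (- psi)).
  { destruct (Rle_dec phi 0).
    - exists (- phi); split; [lra | rewrite E; f_equal; ring].
    - exists (2 * PI - phi); split; [lra |]. rewrite E.
      replace (- (2 * PI - phi)) with (phi - 2 * PI) by ring.
      unfold cis. rewrite cos_minus, sin_minus, cos_2PI, sin_2PI. f_equal; ring. }
  destruct H as (psi & Hpsi & ->).
  destruct (nfloor_ex (16 * psi / PI)) as [k [Hk1 Hk2]].
  { apply Rdiv_le_0_compat; lra. }
  apply Rle_div_r in Hk1; [| lra]. apply Rlt_div_l in Hk2; [| lra].
  exists k, (PI * INR k / 16 - psi). repeat split.
  - apply INR_lt. apply Rmult_lt_reg_r with PI; [lra |]. replace (INR 32) with 32 by (simpl; ring).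
    lra.
  - apply Rabs_le; lra.
  - rewrite <- cis_plus; f_equal; ring.
Qed.

Lemma exp_pow_INR (x : R) (n : nat) : exp x ^ n = exp (INR n * x).
Proof.
  induction n as [| n IH]; [simpl; rewrite Rmult_0_l, exp_0; auto |].
  rewrite S_INR; simpl; rewrite IH, <- exp_plus; f_equal; ring.
Qed.

(** [phi1] is fixed before [c] because it determines the compact arc from which the rate [c] is
    extracted. The estimate is a two-constants argument by products: among 32 rotates of [P] about
    [z0], each is at most [M exp (4 N B r^2)] on the circle, and at every point one of them is at
    most [M exp (- N D / 2)]. *)
Lemma local_decay (t rad : R) : PI / 4 < t < PI / 2 -> 0 < rad ->
  exists phi1, 0 < phi1 < t /\ forall c, 0 < c ->
  exists r0 c0, 0 < r0 /\ 0 < c0 /\ forall (N : nat) (P : C -> C) (M : R), poly_le N P ->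
    (forall z, sector t rad z \/ sector t rad (- z) -> Cmod (P z) <= M) ->
    (forall phi, Rabs phi <= phi1 ->
       Cmod (P (RtoC (rad / 2) * cis phi)%C) <= M * exp (- c * INR N)) ->
    forall z, Cmod z <= r0 -> Cmod (P z) <= M * exp (- c0 * INR N).
Proof.
  intros Ht Hrad. assert (HPI := PI_bounds).
  destruct (exterior_growth t rad Ht Hrad) as (B & HB & Hext).
  assert (Hpt : PI / (2 * t) < 2) by (apply Rlt_div_l; lra).
  assert (Hpt1 : 1 < PI / (2 * t)) by (apply Rlt_div_r; lra).
  (* [PI / (2 t)] is [1 / alpha] in the application; [k] is the midpoint between it and 2. *)
  set (k := (PI / (2 * t) + 2) / 2).
  assert (Hk : 1 < k < 2) by (unfold k; lra).
  assert (Hkt : PI / 2 < k * t).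
  { replace (PI / 2) with (PI / (2 * t) * t) by (field; lra).
    apply Rmult_lt_compat_r; unfold k; lra. }
  exists (PI / (2 * k)). split.
  { split; [apply Rdiv_lt_0_compat; lra | apply Rlt_div_l; lra]. }
  intros c Hc.
  destruct (interior_decay t (rad / 2) k c) as (c' & Hc' & Hint); try lra.
  { apply Rle_div_l; lra. } { nra. }
  (* With [r = 2 s], this bounds [124 B r^2], the total growth exponent of 31 factors at modulus at
     most [2 r], by [D / 4]. It is here that [2 - k > 0] is decisive. *)
  destruct (Rpower_small (2 - k) (c' / (1984 * B))) as (s0 & Hs0 & Hsmall).
  { lra. } { apply Rdiv_lt_0_compat; lra. }
  set (s := Rmin s0 (rad / 8)).
  assert (Hs : 0 < s) by (apply Rmin_pos; lra).
  assert (Hs1 : s <= s0) by apply Rmin_l. assert (Hs2 : s <= rad / 8) by apply Rmin_r.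
  set (r := 2 * s).
  set (D := c' * Rpower s k).
  assert (HD : 0 < D) by (apply Rmult_lt_0_compat; [auto | apply exp_pos]).
  assert (HBr : 124 * B * (r * r) <= D / 4).
  { unfold r, D. replace (2 * s * (2 * s)) with (4 * (s * s)) by ring.
    rewrite <- Rpower_2 by auto.
    replace (Rpower s 2) with (Rpower s k * Rpower s (2 - k))
      by (rewrite <- Rpower_plus; f_equal; ring).
    assert (H := Hsmall s (conj Hs Hs1)).
    apply Rle_div_r in H; [| lra]. assert (0 < Rpower s k) by apply exp_pos. nra. }
  (* The product has exponent at most [- D / 2 + D / 4], and a 32nd root leaves [D / 128]. *)
  exists (r / 32), (D / 128). split; [unfold r; lra |]. split; [lra |].
  intros N P M HP HM HA z0 Hz0.
  assert (HN := pos_INR N).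
  assert (HM0 : 0 <= M).
  { eapply Rle_trans; [apply Cmod_ge_0 | apply (HM 0%C)].
    destruct (sin_lt_cos_quarter t Ht).
    left; split; [simpl; rewrite Rabs_R0; lra |]. rewrite Cmod_0; lra. }
  assert (HM' : forall z, sector t (rad / 2) z -> Cmod (P z) <= M).
  { intros z [K1 K2]; apply HM; left; split; lra. }
  (* At the centre the product is [P z0 ^ 32], so a bound on the unit circle bounds [P z0]
     itself. *)
  set (F := fun w : C => Cprod (fun j => P (z0 + (RtoC r * cis (PI * INR j / 16)) * w)%C) 32).
  assert (HF0 : F 0%C = (P z0 ^ 32)%C).
  { unfold F. rewrite <- Cprod_const. generalize 32%nat; intros n.
    induction n as [| n IH]; [reflexivity |]. cbn [Cprod]. rewrite IH. do 2 f_equal; ring. }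
  assert (HFb : Cmod (F 0%C) <= (M * exp (INR N * B * (4 * (r * r)))) ^ 31 *
     (M * exp (- (INR N * (D / 2))))).
  { apply (maximum_principle_disc F 0 1).
    - intros w. apply taylor3_Cprod; intros j. apply (poly_le_taylor3 _ w N P); auto.
      apply taylor3_plus; [apply taylor3_const |].
      apply taylor3_mult; [apply taylor3_const | apply taylor3_id].
    - intros w Hw. replace (w - 0)%C with w in Hw by ring.
      destruct (rotation_near_1 w Hw) as (j & d & Hj & Hd & E).
      unfold F. apply Cmod_Cprod_le_one_small with j; auto.
      + intros i _.
        assert (Hz : Cmod (z0 + RtoC r * cis (PI * INR i / 16) * w) <= 2 * r).
        { eapply Rle_trans; [apply Cmod_triangle |].
          rewrite Cmod_mult, Hw, Cmod_polar by (unfold r; lra). unfold r in *; lra. }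
        eapply Rle_trans; [apply (Hext N P M); auto; unfold r in *; lra |].
        apply Rmult_le_compat_l; auto. apply exp_mono. apply Rmult_le_compat_l; [nra |].
        assert (H0 := Cmod_ge_0 (z0 + RtoC r * cis (PI * INR i / 16) * w)). nra.
      (* For the rotate near the positive axis, [|z0| <= r / 32] keeps the argument of [z] within
         [1 / 3] and its modulus at least [s]; as [k < 2], the cosine in the decay is at least
         [1 / 2]. *)
      + rewrite <- Cmult_assoc, E.
        set (z := (z0 + RtoC r * cis d)%C).
        assert (Hd1 := cos_taylor1 d). assert (Hd2 := sin_le_Rabs d).
        assert (Hd0 := Rabs_pos d).
        assert (Hcd : 15 / 16 <= cos d).
        { apply Rabs_le_between in Hd1. simpl in Hd1. nra. }
        assert (R1 := re_le_Cmod z0). assert (R2 := Rabs_Im_le_Cmod z0).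
        assert (Hr0 : 0 < r) by (unfold r; lra).
        assert (Hx : 29 / 32 * r <= Re z).
        { unfold z, cis; simpl. unfold Re in R1. apply Rabs_le_between in R1. nra. }
        assert (Hy : Rabs (Im z) <= 9 / 32 * r).
        { unfold z, cis; simpl. unfold Im in R2. eapply Rle_trans; [apply Rabs_triang |].
          replace (r * sin d + 0 * cos d) with (r * sin d) by ring.
          rewrite Rabs_mult, (Rabs_pos_eq r) by lra. nra. }
        assert (Hzb : Cmod z <= 2 * r).
        { unfold z. eapply Rle_trans; [apply Cmod_triangle |]. rewrite Cmod_polar; lra. }
        assert (Hzl : s <= Cmod z) by (generalize (Re_le_Cmod z); unfold r in *; lra).
        assert (Hphi : Rabs (atan (Im z / Re z)) <= / 3).
        { eapply Rle_trans; [apply Rabs_atan_le_Rabs |].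
          unfold Rdiv; rewrite Rabs_mult, Rabs_inv, (Rabs_pos_eq (Re z)) by lra.
          apply Rle_div_l; lra. }
        rewrite (polar_right z) by lra.
        eapply Rle_trans; [apply (Hint N P M HP HM' HA) |].
        * unfold r in *; lra.
        * lra.
        * apply Rmult_le_compat_l; auto. apply exp_mono, Ropp_le_contravar.
          unfold D. rewrite !Rmult_assoc. apply Rmult_le_compat_l; auto.
          replace (c' * (Rpower s k * / 2)) with (c' * (Rpower s k * / 2)) by auto.
          unfold Rdiv; rewrite Rmult_assoc.
          apply Rmult_le_compat_l; [lra |].
          apply Rmult_le_compat; [left; apply exp_pos | lra | |].
          -- apply Rle_Rpower_l; lra.
          -- assert (Q := cos_taylor1 (k * atan (Im z / Re z))). apply Rabs_le_between in Q.
             assert (Q' : Rabs (k * atan (Im z / Re z)) <= 2 / 3).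
             { rewrite Rabs_mult, (Rabs_pos_eq k) by lra.
               generalize (Rabs_pos (atan (Im z / Re z))); nra. }
             assert (Q0 := Rabs_pos (k * atan (Im z / Re z))).
             change (/ 2 <= cos (k * atan (Im z / Re z))).
             revert Q Q' Q0. generalize (Rabs (k * atan (Im z / Re z))). simpl. intros; nra.
    - replace (0 - 0)%C with (RtoC 0) by ring. rewrite Cmod_0; lra. }
  rewrite HF0, Cmod_pow in HFb.
  assert (HFe : Cmod (P z0) ^ 32 <= (M * exp (- (D / 128) * INR N)) ^ 32).
  { eapply Rle_trans; [exact HFb |]. rewrite !Rpow_mult_distr.
    replace (M ^ 31 * _ * _) with (M ^ 32 *
      (exp (INR N * B * (4 * (r * r))) ^ 31 * exp (- (INR N * (D / 2))))) by (simpl; ring).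
    apply Rmult_le_compat_l; [apply pow_le; auto |].
    rewrite !exp_pow_INR, <- exp_plus. apply exp_mono.
    replace (INR 31) with 31 by (simpl; ring). replace (INR 32) with 32 by (simpl; ring). nra. }
  apply Rnot_lt_le; intros Hlt.
  assert (Hp : 0 <= M * exp (- (D / 128) * INR N)).
  { apply Rmult_le_pos; auto. left; apply exp_pos. }
  assert (Hpl : (M * exp (- (D / 128) * INR N)) ^ 32 < Cmod (P z0) ^ 32).
  { revert HFe Hlt Hp. clear. intros _ H1 H2. revert H1 H2.
    generalize (M * exp (- (D / 128) * INR N)) (Cmod (P z0)); intros x y H1 H2.
    assert (forall n, x ^ S n < y ^ S n).
    { induction n as [| n IH]; [simpl; lra |].
      change (x * x ^ S n < y * y ^ S n).
      assert (0 <= x ^ S n) by (apply pow_le; auto). nra. }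
    auto. }
  lra.
Qed.

(** * Part (ii) *)

Definition cdiff (f : C -> C) (z l : C) : Prop :=
  forall eps, 0 < eps -> exists d, 0 < d /\ forall w, Cmod (w - z) < d ->
    Cmod (f w - f z - l * (w - z)) <= eps * Cmod (w - z).

(** [cdiff] is the little-o form of the derivative, suited to estimates by moduli; this equivalence
    is the passage to and from [analytic_on]. *)
Lemma is_derive_cdiff (f : C -> C) (z l : C) :
  @is_derive C_AbsRing C_NormedModule f z l <-> cdiff f z l.
Proof.
  split.
  - intros [_ H] eps Heps.
    destruct (H z (fun P HP => HP) (mkposreal eps Heps)) as [d Hd].
    exists d; split; [apply cond_pos |]. intros w Hw.
    assert (K := Hd w Hw). simpl in K.
    replace (f w - f z - l * (w - z))%C with ((f w - f z) - (w - z) * l)%C by ring.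
    exact K.
  - intros H. split; [apply is_linear_scal_l |].
    intros x Hx eps.
    apply (@is_filter_lim_locally_unique C_AbsRing (AbsRing_NormedModule C_AbsRing)) in Hx. subst x.
    destruct (H eps (cond_pos eps)) as (d & Hd & K).
    exists (mkposreal d Hd). intros w Hw. assert (K' := K w Hw).
    replace (f w - f z - l * (w - z))%C with ((f w - f z) - (w - z) * l)%C in K' by ring.
    exact K'.
Qed.

Lemma cdiff_continuous (f : C -> C) (z l : C) : cdiff f z l ->
  forall eps, 0 < eps -> exists d, 0 < d /\ forall w, Cmod (w - z) < d -> Cmod (f w - f z) < eps.
Proof.
  intros H eps Heps. destruct (H 1 Rlt_0_1) as (d & Hd & K).
  assert (Hl := Cmod_ge_0 l).
  exists (Rmin d (eps / (2 + Cmod l))); split.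
  { apply Rmin_pos; auto. apply Rdiv_lt_0_compat; lra. }
  intros w Hw.
  assert (H1 := K w (Rlt_le_trans _ _ _ Hw (Rmin_l _ _))).
  assert (H2 := Rlt_le_trans _ _ _ Hw (Rmin_r _ _)).
  apply Rlt_div_r in H2; [| lra].
  replace (f w - f z)%C with ((f w - f z - l * (w - z)) + l * (w - z))%C by ring.
  eapply Rle_lt_trans; [apply Cmod_triangle |]. rewrite Cmod_mult.
  assert (H0 := Cmod_ge_0 (w - z)). nra.
Qed.

Lemma cdiff_of_quadratic (f : C -> C) (z l : C) (d k : R) : 0 < d ->
  (forall w, Cmod (w - z) < d -> Cmod (f w - f z - l * (w - z)) <= k * (Cmod (w - z) * Cmod (w - z))) ->
  cdiff f z l.
Proof.
  intros Hd H eps Heps. assert (Hk := Rabs_pos k).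
  exists (Rmin d (eps / (Rabs k + 1))); split.
  { apply Rmin_pos; auto. apply Rdiv_lt_0_compat; lra. }
  intros w Hw.
  assert (H1 := H w (Rlt_le_trans _ _ _ Hw (Rmin_l _ _))).
  assert (H2 := Rlt_le_trans _ _ _ Hw (Rmin_r _ _)).
  apply Rlt_div_r in H2; [| lra].
  assert (H0 := Cmod_ge_0 (w - z)). eapply Rle_trans; [exact H1 |].
  rewrite <- Rmult_assoc. apply Rmult_le_compat_r; auto.
  generalize (Rle_abs k); nra.
Qed.

Lemma cdiff_plus (f g : C -> C) (z l m : C) :
  cdiff f z l -> cdiff g z m -> cdiff (fun w => f w + g w)%C z (l + m)%C.
Proof.
  intros Hf Hg. apply is_derive_cdiff. apply is_derive_cdiff in Hf. apply is_derive_cdiff in Hg.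
  exact (is_derive_plus f g z l m Hf Hg).
Qed.

Lemma cdiff_poly (n : nat) (P : C -> C) (z : C) : poly_le n P -> exists l, cdiff P z l.
Proof.
  intros HP. destruct (poly_le_taylor3 (fun w => w) z n P HP (taylor3_id z))
    as (a & b & r & Hr & E).
  exists a.
  assert (Hb : bounded_near_0 (fun h => b + h * r h)%C) by bnd.
  destruct Hb as (c & d & Hd & Hc).
  apply cdiff_of_quadratic with d c; auto. intros w Hw.
  replace w with (z + (w - z))%C at 1 by ring. rewrite E.
  replace (_ - P z - _)%C with ((w - z) * (w - z) * (b + (w - z) * r (w - z)))%C by ring.
  rewrite !Cmod_mult, Rmult_comm. apply Rmult_le_compat_r.
  - apply Rmult_le_pos; apply Cmod_ge_0.
  - apply Hc; lra.
Qed.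

(** * Continuity, supremum norms and best errors *)

Definition contC (K : C -> Prop) (f : C -> C) : Prop :=
  forall z, K z -> forall eps, 0 < eps ->
    exists d, 0 < d /\ forall w, K w -> Cmod (w - z) < d -> Cmod (f w - f z) < eps.

Lemma continuous_on_contC (K : C -> Prop) (f : C -> C) :
  continuous_on (T := C_UniformSpace) (U := C_UniformSpace) K f -> contC K f.
Proof.
  intros H z Hz eps Heps.
  assert (Hl : locally (T := C_UniformSpace) (f z) (fun y => Cmod (y - f z) < eps)).
  { apply locally_C_Cmod. exists eps; auto. }
  assert (K' := H z Hz _ Hl). unfold filtermap, within in K'.
  apply locally_C_Cmod in K'. destruct K' as (d & Hd & HK).
  exists d; split; auto.
Qed.

Lemma contC_cont_on_set (K : C -> Prop) (f : C -> C) :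
  contC K f -> cont_on_set K (fun z => Cmod (f z)).
Proof.
  intros H z Hz eps Heps. destruct (H z Hz eps Heps) as (d & Hd & Hw).
  exists d; split; auto. intros w Kw Hwz. eapply Rle_lt_trans; [| apply (Hw w Kw Hwz)].
  assert (H1 := Cmod_triangle_rev (f w) (f z)). assert (H2 := Cmod_triangle_rev (f z) (f w)).
  rewrite Cmod_minus_sym in H2. apply Rabs_le; lra.
Qed.

Lemma contC_minus_poly (K : C -> Prop) (f P : C -> C) (n : nat) :
  contC K f -> poly_le n P -> contC K (fun z => f z - P z)%C.
Proof.
  intros Hf HP z Hz eps Heps.
  destruct (Hf z Hz (eps / 2)) as (d & Hd & H1); [lra |].
  destruct (poly_le_continuous n P z HP (eps / 2)) as (d' & Hd' & H2); [lra |].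
  exists (Rmin d d'); split; [apply Rmin_pos; auto |]. intros w Kw Hw.
  replace (f w - P w - (f z - P z))%C with ((f w - f z) - (P w - P z))%C by ring.
  eapply Rle_lt_trans; [apply Cmod_minus_le |].
  assert (H3 := H1 w Kw (Rlt_le_trans _ _ _ Hw (Rmin_l _ _))).
  assert (H4 := H2 w (Rlt_le_trans _ _ _ Hw (Rmin_r _ _))). lra.
Qed.

Lemma supnorm_le (X : C -> Prop) (g : C -> C) (m : R) :
  0 <= m -> (forall z, X z -> Cmod (g z) <= m) -> supnorm X g <= m.
Proof.
  intros Hm H. unfold supnorm.
  set (E := fun y : R => _). destruct (Lub_Rbar_correct E) as [H1 H2].
  assert (H3 : Rbar_le (Lub_Rbar E) m).
  { apply H2. intros y (z & Hz & ->). simpl; auto. }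
  destruct (Lub_Rbar E); simpl in *; lra.
Qed.

Lemma supnorm_ge (X : C -> Prop) (g : C -> C) (m : R) (z : C) :
  (forall z, X z -> Cmod (g z) <= m) -> X z -> Cmod (g z) <= supnorm X g.
Proof.
  intros H Hz. unfold supnorm.
  set (E := fun y : R => _). destruct (Lub_Rbar_correct E) as [H1 H2].
  assert (H3 : Rbar_le (Lub_Rbar E) m).
  { apply H2. intros y (w & Hw & ->). simpl; auto. }
  assert (H4 : Rbar_le (Cmod (g z)) (Lub_Rbar E)) by (apply H1; exists z; auto).
  destruct (Lub_Rbar E); simpl in *; tauto.
Qed.

Lemma supnorm_ge_0 (X : C -> Prop) (g : C -> C) : 0 <= supnorm X g.
Proof.
  unfold supnorm. set (E := fun y : R => _). destruct (Lub_Rbar_correct E) as [H1 H2].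
  destruct (classic (exists y, E y)) as [[y Hy] | HN].
  - assert (H3 := H1 y Hy). destruct Hy as (z & _ & ->).
    assert (H0 := Cmod_ge_0 (g z)). destruct (Lub_Rbar E); simpl in *; lra.
  - assert (H3 : Rbar_le (Lub_Rbar E) m_infty).
    { apply H2. intros y Hy; exfalso; eauto. }
    destruct (Lub_Rbar E); simpl in *; try tauto; lra.
Qed.

(** The infimum is finite because distances are nonnegative and the zero polynomial competes, so
    [real] returns its true value. *)
Lemma best_error_spec (K : C -> Prop) (f : C -> C) (n : nat) :
  0 <= best_error K f n /\
  (forall P, poly_le n P -> best_error K f n <= dist_on K f P) /\
  (forall eta, 0 < eta -> exists P, poly_le n P /\ dist_on K f P < best_error K f n + eta).
Proof.
  unfold best_error. set (E := fun y : R => _). destruct (Glb_Rbar_correct E) as [H1 H2].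
  assert (H3 : Rbar_le 0 (Glb_Rbar E)).
  { apply H2. intros y (P & _ & ->). apply supnorm_ge_0. }
  assert (H4 : forall P, poly_le n P -> Rbar_le (Glb_Rbar E) (dist_on K f P)).
  { intros P HP. apply H1. exists P; auto. }
  assert (H5 := H4 _ (poly_le_const n 0%C)).
  destruct (Glb_Rbar E) as [g | |] eqn:Eg; simpl in H3, H5; try tauto.
  simpl. repeat split; auto.
  intros eta Heta. apply NNPP; intros HN.
  assert (H6 : Rbar_le (g + eta) g).
  { apply H2. intros y (P & HP & ->). apply Rnot_lt_le; intros Hlt. apply HN. exists P; auto. }
  simpl in H6; lra.
Qed.

(** * Geometric convergence and analytic limits *)

Lemma geometric_limit_R (v : nat -> R) (A x : R) : 0 <= x < 1 ->
  (forall n, Rabs (v (S n) - v n) <= A * x ^ n) ->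
  exists l, forall n, Rabs (v n - l) <= A / (1 - x) * x ^ n.
Proof.
  intros Hx H.
  assert (HA : 0 <= A).
  { eapply Rle_trans; [apply Rabs_pos |]. eapply Rle_trans; [apply (H 0%nat) |]. simpl; lra. }
  assert (Hk : forall k n, Rabs (v (n + k)%nat - v n) <= A / (1 - x) * x ^ n * (1 - x ^ k)).
  { induction k as [| k IH]; intros n.
    - rewrite Nat.add_0_r. replace (v n - v n) with 0 by ring. rewrite Rabs_R0; simpl; lra.
    - replace (n + S k)%nat with (S (n + k)) by lia.
      replace (v (S (n + k)) - v n) with ((v (S (n + k)) - v (n + k)%nat) + (v (n + k)%nat - v n)) by ring.
      eapply Rle_trans; [apply Rabs_triang |].
      eapply Rle_trans; [apply Rplus_le_compat; [apply H | apply IH] |].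
      rewrite pow_add. simpl. right; field; lra. }
  assert (HA' : 0 <= A / (1 - x)) by (apply Rdiv_le_0_compat; lra).
  assert (Hb : forall k n, Rabs (v (n + k)%nat - v n) <= A / (1 - x) * x ^ n).
  { intros k n. eapply Rle_trans; [apply Hk |].
    assert (0 <= x ^ n) by (apply pow_le; lra). assert (0 <= x ^ k) by (apply pow_le; lra).
    assert (0 <= A / (1 - x) * x ^ n) by (apply Rmult_le_pos; auto). nra. }
  destruct (Rcomplete.R_complete v) as [l Hl].
  { intros eps Heps.
    destruct (pow_lt_1_zero x ltac:(rewrite Rabs_pos_eq; lra) (eps / 2 / (A / (1 - x) + 1))) as [N HN].
    { apply Rdiv_lt_0_compat; lra. }
    assert (HNb : forall n, (n >= N)%nat -> Rabs (v n - v N) < eps / 2).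
    { intros n Hn. replace n with (N + (n - N))%nat by lia.
      eapply Rle_lt_trans; [apply Hb |]. assert (K := HN N (le_n N)).
      rewrite Rabs_pos_eq in K by (apply pow_le; lra). apply Rlt_div_r in K; [| lra].
      assert (0 <= x ^ N) by (apply pow_le; lra). nra. }
    exists N. intros n m Hn Hm. unfold Rdist.
    replace (v n - v m) with ((v n - v N) - (v m - v N)) by ring.
    eapply Rle_lt_trans; [apply Rabs_triang |]. rewrite Rabs_Ropp.
    assert (K1 := HNb n Hn). assert (K2 := HNb m Hm). lra. }
  exists l. intros n. apply le_epsilon; intros eps Heps.
  destruct (Hl eps Heps) as [N HN]. assert (K := HN (n + N)%nat ltac:(lia)). unfold Rdist in K.
  replace (v n - l) with ((v (n + N)%nat - l) - (v (n + N)%nat - v n)) by ring.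
  eapply Rle_trans; [apply Rabs_triang |]. rewrite Rabs_Ropp.
  generalize (Hb N n); lra.
Qed.

Lemma geometric_limit (u : nat -> C) (A x : R) : 0 <= x < 1 ->
  (forall n, Cmod (u (S n) - u n) <= A * x ^ n) ->
  exists l, forall n, Cmod (u n - l) <= 2 * (A / (1 - x)) * x ^ n.
Proof.
  intros Hx H.
  destruct (geometric_limit_R (fun n => Re (u n)) A x Hx) as [a Ha].
  { intros n. eapply Rle_trans; [| apply H]. eapply Rle_trans; [| apply re_le_Cmod].
    right; f_equal; unfold Re; simpl; ring. }
  destruct (geometric_limit_R (fun n => Im (u n)) A x Hx) as [b Hb].
  { intros n. eapply Rle_trans; [| apply H]. eapply Rle_trans; [| apply Rabs_Im_le_Cmod].
    right; f_equal; unfold Im; simpl; ring. }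
  exists (a, b). intros n. eapply Rle_trans; [apply Cmod_le_Rabs |].
  assert (Ha' := Ha n). assert (Hb' := Hb n). unfold Re, Im in *; simpl. unfold Rminus in *. lra.
Qed.

(** Cauchy estimates without integrals. Dividing by [w - z] twice leaves polynomials that the
    maximum principle bounds from the circle [|w| = rho], where [|w - z| >= rho / 2]. The constants
    do not involve the degree, so they pass to limits. *)
Lemma poly_second_order (n : nat) (P : C -> C) (rho m : R) : poly_le n P -> 0 < rho ->
  (forall z, Cmod z <= rho -> Cmod (P z) <= m) ->
  forall z, Cmod z <= rho / 2 -> exists l, Cmod l <= 4 * m / rho /\
    forall w, Cmod w <= rho ->
      Cmod (P w - P z - l * (w - z)) <= 16 * m / (rho * rho) * (Cmod (w - z) * Cmod (w - z)).
Proof.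
  intros HP Hrho Hm z Hz.
  assert (HP2 : poly_le (S (S n)) P) by auto using poly_le_S.
  destruct (poly_le_factor z (S n) P HP2) as (Q & HQ & EQ).
  destruct (poly_le_factor z n Q HQ) as (S' & HS & ES).
  assert (Hfar : forall w, Cmod (w - 0) = rho -> rho / 2 <= Cmod (w - z)).
  { intros w Hw. replace (w - 0)%C with w in Hw by ring.
    generalize (Cmod_triangle_rev w z); lra. }
  assert (HT : forall k T, poly_le k T -> forall w, taylor3 T w).
  { intros k T HT w. apply (poly_le_taylor3 (fun v => v) w k T); auto using taylor3_id. }
  assert (HQb : forall w, Cmod w <= rho -> Cmod (Q w) <= 4 * m / rho).
  { intros w Hw. apply (maximum_principle_disc Q 0 rho); eauto.
    - clear w Hw. intros w Hw. assert (Hf := Hfar w Hw).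
      replace (w - 0)%C with w in Hw by ring.
      assert (E : ((w - z) * Q w)%C = (P w - P z)%C) by (rewrite (EQ w); ring).
      apply (f_equal Cmod) in E. rewrite Cmod_mult in E.
      assert (K : Cmod (P w - P z) <= 2 * m).
      { eapply Rle_trans; [apply Cmod_minus_le |].
        generalize (Hm w ltac:(lra)) (Hm z ltac:(lra)); lra. }
      apply Rle_div_r; auto. assert (H0 := Cmod_ge_0 (Q w)). nra.
    - replace (w - 0)%C with w by ring; auto. }
  assert (HSb : forall w, Cmod w <= rho -> Cmod (S' w) <= 16 * m / (rho * rho)).
  { intros w Hw. apply (maximum_principle_disc S' 0 rho); eauto.
    - clear w Hw. intros w Hw. assert (Hf := Hfar w Hw).
      replace (w - 0)%C with w in Hw by ring.
      assert (E : ((w - z) * S' w)%C = (Q w - Q z)%C) by (rewrite (ES w); ring).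
      apply (f_equal Cmod) in E. rewrite Cmod_mult in E.
      assert (K : Cmod (Q w - Q z) <= 8 * m / rho).
      { eapply Rle_trans; [apply Cmod_minus_le |].
        replace (8 * m / rho) with (4 * m / rho + 4 * m / rho) by (field; lra).
        apply Rplus_le_compat; apply HQb; lra. }
      apply Rle_div_r; [nra |]. apply Rle_div_r in K; auto.
      assert (H0 := Cmod_ge_0 (S' w)). rewrite <- E in K.
      assert (rho / 2 * (Cmod (S' w) * rho) <= Cmod (w - z) * (Cmod (S' w) * rho))
        by (apply Rmult_le_compat_r; nra).
      lra.
    - replace (w - 0)%C with w by ring; auto. }
  exists (Q z). split; [apply HQb; lra |]. intros w Hw.
  replace (P w - P z - Q z * (w - z))%C with ((w - z) * (w - z) * S' w)%C
    by (rewrite (EQ w), (ES w); ring).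
  rewrite !Cmod_mult, Rmult_comm. apply Rmult_le_compat_r; auto.
  apply Rmult_le_pos; apply Cmod_ge_0.
Qed.

Lemma poly_bounded (n : nat) (P : C -> C) (rho : R) : poly_le n P ->
  exists m, forall z, Cmod z <= rho -> Cmod (P z) <= m.
Proof.
  intros HP. destruct (cont_bounded (fun z => Cmod z <= rho) rho (fun z => Cmod (P z))) as (M & _ & HM).
  - apply (lipschitz_closed _ 1), lipschitz_Cmod.
  - intros z Hz; auto.
  - intros z _ eps Heps. destruct (poly_le_continuous n P z HP eps Heps) as (d & Hd & H).
    exists d; split; auto. intros w _ Hw. eapply Rle_lt_trans; [| apply (H w Hw)].
    assert (H1 := Cmod_triangle_rev (P w) (P z)). assert (H2 := Cmod_triangle_rev (P z) (P w)).
    rewrite Cmod_minus_sym in H2. apply Rabs_le; lra.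
  - exists M; auto.
Qed.

Lemma exists_choice_function (X Y : Type) (Q : X -> Y -> Prop) :
  (forall x, exists y, Q x y) -> exists h, forall x, Q x (h x).
Proof.
  intros H. exists (fun x => proj1_sig (constructive_indefinite_description _ (H x))).
  intros x. destruct (constructive_indefinite_description _ (H x)); auto.
Qed.

(** The second order remainders of the increments are summable, so all [p n] satisfy a quadratic
    expansion at [z] with one constant, and the limit inherits it. *)
Lemma analytic_limit (p : nat -> C -> C) (A x rho : R) : 0 <= x < 1 -> 0 < rho ->
  (forall n, exists k, poly_le k (p n)) ->
  (forall n z, Cmod z <= rho -> Cmod (p (S n) z - p n z) <= A * x ^ n) ->
  exists g, (forall n z, Cmod z <= rho -> Cmod (p n z - g z) <= 2 * (A / (1 - x)) * x ^ n) /\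
    forall z, Cmod z < rho / 2 -> exists l, cdiff g z l.
Proof.
  intros Hx Hrho Hp H.
  assert (Hg : forall z, exists l, Cmod z <= rho ->
    forall n, Cmod (p n z - l) <= 2 * (A / (1 - x)) * x ^ n).
  { intros z. destruct (Rle_dec (Cmod z) rho) as [Hz | Hz].
    - destruct (geometric_limit (fun n => p n z) A x Hx) as [l Hl]; eauto.
    - exists 0%C; intros; contradiction. }
  destruct (exists_choice_function _ _ _ Hg) as [g Hg']. clear Hg.
  assert (Hg : forall n z, Cmod z <= rho -> Cmod (p n z - g z) <= 2 * (A / (1 - x)) * x ^ n)
    by auto.
  exists g. split; auto. intros z Hz.
  assert (HA : 0 <= A).
  { assert (K := H 0%nat 0%C). rewrite Cmod_0 in K. simpl in K.
    generalize (Cmod_ge_0 (p 1%nat 0%C - p 0%nat 0%C)); lra. }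
  assert (Hln : forall n, exists l, Cmod l <= 4 * (A * x ^ n) / rho /\
    forall w, Cmod w <= rho -> Cmod (p (S n) w - p n w - (p (S n) z - p n z) - l * (w - z)) <=
      16 * (A * x ^ n) / (rho * rho) * (Cmod (w - z) * Cmod (w - z))).
  { intros n. destruct (Hp n) as [k1 Hk1]. destruct (Hp (S n)) as [k2 Hk2].
    apply (poly_second_order (k1 + k2) (fun w => p (S n) w - p n w)%C rho (A * x ^ n)); auto; [| lra].
    apply poly_le_minus; eapply poly_le_mono; [| exact Hk2 | | exact Hk1]; lia. }
  destruct (Hp 0%nat) as [k0 Hk0].
  destruct (poly_bounded k0 (p 0%nat) rho Hk0) as [m Hm].
  destruct (poly_second_order k0 (p 0%nat) rho m Hk0 Hrho Hm z) as (l0 & _ & Hl0); [lra |].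
  destruct (exists_choice_function _ _ _ Hln) as [ln Hlns]. clear Hln.
  (* Linear coefficients accumulated from the increments; their limit is the derivative of [g] at
     [z]. *)
  pose (L := fix L n := match n with O => l0 | S k => (L k + ln k)%C end).
  assert (HL : exists l, forall n, Cmod (L n - l) <= 2 * (4 * A / rho / (1 - x)) * x ^ n).
  { apply geometric_limit; auto. intros n. simpl.
    replace (L n + ln n - L n)%C with (ln n) by ring.
    eapply Rle_trans; [apply Hlns |]. right; field; lra. }
  destruct HL as [l Hl]. exists l.
  set (k2 := 16 * A / (rho * rho) / (1 - x)).
  assert (Hk2 : 0 <= k2).
  { apply Rdiv_le_0_compat; [apply Rdiv_le_0_compat; nra | lra]. }
  assert (Hpart : forall n w, Cmod w <= rho -> Cmod (p n w - p n z - L n * (w - z)) <=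
    (16 * m / (rho * rho) + k2 * (1 - x ^ n)) * (Cmod (w - z) * Cmod (w - z))).
  { intros n w Hw; induction n as [| n IH].
    - simpl. eapply Rle_trans; [apply Hl0; auto |]. right; ring.
    - simpl L.
      replace (p (S n) w - p (S n) z - (L n + ln n) * (w - z))%C with
        ((p n w - p n z - L n * (w - z)) +
         (p (S n) w - p n w - (p (S n) z - p n z) - ln n * (w - z)))%C by ring.
      eapply Rle_trans; [apply Cmod_triangle |].
      eapply Rle_trans; [apply Rplus_le_compat; [exact IH | apply Hlns; auto] |].
      rewrite <- Rmult_plus_distr_r. right. f_equal. unfold k2; simpl; field; lra. }
  apply cdiff_of_quadratic with (rho / 2) (16 * m / (rho * rho) + k2); [lra |].
  intros w Hw.
  assert (Hwr : Cmod w <= rho).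
  { replace w with ((w - z) + z)%C by ring. eapply Rle_trans; [apply Cmod_triangle | lra]. }
  apply le_epsilon; intros eps Heps.
  set (G := 2 * (A / (1 - x))). set (G' := 2 * (4 * A / rho / (1 - x))).
  assert (HG : 0 <= G) by (unfold G; apply Rmult_le_pos; [lra | apply Rdiv_le_0_compat; lra]).
  assert (HG' : 0 <= G').
  { unfold G'; apply Rmult_le_pos; [lra |]. apply Rdiv_le_0_compat; [apply Rdiv_le_0_compat |]; lra. }
  set (d := Cmod (w - z)) in *. assert (Hd0 : 0 <= d) by apply Cmod_ge_0.
  destruct (pow_lt_1_zero x ltac:(rewrite Rabs_pos_eq; lra) (eps / (2 * G + G' * d + 1))) as [N HN].
  { apply Rdiv_lt_0_compat; nra. }
  assert (HNN := HN N (le_n N)).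
  assert (HxN : 0 <= x ^ N) by (apply pow_le; lra).
  rewrite Rabs_pos_eq in HNN by auto. apply Rlt_div_r in HNN; [| nra].
  replace (g w - g z - l * (w - z))%C with
    ((p N w - p N z - L N * (w - z)) + (L N - l) * (w - z) + ((p N z - g z) - (p N w - g w)))%C by ring.
  eapply Rle_trans; [apply Cmod_triangle |].
  assert (T1 := Cmod_triangle (p N w - p N z - L N * (w - z)) ((L N - l) * (w - z))).
  rewrite (Cmod_mult (L N - l)) in T1. fold d in T1.
  assert (T2 := Cmod_minus_le (p N z - g z) (p N w - g w)).
  assert (T3 := Hpart N w Hwr). fold d in T3.
  assert (T4 := Hl N). fold G' in T4.
  assert (T5 := Hg N z ltac:(lra)). assert (T6 := Hg N w Hwr). fold G in T5, T6.
  assert (T7 : Cmod (L N - l) * d <= G' * x ^ N * d) by (apply Rmult_le_compat_r; auto).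
  assert (T8 : (16 * m / (rho * rho) + k2 * (1 - x ^ N)) * (d * d) <=
    (16 * m / (rho * rho) + k2) * (d * d)) by (apply Rmult_le_compat_r; nra).
  nra.
Qed.

(** * Approach to the boundary and conclusion of part (ii) *)

Lemma sector_shrink (t rad s : R) (z : C) : 0 < t < PI / 2 -> 0 < rad -> 0 < s <= 1 ->
  sector t rad z -> open_sector t rad (RtoC (1 - s) * z + RtoC s * RtoC (rad / 2)).
Proof.
  intros Ht Hrad Hs [H1 H2].
  assert (Hsin : 0 < sin t) by (apply sin_gt_0; lra).
  split.
  - replace (Im (RtoC (1 - s) * z + RtoC s * RtoC (rad / 2))) with ((1 - s) * Im z)
      by (unfold Im; simpl; ring).
    replace (Re (RtoC (1 - s) * z + RtoC s * RtoC (rad / 2))) with ((1 - s) * Re z + s * (rad / 2))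
      by (unfold Re; simpl; ring).
    rewrite Rabs_mult, (Rabs_pos_eq (1 - s)) by lra.
    assert (0 < s * (rad / 2) * sin t) by (repeat apply Rmult_lt_0_compat; lra).
    nra.
  - eapply Rle_lt_trans; [apply Cmod_triangle |].
    rewrite !Cmod_mult, !Cmod_R, !Rabs_pos_eq by lra. nra.
Qed.

Lemma double_sector_closed (alpha rad : R) : 0 < alpha < 1 -> closed_set (double_sector alpha rad).
Proof.
  intros Ha z Hz. assert (HP := PI_RGT_0).
  assert (Ht : 0 < alpha * PI / 2 < PI / 2) by nra.
  rewrite double_sector_iff in Hz by auto.
  destruct (sector_closed _ rad Ht z) as (d & Hd & H); [tauto |].
  destruct (sector_closed _ rad Ht (- z)%C) as (d' & Hd' & H'); [tauto |].
  exists (Rmin d d'); split; [apply Rmin_pos; auto |]. intros w Hw.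
  rewrite double_sector_iff by auto. intros [K | K].
  - apply (H w); auto. eapply Rlt_le_trans; [exact Hw | apply Rmin_l].
  - apply (H' (- w)%C); auto. replace (- w - - z)%C with (- (w - z))%C by ring.
    rewrite Cmod_opp. eapply Rlt_le_trans; [exact Hw | apply Rmin_r].
Qed.

Lemma double_sector_bounded (alpha rad : R) : 0 < alpha < 1 ->
  bounded_set rad (double_sector alpha rad).
Proof.
  intros Ha z Hz. apply double_sector_iff in Hz; auto.
  destruct Hz as [[_ H] | [_ H]]; auto. rewrite Cmod_opp in H; auto.
Qed.

Lemma interior_shrink (alpha rad : R) (z : C) (d : R) : 0 < alpha < 1 -> 0 < rad -> 0 < d ->
  double_sector alpha rad z ->
  exists w, interior_C (double_sector alpha rad) w /\ double_sector alpha rad w /\ Cmod (w - z) < d.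
Proof.
  intros Ha Hrad Hd Hz. assert (HP := PI_RGT_0).
  assert (Ht : 0 < alpha * PI / 2 < PI / 2) by nra.
  set (s := Rmin 1 (d / (2 * (rad + rad)))).
  assert (Hs : 0 < s <= 1).
  { split; [apply Rmin_pos; [lra | apply Rdiv_lt_0_compat; lra] | apply Rmin_l]. }
  assert (Hs2 : s <= d / (2 * (rad + rad))) by apply Rmin_r.
  apply Rle_div_r in Hs2; [| lra].
  assert (Hdist : forall u, Cmod u <= rad ->
    Cmod (RtoC (1 - s) * u + RtoC s * RtoC (rad / 2) - u) < d).
  { intros u Hu. replace (RtoC (1 - s) * u + RtoC s * RtoC (rad / 2) - u)%C with
      (RtoC s * (RtoC (rad / 2) - u))%C by (rewrite RtoC_minus; ring).
    rewrite Cmod_mult, Cmod_R, Rabs_pos_eq by lra.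
    assert (Cmod (RtoC (rad / 2) - u) <= rad + rad).
    { eapply Rle_trans; [apply Cmod_minus_le |]. rewrite Cmod_R, Rabs_pos_eq; lra. }
    nra. }
  apply double_sector_iff in Hz; auto. destruct Hz as [Hz | Hz].
  - exists (RtoC (1 - s) * z + RtoC s * RtoC (rad / 2))%C.
    assert (Ho := sector_shrink _ rad s z Ht Hrad Hs Hz).
    repeat split; [apply interior_double_sector; auto | apply double_sector_iff; auto | apply Hdist, Hz].
    left; apply open_sector_sector; auto.
  - exists (- (RtoC (1 - s) * - z + RtoC s * RtoC (rad / 2)))%C.
    assert (Ho := sector_shrink _ rad s (- z) Ht Hrad Hs Hz).
    replace (RtoC (1 - s) * - z + RtoC s * RtoC (rad / 2))%C with
      (- - (RtoC (1 - s) * - z + RtoC s * RtoC (rad / 2)))%C in Ho by ring.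
    repeat split; [apply interior_double_sector; auto | apply double_sector_iff; auto |].
    + right; apply open_sector_sector; auto.
    + replace (- (RtoC (1 - s) * - z + RtoC s * RtoC (rad / 2)) - z)%C with
        (- (RtoC (1 - s) * - z + RtoC s * RtoC (rad / 2) - - z))%C by ring.
      rewrite Cmod_opp. apply Hdist, Hz.
Qed.

Lemma contC_minus_bounded (alpha rad : R) (f P : C -> C) (n : nat) : 0 < alpha < 1 ->
  contC (double_sector alpha rad) f -> poly_le n P ->
  exists m, 0 <= m /\ forall z, double_sector alpha rad z -> Cmod (f z - P z) <= m.
Proof.
  intros Ha Hf HP.
  apply (cont_bounded _ rad (fun z => Cmod (f z - P z))).
  - apply double_sector_closed; auto.
  - apply double_sector_bounded; auto.
  - apply contC_cont_on_set with (f := fun z => (f z - P z)%C). eapply contC_minus_poly; eauto.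
Qed.

Lemma dist_on_ge (alpha rad : R) (f P : C -> C) (n : nat) (E : C -> Prop) (z : C) : 0 < alpha < 1 ->
  contC (double_sector alpha rad) f -> poly_le n P ->
  (forall w, E w -> double_sector alpha rad w) -> E z -> Cmod (f z - P z) <= dist_on E f P.
Proof.
  intros Ha Hf HP HE Hz.
  destruct (contC_minus_bounded alpha rad f P n Ha Hf HP) as (m & _ & Hm).
  apply (supnorm_ge E (fun z => f z - P z)%C m z); auto.
Qed.

Lemma geometric_rate_eventually (alpha rad : R) (f : C -> C) (p : nat -> C -> C) (E : C -> Prop) :
  0 < alpha < 1 -> contC (double_sector alpha rad) f -> (forall n, (1 <= n)%nat -> poly_le n (p n)) ->
  geometric_rate (double_sector alpha rad) f p ->
  compact_C E -> (forall z, E z -> interior_C (double_sector alpha rad) z) ->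
  exists c N, 0 < c /\ (1 <= N)%nat /\ forall n z, (N <= n)%nat -> E z ->
    Cmod (f z - p n z) <= exp (- c * INR n).
Proof.
  intros Ha Hf Hp Hg HE HEi. destruct (Hg E HE HEi) as (c & Hc & Hl).
  unfold LimSup_seq in Hl. destruct (ex_LimSup_seq _) as [l Hls]. simpl in Hl. subst l.
  (* Tolerance 1 in the upper limit: the distance times [exp (c n)] is eventually below 1. The index
     [S N] also guarantees [n >= 1], where [p n] is a polynomial. *)
  destruct (Hls (mkposreal 1 Rlt_0_1)) as [_ [N HN]]. simpl in HN.
  exists c, (S N). split; auto. split; [lia |]. intros n z Hn Hz.
  apply Rmult_le_reg_r with (exp (c * INR n)); [apply exp_pos |].
  rewrite <- exp_plus. replace (- c * INR n + c * INR n) with 0 by ring. rewrite exp_0.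
  eapply Rle_trans; [| left; specialize (HN n ltac:(lia)); rewrite Rplus_0_l in HN; exact HN].
  apply Rmult_le_compat_r; [left; apply exp_pos |].
  apply (dist_on_ge alpha rad f (p n) n); auto; [apply Hp; lia |].
  intros w Hw. assert (Hi := HEi w Hw). apply locally_C_Cmod in Hi. destruct Hi as (d & Hd & H).
  apply H. replace (w - w)%C with (RtoC 0) by ring. rewrite Cmod_0; auto.
Qed.

(** Part (ii) in contrapositive form: the limit of the polynomials near 0 is the analytic extension
    of [f]. *)
Lemma geometric_rate_analytic (alpha rad : R) (f : C -> C) (p : nat -> C -> C) :
  / 2 < alpha < 1 -> 0 < rad -> contC (double_sector alpha rad) f ->
  near_best (double_sector alpha rad) f p -> geometric_rate (double_sector alpha rad) f p ->
  analytic_at (double_sector alpha rad) f (RtoC 0).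
Proof.
  intros Ha Hrad Hf [Hp (c0 & Hc0 & Hnb)] Hg. assert (HPI := PI_RGT_0).
  assert (Ha' : 0 < alpha < 1) by lra.
  set (K := double_sector alpha rad) in *. set (t := alpha * PI / 2).
  assert (Ht : PI / 4 < t < PI / 2) by (unfold t; nra).
  assert (Ht' : 0 < t < PI / 2) by lra.
  assert (HKs : forall z, sector t rad z \/ sector t rad (- z) -> K z)
    by (intros z; apply double_sector_iff; auto).
  destruct (contC_minus_bounded alpha rad f (fun _ => 0%C) 0 Ha' Hf (poly_le_const 0 0%C))
    as (Mf & HMf & Hfb).
  assert (Hpb : forall n z, (1 <= n)%nat -> K z -> Cmod (p n z) <= Mf + c0 * Mf).
  { intros n z Hn Hz.
    assert (H1 : Cmod (f z - p n z) <= c0 * Mf).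
    { eapply Rle_trans; [apply (dist_on_ge alpha rad f (p n) n K z); auto |].
      eapply Rle_trans; [apply Hnb; auto |]. apply Rmult_le_compat_l; [lra |].
      eapply Rle_trans; [apply best_error_spec, (poly_le_const n 0%C) |].
      apply supnorm_le; auto. }
    assert (H2 := Hfb z Hz). replace (f z - 0)%C with (f z) in H2 by ring.
    replace (p n z) with (f z - (f z - p n z))%C by ring.
    eapply Rle_trans; [apply Cmod_minus_le | lra]. }
  destruct (local_decay t rad Ht Hrad) as (phi1 & Hphi1 & Hloc).
  (* The arc [|z| = rad / 2], [|arg z| <= phi1] of the right lobe: compact, interior, and exactly
     where [local_decay] asks for exponential smallness. *)
  set (E := fun z => (sector phi1 (rad / 2) z /\ - Cmod z <= - (rad / 2))).
  assert (HEc : compact_C E).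
  { apply closed_bounded_compact with (rad / 2).
    - apply closed_set_and; [apply sector_closed; lra |].
      apply (lipschitz_closed (fun z => - Cmod z) 1). intros z w.
      rewrite Cmod_minus_sym. generalize (lipschitz_Cmod w z); lra.
    - intros z [H _]; apply H. }
  assert (HEi : forall z, E z -> interior_C K z).
  { intros z [H1 H2]. apply interior_double_sector; auto. left.
    assert (Hz0 : z <> 0%C) by (apply Cmod_gt_0; lra).
    assert (Hx : 0 < Re z) by (apply (sector_pos phi1 (rad / 2)); auto; lra).
    destruct H1 as [H1 H3]. split; [| lra].
    assert (C1 : 0 < cos phi1) by (apply cos_gt_0; lra).
    assert (C2 : 0 < cos t) by (apply cos_gt_0; lra).
    assert (S1 : 0 < sin (t - phi1)) by (apply sin_gt_0; lra).
    rewrite sin_minus in S1. fold t.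
    apply Rmult_lt_reg_r with (cos phi1); auto.
    apply Rle_lt_trans with (Re z * sin phi1 * cos t); [| nra].
    replace (Rabs (Im z) * cos t * cos phi1) with (Rabs (Im z) * cos phi1 * cos t) by ring.
    apply Rmult_le_compat_r; lra. }
  destruct (geometric_rate_eventually alpha rad f p E Ha' Hf Hp Hg HEc HEi)
    as (c & N & Hc & HN & HE).
  destruct (Hloc c Hc) as (r0 & c1 & Hr0 & Hc1 & Hdec).
  (* The first term bounds two successive polynomials on [K]. The second absorbs the index shift, as
     [exp (- c m) = exp c * exp (- c (m + 1))] and the difference has degree [m + 1]. *)
  set (M := 2 * (Mf + c0 * Mf) + 2 * exp c).
  assert (Hec : 0 < exp c) by apply exp_pos.
  assert (HM0 : 0 <= Mf + c0 * Mf) by nra.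
  assert (Hstep : forall n z, Cmod z <= r0 ->
    Cmod (p (S (n + N)) z - p (n + N)%nat z) <= M * exp (- c1) ^ n).
  { intros n z Hz. set (m := (n + N)%nat).
    eapply Rle_trans; [apply (Hdec (S m) (fun z => p (S m) z - p m z)%C M); auto |].
    - apply poly_le_minus; [apply Hp; lia | apply poly_le_S, Hp; lia].
    - intros w Hw. eapply Rle_trans; [apply Cmod_minus_le |].
      assert (K1 := Hpb m w ltac:(lia) (HKs w Hw)).
      assert (K2 := Hpb (S m) w ltac:(lia) (HKs w Hw)). unfold M; lra.
    - intros phi Hphi.
      assert (HEw : E (RtoC (rad / 2) * cis phi)%C).
      { split; [apply sector_cis; lra |]. rewrite Cmod_polar; lra. }
      assert (K1 := HE m _ ltac:(lia) HEw). assert (K2 := HE (S m) _ ltac:(lia) HEw).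
      set (w := (RtoC (rad / 2) * cis phi)%C) in *.
      replace (p (S m) w - p m w)%C with ((f w - p m w) - (f w - p (S m) w))%C by ring.
      eapply Rle_trans; [apply Cmod_minus_le |].
      assert (E1 : exp (- c * INR m) = exp c * exp (- c * INR (S m))).
      { rewrite <- exp_plus, S_INR; f_equal; ring. }
      assert (E2 : exp (- c * INR (S m)) <= exp (- c * INR m)).
      { apply exp_mono. rewrite S_INR. nra. }
      assert (E3 : 0 < exp (- c * INR (S m))) by apply exp_pos.
      unfold M; nra.
    - apply Rmult_le_compat_l; [unfold M; lra |]. rewrite exp_pow_INR. apply exp_mono.
      unfold m. rewrite S_INR, plus_INR. generalize (pos_INR N); nra. }
  assert (Hx : 0 <= exp (- c1) < 1).
  { split; [left; apply exp_pos |]. rewrite <- exp_0. apply exp_increasing; lra. }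
  destruct (analytic_limit (fun n => p (n + N)%nat) M (exp (- c1)) r0) as (g & Hg1 & Hg2); auto.
  { intros n; exists (n + N)%nat; apply Hp; lia. }
  (* At an interior point the geometric rate is applied to the one-point compact set, described by
     two inequalities; it forces [p n z] to converge to [f z]. *)
  assert (Hgf : forall z, Cmod z < r0 / 2 -> interior_C K z -> g z = f z).
  { intros z Hz Hzi.
    destruct (geometric_rate_eventually alpha rad f p (fun w => - Cmod (w - z) <= 0 /\ Cmod (w - z) <= 0)
      Ha' Hf Hp Hg) as (c2 & N2 & Hc2 & _ & H2).
    { apply closed_bounded_compact with (Cmod z).
      - apply closed_set_and; [| apply (lipschitz_closed _ 1), lipschitz_dist].
        apply (lipschitz_closed (fun w => - Cmod (w - z)) 1). intros u v.
        rewrite (Cmod_minus_sym v u). generalize (lipschitz_dist z v u); lra.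
      - intros w [_ Hw]. replace w with ((w - z) + z)%C by ring.
        eapply Rle_trans; [apply Cmod_triangle | lra]. }
    { intros w [_ Hw]. replace w with z; auto.
      assert (H0 : Cmod (w - z) = 0) by (generalize (Cmod_ge_0 (w - z)); lra).
      apply Cmod_eq_0 in H0. replace w with ((w - z) + z)%C by ring. rewrite H0; ring. }
    assert (H0 : Cmod (g z - f z) = 0).
    { apply Rle_antisym; [| apply Cmod_ge_0]. apply le_epsilon; intros eps Heps. rewrite Rplus_0_l.
      set (G := 2 * (M / (1 - exp (- c1)))).
      assert (HG : 0 <= G).
      { unfold G; apply Rmult_le_pos; [lra |]. apply Rdiv_le_0_compat; unfold M; lra. }
      destruct (pow_lt_1_zero (exp (- c1)) ltac:(rewrite Rabs_pos_eq; lra) (eps / 2 / (G + 1))) as [N3 HN3].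
      { apply Rdiv_lt_0_compat; lra. }
      assert (Hx2 : 0 <= exp (- c2) < 1).
      { split; [left; apply exp_pos |]. rewrite <- exp_0. apply exp_increasing; lra. }
      destruct (pow_lt_1_zero (exp (- c2)) ltac:(rewrite Rabs_pos_eq; lra) (eps / 2)) as [N4 HN4]; [lra |].
      set (n := (N2 + N3 + N4)%nat).
      assert (K1 := Hg1 n z ltac:(lra)). fold G in K1.
      assert (K2 := HN3 n ltac:(unfold n; lia)).
      assert (Hpp : 0 <= exp (- c1) ^ n) by (apply pow_le; lra).
      rewrite Rabs_pos_eq in K2 by auto.
      apply Rlt_div_r in K2; [| lra].
      assert (K3 := H2 (n + N)%nat z ltac:(unfold n; lia)
        ltac:(replace (z - z)%C with (RtoC 0) by ring; rewrite Cmod_0; lra)).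
      assert (K4 := HN4 (n + N)%nat ltac:(unfold n; lia)).
      rewrite Rabs_pos_eq, exp_pow_INR in K4 by (apply pow_le; lra).
      replace (INR (n + N) * - c2) with (- c2 * INR (n + N)) in K4 by ring.
      replace (g z - f z)%C with (- ((p (n + N)%nat z - g z) + (f z - p (n + N)%nat z)))%C by ring.
      rewrite Cmod_opp. eapply Rle_trans; [apply Cmod_triangle |]. nra. }
    apply Cmod_eq_0 in H0. replace (g z) with ((g z - f z) + f z)%C by ring. rewrite H0; ring. }
  exists (fun z => Cmod z < r0 / 2), g. repeat split.
  - intros z Hz. apply locally_C_Cmod. apply (lipschitz_lt_near _ 1); auto using lipschitz_Cmod.
  - rewrite Cmod_0; lra.
  - intros z Hz. destruct (Hg2 z Hz) as [l Hl]. exists l. apply is_derive_cdiff; auto.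
  (* Boundary points, 0 included, are limits of interior points, and both [g] and [f] are continuous
     along them. *)
  - intros z Hz HKz.
    assert (H0 : Cmod (g z - f z) = 0).
    { apply Rle_antisym; [| apply Cmod_ge_0]. apply le_epsilon; intros eps Heps. rewrite Rplus_0_l.
      destruct (Hf z HKz (eps / 2)) as (d1 & Hd1 & H1); [lra |].
      destruct (Hg2 z Hz) as [l Hl].
      destruct (cdiff_continuous g z l Hl (eps / 2)) as (d2 & Hd2 & H2); [lra |].
      destruct (lipschitz_lt_near _ 1 _ z lipschitz_Cmod Hz) as (d3 & Hd3 & H3).
      destruct (interior_shrink alpha rad z (Rmin d1 (Rmin d2 d3)) Ha' Hrad) as (w & Hw1 & Hw2 & Hw3); auto.
      { repeat apply Rmin_pos; auto. }
      assert (L1 := Rmin_l d1 (Rmin d2 d3)). assert (L2 := Rmin_r d1 (Rmin d2 d3)).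
      assert (L3 := Rmin_l d2 d3). assert (L4 := Rmin_r d2 d3).
      assert (Ew : g w = f w) by (apply Hgf; auto; apply H3; lra).
      replace (g z - f z)%C with ((f w - f z) - (g w - g z))%C by (rewrite Ew; ring).
      eapply Rle_trans; [apply Cmod_minus_le |].
      assert (Q1 := H1 w Hw2 ltac:(lra)). assert (Q2 := H2 w ltac:(lra)). lra. }
    apply Cmod_eq_0 in H0. replace (g z) with ((g z - f z) + f z)%C by ring. rewrite H0; ring.
Qed.

(** * Cauchy's theorem *)

Definition pcont (h : R -> C) (t : R) : Prop :=
  continuous (fun s => Re (h s)) t /\ continuous (fun s => Im (h s)) t.

Lemma continuous_R_eps (f : R -> R) (t : R) : continuous f t <->
  forall eps, 0 < eps -> exists d, 0 < d /\ forall s, Rabs (s - t) < d -> Rabs (f s - f t) < eps.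
Proof.
  split.
  - intros H eps Heps.
    assert (Hl : locally (f t) (fun y => Rabs (y - f t) < eps)) by (exists (mkposreal eps Heps); auto).
    destruct (H _ Hl) as [d Hd]. exists d; split; [apply cond_pos | exact Hd].
  - intros H P [e He]. destruct (H e (cond_pos e)) as (d & Hd & K).
    exists (mkposreal d Hd). intros s Hs. apply He, K, Hs.
Qed.

Lemma pcont_eps (h : R -> C) (t : R) : pcont h t <->
  forall eps, 0 < eps -> exists d, 0 < d /\ forall s, Rabs (s - t) < d -> Cmod (h s - h t) < eps.
Proof.
  unfold pcont; rewrite !continuous_R_eps. split.
  - intros [H1 H2] eps Heps.
    destruct (H1 (eps / 2)) as (d & Hd & K1); [lra |].
    destruct (H2 (eps / 2)) as (d' & Hd' & K2); [lra |].
    exists (Rmin d d'); split; [apply Rmin_pos; auto |]. intros s Hs.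
    eapply Rle_lt_trans; [apply Cmod_le_Rabs |].
    assert (Q1 := K1 s (Rlt_le_trans _ _ _ Hs (Rmin_l _ _))).
    assert (Q2 := K2 s (Rlt_le_trans _ _ _ Hs (Rmin_r _ _))).
    unfold Re, Im, Rminus in *; simpl; lra.
  - intros H; split; intros eps Heps; destruct (H eps Heps) as (d & Hd & K);
      exists d; split; auto; intros s Hs; (eapply Rle_lt_trans; [| apply (K s Hs)]).
    + exact (re_le_Cmod (h s - h t)).
    + exact (Rabs_Im_le_Cmod (h s - h t)).
Qed.

Lemma pcont_const (c : C) (t : R) : pcont (fun _ => c) t.
Proof. split; apply continuous_const. Qed.

Lemma pcont_plus (h k : R -> C) (t : R) : pcont h t -> pcont k t -> pcont (fun s => h s + k s)%C t.
Proof.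
  intros [H1 H2] [K1 K2]; split; simpl.
  - apply (continuous_plus (fun s => Re (h s)) (fun s => Re (k s))); auto.
  - apply (continuous_plus (fun s => Im (h s)) (fun s => Im (k s))); auto.
Qed.

Lemma pcont_opp (h : R -> C) (t : R) : pcont h t -> pcont (fun s => - h s)%C t.
Proof.
  intros [H1 H2]; split; simpl; [apply (continuous_opp (fun s => Re (h s))) |
    apply (continuous_opp (fun s => Im (h s)))]; auto.
Qed.

Lemma pcont_minus (h k : R -> C) (t : R) : pcont h t -> pcont k t -> pcont (fun s => h s - k s)%C t.
Proof. intros; apply pcont_plus; auto using pcont_opp. Qed.

Lemma pcont_mult (h k : R -> C) (t : R) : pcont h t -> pcont k t -> pcont (fun s => h s * k s)%C t.
Proof.
  intros [H1 H2] [K1 K2]; split; simpl.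
  - apply (continuous_minus (fun s => Re (h s) * Re (k s)) (fun s => Im (h s) * Im (k s)));
      apply (continuous_mult (K := R_AbsRing)); auto.
  - apply (continuous_plus (fun s => Re (h s) * Im (k s)) (fun s => Im (h s) * Re (k s)));
      apply (continuous_mult (K := R_AbsRing)); auto.
Qed.

Lemma pcont_ext (h k : R -> C) (t : R) : (forall s, h s = k s) -> pcont h t -> pcont k t.
Proof.
  intros E [H1 H2]; split.
  - apply (continuous_ext (fun s => Re (h s))); [intros; rewrite E; reflexivity | exact H1].
  - apply (continuous_ext (fun s => Im (h s))); [intros; rewrite E; reflexivity | exact H2].
Qed.

Lemma pcont_pow (h : R -> C) (n : nat) (t : R) : pcont h t -> pcont (fun s => h s ^ n)%C t.
Proof.
  intros H; induction n as [| n IH]; simpl; [apply pcont_const | apply pcont_mult; auto].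
Qed.

Lemma pcont_comp (g : C -> C) (h : R -> C) (t : R) : pcont h t ->
  (forall eps, 0 < eps -> exists d, 0 < d /\ forall w, Cmod (w - h t) < d -> Cmod (g w - g (h t)) < eps) ->
  pcont (fun s => g (h s)) t.
Proof.
  rewrite !pcont_eps. intros H Hg eps Heps.
  destruct (Hg eps Heps) as (d & Hd & K). destruct (H d Hd) as (d' & Hd' & K').
  exists d'; split; auto.
Qed.

Lemma pcont_inv (h : R -> C) (t : R) : pcont h t -> h t <> RtoC 0 -> pcont (fun s => / h s)%C t.
Proof.
  intros H Hn. apply (pcont_comp Cinv); auto. intros eps Heps.
  set (a := h t) in *. assert (Ha := proj1 (Cmod_gt_0 _) Hn).
  exists (Rmin (Cmod a / 2) (eps * (Cmod a * Cmod a) / 2)). split.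
  { apply Rmin_pos; [lra |]. assert (0 < eps * (Cmod a * Cmod a)) by (apply Rmult_lt_0_compat; nra). lra. }
  intros w Hw.
  assert (H1 := Rlt_le_trans _ _ _ Hw (Rmin_l _ _)).
  assert (H2 := Rlt_le_trans _ _ _ Hw (Rmin_r _ _)).
  assert (H3 := Cmod_triangle_rev a w). rewrite Cmod_minus_sym in H3.
  assert (Hw0 : w <> RtoC 0) by (apply Cmod_gt_0; lra).
  replace (/ w - / a)%C with (- ((w - a) / (w * a)))%C by (field; auto).
  rewrite Cmod_opp, Cmod_div, Cmod_mult by (apply Cmult_neq_0; auto).
  assert (Hwa : Cmod a / 2 * Cmod a <= Cmod w * Cmod a) by (apply Rmult_le_compat_r; lra).
  assert (Haa : 0 < Cmod a * Cmod a) by (apply Rmult_lt_0_compat; auto).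
  apply Rlt_div_l; [lra |].
  assert (eps * (Cmod a / 2 * Cmod a) <= eps * (Cmod w * Cmod a)) by (apply Rmult_le_compat_l; lra).
  lra.
Qed.

Definition CInt (h : R -> C) : C :=
  (RInt (fun t => Re (h t)) 0 1, RInt (fun t => Im (h t)) 0 1).

Definition pcont01 (h : R -> C) : Prop := forall t, 0 <= t <= 1 -> pcont h t.

Lemma ex_RInt_01 (f : R -> R) (a b : R) : 0 <= a <= 1 -> 0 <= b <= 1 ->
  (forall t, 0 <= t <= 1 -> continuous f t) -> ex_RInt f a b.
Proof.
  intros Ha Hb H. apply (ex_RInt_continuous (V := R_CompleteNormedModule)). intros z Hz. apply H.
  revert Hz; unfold Rmin, Rmax; destruct (Rle_dec a b); lra.
Qed.

Lemma pcont01_ex_Re (h : R -> C) : pcont01 h -> ex_RInt (fun t => Re (h t)) 0 1.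
Proof. intros H; apply ex_RInt_01; try lra. intros t Ht; apply (H t Ht). Qed.

Lemma pcont01_ex_Im (h : R -> C) : pcont01 h -> ex_RInt (fun t => Im (h t)) 0 1.
Proof. intros H; apply ex_RInt_01; try lra. intros t Ht; apply (H t Ht). Qed.

Lemma CInt_ext (h k : R -> C) : (forall t, 0 <= t <= 1 -> h t = k t) -> CInt h = CInt k.
Proof.
  intros H; unfold CInt; f_equal; apply RInt_ext; intros t Ht; rewrite H; auto;
    rewrite Rmin_left, Rmax_right in Ht; lra.
Qed.

Lemma CInt_plus (h k : R -> C) : pcont01 h -> pcont01 k ->
  CInt (fun t => h t + k t)%C = (CInt h + CInt k)%C.
Proof.
  intros H K; unfold CInt; apply injective_projections; simpl.
  - apply (RInt_plus (fun t => Re (h t)) (fun t => Re (k t))); apply pcont01_ex_Re; auto.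
  - apply (RInt_plus (fun t => Im (h t)) (fun t => Im (k t))); apply pcont01_ex_Im; auto.
Qed.

Lemma CInt_scal (c : C) (h : R -> C) : pcont01 h -> CInt (fun t => c * h t)%C = (c * CInt h)%C.
Proof.
  intros H. assert (H1 := pcont01_ex_Re h H). assert (H2 := pcont01_ex_Im h H).
  assert (S : forall (l : R) (f : R -> R), ex_RInt f 0 1 -> RInt (fun t => l * f t) 0 1 = l * RInt f 0 1)
    by (intros l f Hf; apply (RInt_scal f 0 1 l Hf)).
  assert (E : forall (l : R) (f : R -> R), ex_RInt f 0 1 -> ex_RInt (fun t => l * f t) 0 1)
    by (intros l f Hf; apply (ex_RInt_scal f 0 1 l Hf)).
  unfold CInt; apply injective_projections; simpl; rewrite <- !S by auto.
  - apply (RInt_minus (fun t => fst c * Re (h t)) (fun t => snd c * Im (h t))); auto.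
  - apply (RInt_plus (fun t => fst c * Im (h t)) (fun t => snd c * Re (h t))); auto.
Qed.

Lemma CInt_minus (h k : R -> C) : pcont01 h -> pcont01 k ->
  CInt (fun t => h t - k t)%C = (CInt h - CInt k)%C.
Proof.
  intros H K. rewrite (CInt_ext _ (fun t => h t + (- (1)) * k t)%C) by (intros; ring).
  rewrite CInt_plus, CInt_scal; auto; [ring |].
  intros t Ht; apply pcont_mult; auto using pcont_const.
Qed.

Lemma CInt_const (c : C) : CInt (fun _ => c) = c.
Proof.
  unfold CInt. rewrite !RInt_const. unfold scal; simpl; unfold mult; simpl.
  rewrite !Rminus_0_r, !Rmult_1_l. destruct c; auto.
Qed.

(** The factor 2 comes from treating the real and imaginary parts separately; later constants are
    not sharp either. *)
Lemma CInt_bound_fun (h : R -> C) (b : R -> R) : pcont01 h -> ex_RInt b 0 1 ->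
  (forall t, 0 <= t <= 1 -> Cmod (h t) <= b t) -> Cmod (CInt h) <= 2 * RInt b 0 1.
Proof.
  intros H Hb Hle. eapply Rle_trans; [apply Cmod_le_Rabs |]. simpl.
  assert (K : forall f : R -> R, ex_RInt f 0 1 -> (forall t, 0 <= t <= 1 -> Rabs (f t) <= b t) ->
    Rabs (RInt f 0 1) <= RInt b 0 1).
  { intros f Hf Hfb. apply Rabs_le; split.
    - replace (- RInt b 0 1) with (RInt (fun t => opp (b t)) 0 1)
        by (rewrite (RInt_opp (V := R_CompleteNormedModule)); auto).
      apply RInt_le; [lra | apply (ex_RInt_opp (V := R_NormedModule)); auto | auto |].
      intros t Ht. assert (Q := Hfb t ltac:(lra)). apply Rabs_le_between in Q.
      unfold opp; simpl; lra.
    - apply RInt_le; [lra | auto | auto |].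
      intros t Ht. assert (Q := Hfb t ltac:(lra)). apply Rabs_le_between in Q. lra. }
  assert (K1 : Rabs (RInt (fun t => Re (h t)) 0 1) <= RInt b 0 1).
  { apply K; [apply pcont01_ex_Re; auto |]. intros t Ht. eapply Rle_trans; [apply re_le_Cmod | auto]. }
  assert (K2 : Rabs (RInt (fun t => Im (h t)) 0 1) <= RInt b 0 1).
  { apply K; [apply pcont01_ex_Im; auto |]. intros t Ht. eapply Rle_trans; [apply Rabs_Im_le_Cmod | auto]. }
  lra.
Qed.

Lemma CInt_bound (h : R -> C) (m : R) : pcont01 h ->
  (forall t, 0 <= t <= 1 -> Cmod (h t) <= m) -> Cmod (CInt h) <= 2 * m.
Proof.
  intros H Hm. eapply Rle_trans; [apply (CInt_bound_fun h (fun _ => m)); auto |].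
  - apply (ex_RInt_const (V := R_NormedModule)).
  - rewrite RInt_const. unfold scal; simpl; unfold mult; simpl. lra.
Qed.

Definition rdiff (h : R -> C) (t : R) (v : C) : Prop :=
  forall eps, 0 < eps -> exists d, 0 < d /\ forall s, Rabs (s - t) < d ->
    Cmod (h s - h t - RtoC (s - t) * v) <= eps * Rabs (s - t).

Lemma rdiff_is_derive (h : R -> C) (t : R) (v : C) : rdiff h t v <->
  is_derive (fun s => Re (h s)) t (Re v) /\ is_derive (fun s => Im (h s)) t (Im v).
Proof.
  split.
  - intros H.
    assert (K : forall (f : R -> R) l,
      (forall s, Rabs (f s - f t - (s - t) * l) <= Cmod (h s - h t - RtoC (s - t) * v)) ->
      is_derive f t l).
    { intros f l Hf. apply is_derive_Reals. intros eps Heps.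
      destruct (H (eps / 2)) as (d & Hd & Hs); [lra |]. exists (mkposreal d Hd).
      intros k Hk Hkd. simpl in Hkd. assert (Q := Hf (t + k)).
      assert (Q' := Hs (t + k)). replace (t + k - t) with k in * by ring.
      specialize (Q' Hkd). assert (Hp : 0 < Rabs k) by (apply Rabs_pos_lt; auto).
      replace ((f (t + k) - f t) / k - l) with ((f (t + k) - f t - k * l) / k) by (field; auto).
      unfold Rdiv. rewrite Rabs_mult, Rabs_inv. apply Rlt_div_l; auto.
      apply Rle_lt_trans with (eps / 2 * Rabs k); [lra |]. nra. }
    split; apply K; intros s.
    + eapply Rle_trans; [| apply (re_le_Cmod (h s - h t - RtoC (s - t) * v))].
      right; f_equal; unfold Re; simpl; ring.
    + eapply Rle_trans; [| apply (Rabs_Im_le_Cmod (h s - h t - RtoC (s - t) * v))].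
      right; f_equal; unfold Im; simpl; ring.
  - intros [H1 H2].
    assert (K : forall (f : R -> R) l, is_derive f t l -> forall eps, 0 < eps ->
      exists d, 0 < d /\ forall s, Rabs (s - t) < d -> Rabs (f s - f t - (s - t) * l) <= eps * Rabs (s - t)).
    { intros f l Hf eps Heps. apply is_derive_Reals in Hf.
      destruct (Hf eps Heps) as [d Hd]. exists d; split; [apply cond_pos |]. intros s Hs.
      destruct (Req_dec s t) as [-> | Hn].
      - replace (f t - f t - (t - t) * l) with 0 by ring.
        rewrite Rabs_R0. replace (t - t) with 0 by ring. rewrite Rabs_R0; lra.
      - assert (Q := Hd (s - t) ltac:(lra) Hs). replace (t + (s - t)) with s in Q by ring.
        replace (f s - f t - (s - t) * l) with (((f s - f t) / (s - t) - l) * (s - t)) by (field; lra).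
        rewrite Rabs_mult. apply Rmult_le_compat_r; [apply Rabs_pos | lra]. }
    intros eps Heps.
    destruct (K _ _ H1 (eps / 2)) as (d & Hd & K1); [lra |].
    destruct (K _ _ H2 (eps / 2)) as (d' & Hd' & K2); [lra |].
    exists (Rmin d d'); split; [apply Rmin_pos; auto |]. intros s Hs.
    assert (Q1 := K1 s (Rlt_le_trans _ _ _ Hs (Rmin_l _ _))).
    assert (Q2 := K2 s (Rlt_le_trans _ _ _ Hs (Rmin_r _ _))).
    eapply Rle_trans; [apply Cmod_le_Rabs |].
    replace (Re (h s - h t - RtoC (s - t) * v)) with (Re (h s) - Re (h t) - (s - t) * Re v)
      by (unfold Re; simpl; ring).
    replace (Im (h s - h t - RtoC (s - t) * v)) with (Im (h s) - Im (h t) - (s - t) * Im v)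
      by (unfold Im; simpl; ring).
    lra.
Qed.

Lemma rdiff_segment (a b : C) (t : R) : rdiff (fun s => a + RtoC s * (b - a))%C t (b - a)%C.
Proof.
  intros eps Heps. exists 1; split; [lra |]. intros s _.
  replace (a + RtoC s * (b - a) - (a + RtoC t * (b - a)) - RtoC (s - t) * (b - a))%C with (RtoC 0)
    by (rewrite RtoC_minus; ring).
  rewrite Cmod_0. apply Rmult_le_pos; [lra | apply Rabs_pos].
Qed.

Lemma rdiff_pcont (h : R -> C) (t : R) (v : C) : rdiff h t v -> pcont h t.
Proof.
  intros H. apply rdiff_is_derive in H. destruct H as [H1 H2].
  split; apply (ex_derive_continuous (V := R_NormedModule)); eexists; eauto.
Qed.

Lemma rdiff_comp (G : C -> C) (h : R -> C) (t : R) (l v : C) :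
  cdiff G (h t) l -> rdiff h t v -> rdiff (fun s => G (h s)) t (l * v)%C.
Proof.
  intros HG Hh eps Heps.
  assert (Hv := Cmod_ge_0 v). assert (Hl := Cmod_ge_0 l).
  set (e := eps / (2 * (Cmod v + 1))).
  assert (He : 0 < e) by (apply Rdiv_lt_0_compat; lra).
  assert (Ee : e * (Cmod v + 1) = eps / 2) by (unfold e; field; lra).
  destruct (HG e He) as (d1 & Hd1 & K1).
  set (e' := Rmin 1 (eps / (2 * (Cmod l + 1)))).
  assert (He' : 0 < e') by (apply Rmin_pos; [lra | apply Rdiv_lt_0_compat; lra]).
  assert (Ee' : e' * (Cmod l + 1) <= eps / 2).
  { replace (eps / 2) with (eps / (2 * (Cmod l + 1)) * (Cmod l + 1)) by (field; lra).
    apply Rmult_le_compat_r; [lra | apply Rmin_r]. }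
  destruct (Hh e' He') as (d2 & Hd2 & K2).
  assert (Hpc := rdiff_pcont h t v Hh). rewrite pcont_eps in Hpc.
  destruct (Hpc d1 Hd1) as (d3 & Hd3 & K3).
  exists (Rmin d2 d3); split; [apply Rmin_pos; auto |]. intros s Hs.
  assert (Q2 := K2 s (Rlt_le_trans _ _ _ Hs (Rmin_l _ _))).
  assert (Q1 := K1 _ (K3 s (Rlt_le_trans _ _ _ Hs (Rmin_r _ _)))).
  set (D := Rabs (s - t)) in *. assert (HD : 0 <= D) by apply Rabs_pos.
  assert (Hhs : Cmod (h s - h t) <= (Cmod v + 1) * D).
  { replace (h s - h t)%C with ((h s - h t - RtoC (s - t) * v) + RtoC (s - t) * v)%C by ring.
    eapply Rle_trans; [apply Cmod_triangle |]. rewrite Cmod_mult, Cmod_R. fold D.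
    assert (e' <= 1) by apply Rmin_l. nra. }
  replace (G (h s) - G (h t) - RtoC (s - t) * (l * v))%C with
    ((G (h s) - G (h t) - l * (h s - h t)) + l * (h s - h t - RtoC (s - t) * v))%C by ring.
  eapply Rle_trans; [apply Cmod_triangle |]. rewrite Cmod_mult. nra.
Qed.

Lemma CInt_FTC (h dh : R -> C) : (forall t, 0 <= t <= 1 -> rdiff h t (dh t)) -> pcont01 dh ->
  CInt dh = (h 1 - h 0)%C.
Proof.
  intros H Hc. unfold CInt; apply injective_projections; simpl.
  - apply is_RInt_unique.
    apply (is_RInt_derive (V := R_CompleteNormedModule) (fun t => Re (h t)) (fun t => Re (dh t))); intros t Ht;
      rewrite Rmin_left, Rmax_right in Ht by lra.
    + apply rdiff_is_derive; auto.
    + exact (proj1 (Hc t Ht)).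
  - apply is_RInt_unique.
    apply (is_RInt_derive (V := R_CompleteNormedModule) (fun t => Im (h t)) (fun t => Im (dh t))); intros t Ht;
      rewrite Rmin_left, Rmax_right in Ht by lra.
    + apply rdiff_is_derive; auto.
    + exact (proj2 (Hc t Ht)).
Qed.

Lemma CInt_split (h : R -> C) (s : R) : 0 <= s <= 1 -> pcont01 h ->
  CInt h = (RtoC s * CInt (fun t => h (s * t)%R) + RtoC (1 - s) * CInt (fun t => h (s + (1 - s) * t)%R))%C.
Proof.
  intros Hs H.
  assert (K : forall f : R -> R, (forall t, 0 <= t <= 1 -> continuous f t) ->
    RInt f 0 1 = s * RInt (fun t => f (s * t)) 0 1 + (1 - s) * RInt (fun t => f (s + (1 - s) * t)) 0 1).
  { intros f Hf.
    assert (A : forall u v : R, 0 <= v -> 0 <= u -> u + v <= 1 ->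
      u * RInt (fun t => f (v + u * t)) 0 1 = RInt f v (u + v)).
    { intros u v Hv Hu Huv.
      assert (Hex : ex_RInt f (u * 0 + v) (u * 1 + v)) by (apply ex_RInt_01; auto; lra).
      assert (E := RInt_comp_lin f u v 0 1 Hex).
      replace (u * 0 + v) with v in E by ring. replace (u * 1 + v) with (u + v) in E by ring.
      rewrite <- E. rewrite (RInt_scal (V := R_CompleteNormedModule)).
      - unfold scal; simpl; unfold mult; simpl. f_equal. apply RInt_ext; intros; f_equal; ring.
      - destruct (Req_dec u 0) as [-> | Hu0].
        + apply ex_RInt_ext with (fun _ => f v); [intros; f_equal; ring |].
          apply (ex_RInt_const (V := R_NormedModule)).
        + apply ex_RInt_01; try lra. intros t Ht.
          apply (continuous_comp (fun y => u * y + v) f).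
          * apply (ex_derive_continuous (V := R_NormedModule)). auto_derive; auto.
          * apply Hf; nra. }
    assert (A1 := A s 0 ltac:(lra) ltac:(lra) ltac:(lra)).
    assert (A2 := A (1 - s) s ltac:(lra) ltac:(lra) ltac:(lra)).
    rewrite Rplus_0_r in A1. replace (1 - s + s) with 1 in A2 by ring.
    rewrite A2. rewrite (RInt_ext (fun t => f (s * t)) (fun t => f (0 + s * t)))
      by (intros; f_equal; ring).
    rewrite A1. symmetry. apply (RInt_Chasles f); apply ex_RInt_01; auto; lra. }
  unfold CInt; apply injective_projections; simpl.
  - etransitivity; [apply (K (fun t => Re (h t)) (fun t Ht => proj1 (H t Ht))) |].
    unfold Re; simpl; ring.
  - etransitivity; [apply (K (fun t => Im (h t)) (fun t Ht => proj2 (H t Ht))) |].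
    unfold Im; simpl; ring.
Qed.

Lemma CInt_reverse (h : R -> C) : pcont01 h -> CInt (fun t => h (1 - t)%R) = CInt h.
Proof.
  intros H.
  assert (K : forall f : R -> R, (forall t, 0 <= t <= 1 -> continuous f t) ->
    RInt (fun t => f (1 - t)) 0 1 = RInt f 0 1).
  { intros f Hf.
    assert (Hex : ex_RInt f (-1 * 0 + 1) (-1 * 1 + 1)) by (apply ex_RInt_01; auto; lra).
    assert (E := RInt_comp_lin f (-1) 1 0 1 Hex).
    replace (-1 * 0 + 1) with 1 in E by ring. replace (-1 * 1 + 1) with 0 in E by ring.
    rewrite <- (opp_RInt_swap (V := R_CompleteNormedModule) f 0 1) in E by (apply ex_RInt_01; auto; lra).
    rewrite (RInt_scal (V := R_CompleteNormedModule)) in E.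
    - unfold scal, opp in E; simpl in E; unfold mult in E; simpl in E.
      rewrite (RInt_ext (fun t => f (1 - t)) (fun y => f (-1 * y + 1))) by (intros; f_equal; ring).
      lra.
    - apply ex_RInt_01; try lra. intros t Ht.
      apply (continuous_comp (fun y => -1 * y + 1) f).
      + apply (ex_derive_continuous (V := R_NormedModule)). auto_derive; auto.
      + apply Hf; lra. }
  unfold CInt; apply injective_projections; simpl.
  - exact (K (fun t => Re (h t)) (fun t Ht => proj1 (H t Ht))).
  - exact (K (fun t => Im (h t)) (fun t Ht => proj2 (H t Ht))).
Qed.

(** * Segment integrals and Goursat's theorem *)

Definition segment_int (f : C -> C) (a b : C) : C := ((b - a) * CInt (fun t => f (a + RtoC t * (b - a))))%C.

Definition cont_at (f : C -> C) (z : C) : Prop :=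
  forall eps, 0 < eps -> exists d, 0 < d /\ forall w, Cmod (w - z) < d -> Cmod (f w - f z) < eps.

(** Continuity is asked in the full plane at each point of the segment. The pulled back functions
    are then continuous on both sides of the endpoints, and functions are taken on open
    neighbourhoods from here on. *)
Definition cont_segment (f : C -> C) (a b : C) : Prop :=
  forall t, 0 <= t <= 1 -> cont_at f (a + RtoC t * (b - a))%C.

Lemma cont_segment_pcont01 (f : C -> C) (a b : C) : cont_segment f a b ->
  pcont01 (fun t => f (a + RtoC t * (b - a))%C).
Proof.
  intros H t Ht. apply (pcont_comp f); [eapply rdiff_pcont, rdiff_segment | apply H; auto].
Qed.

Lemma SI_split (f : C -> C) (a b m : C) (s : R) : 0 <= s <= 1 -> cont_segment f a b ->
  m = (a + RtoC s * (b - a))%C -> segment_int f a b = (segment_int f a m + segment_int f m b)%C.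
Proof.
  intros Hs H ->. unfold segment_int.
  rewrite (CInt_split _ s Hs (cont_segment_pcont01 f a b H)).
  rewrite (CInt_ext (fun t => f (a + RtoC (s * t) * (b - a))%C)
    (fun t => f (a + RtoC t * (a + RtoC s * (b - a) - a)))%C)
    by (intros; f_equal; rewrite RtoC_mult; ring).
  rewrite (CInt_ext (fun t => f (a + RtoC (s + (1 - s) * t) * (b - a))%C)
    (fun t => f (a + RtoC s * (b - a) + RtoC t * (b - (a + RtoC s * (b - a)))))%C)
    by (intros; f_equal; rewrite RtoC_plus, RtoC_mult, RtoC_minus; ring).
  rewrite RtoC_minus. ring.
Qed.

Lemma SI_reverse (f : C -> C) (a b : C) : cont_segment f a b -> segment_int f b a = (- segment_int f a b)%C.
Proof.
  intros H. unfold segment_int. rewrite <- (CInt_reverse _ (cont_segment_pcont01 f a b H)).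
  rewrite (CInt_ext (fun t => f (a + RtoC (1 - t) * (b - a))%C) (fun t => f (b + RtoC t * (a - b)))%C)
    by (intros; f_equal; rewrite RtoC_minus; ring).
  ring.
Qed.

Lemma SI_bound (f : C -> C) (a b : C) (m : R) : cont_segment f a b ->
  (forall t, 0 <= t <= 1 -> Cmod (f (a + RtoC t * (b - a))%C) <= m) ->
  Cmod (segment_int f a b) <= 2 * m * Cmod (b - a).
Proof.
  intros H Hm. unfold segment_int. rewrite Cmod_mult, Rmult_comm.
  apply Rmult_le_compat_r; [apply Cmod_ge_0 |].
  apply CInt_bound; auto. apply cont_segment_pcont01; auto.
Qed.

Lemma SI_FTC (G g : C -> C) (a b : C) : cont_segment g a b ->
  (forall t, 0 <= t <= 1 -> cdiff G (a + RtoC t * (b - a))%C (g (a + RtoC t * (b - a))%C)) ->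
  segment_int g a b = (G b - G a)%C.
Proof.
  intros Hc HG. unfold segment_int. rewrite <- CInt_scal by (apply cont_segment_pcont01; auto).
  rewrite (CInt_ext _ (fun t => g (a + RtoC t * (b - a)) * (b - a))%C) by (intros; ring).
  rewrite (CInt_FTC (fun t => G (a + RtoC t * (b - a))%C)).
  - do 2 f_equal; f_equal; ring.
  - intros t Ht. apply (rdiff_comp G); auto. apply rdiff_segment.
  - intros t Ht. apply pcont_mult; [| apply pcont_const]. apply cont_segment_pcont01; auto.
Qed.

Lemma cdiff_cont_at (f : C -> C) (z l : C) : cdiff f z l -> cont_at f z.
Proof. exact (cdiff_continuous f z l). Qed.

Lemma cont_at_minus (f g : C -> C) (z : C) :
  cont_at f z -> cont_at g z -> cont_at (fun w => f w - g w)%C z.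
Proof.
  intros Hf Hg eps Heps.
  destruct (Hf (eps / 2)) as (d & Hd & H1); [lra |].
  destruct (Hg (eps / 2)) as (d' & Hd' & H2); [lra |].
  exists (Rmin d d'); split; [apply Rmin_pos; auto |]. intros w Hw.
  replace (f w - g w - (f z - g z))%C with ((f w - f z) - (g w - g z))%C by ring.
  eapply Rle_lt_trans; [apply Cmod_minus_le |].
  assert (H3 := H1 w (Rlt_le_trans _ _ _ Hw (Rmin_l _ _))).
  assert (H4 := H2 w (Rlt_le_trans _ _ _ Hw (Rmin_r _ _))). lra.
Qed.

Lemma SI_minus (f g : C -> C) (a b : C) : cont_segment f a b -> cont_segment g a b ->
  segment_int (fun z => f z - g z)%C a b = (segment_int f a b - segment_int g a b)%C.
Proof.
  intros Hf Hg. unfold segment_int. rewrite CInt_minus by (apply cont_segment_pcont01; auto). ring.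
Qed.

Definition triangle_int (f : C -> C) (a b c : C) : C := (segment_int f a b + segment_int f b c + segment_int f c a)%C.

Definition in_simplex (u : C) : Prop := 0 <= Re u /\ 0 <= Im u /\ Re u + Im u <= 1.

Lemma in_simplex_convex (u v : C) (s : R) : 0 <= s <= 1 -> in_simplex u -> in_simplex v ->
  in_simplex (u + RtoC s * (v - u))%C.
Proof.
  intros Hs (U1 & U2 & U3) (V1 & V2 & V3). unfold in_simplex, Re, Im in *; simpl.
  split; [| split]; nra.
Qed.

Definition midpoint (u v : C) : C := (u + RtoC (/ 2) * (v - u))%C.

Lemma in_simplex_midpoint (u v : C) : in_simplex u -> in_simplex v -> in_simplex (midpoint u v).
Proof. apply in_simplex_convex; lra. Qed.

Definition perimeter (u v w : C) : R := Cmod (v - u) + Cmod (w - v) + Cmod (u - w).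

Lemma Cmod_half (z : C) : Cmod (RtoC (/ 2) * z) = / 2 * Cmod z.
Proof. rewrite Cmod_mult, Cmod_R, Rabs_pos_eq; lra. Qed.

(* Barycentric coordinates: the triangle [a b c] is the image of the standard simplex. *)
Definition bary (a b c u : C) : C := (a + RtoC (Re u) * (b - a) + RtoC (Im u) * (c - a))%C.

Lemma bary_affine (a b c u v : C) (s : R) :
  bary a b c (u + RtoC s * (v - u)) = (bary a b c u + RtoC s * (bary a b c v - bary a b c u))%C.
Proof.
  unfold bary. replace (Re (u + RtoC s * (v - u))) with (Re u + s * (Re v - Re u))
    by (unfold Re; simpl; ring).
  replace (Im (u + RtoC s * (v - u))) with (Im u + s * (Im v - Im u)) by (unfold Im; simpl; ring).
  rewrite !RtoC_plus, !RtoC_mult, !RtoC_minus. ring.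
Qed.

Lemma bary_dist (a b c u v : C) :
  Cmod (bary a b c u - bary a b c v) <= (Cmod (b - a) + Cmod (c - a)) * Cmod (u - v).
Proof.
  replace (bary a b c u - bary a b c v)%C with
    (RtoC (Re (u - v)) * (b - a) + RtoC (Im (u - v)) * (c - a))%C.
  - eapply Rle_trans; [apply Cmod_triangle |]. rewrite !Cmod_mult, !Cmod_R.
    assert (H1 := re_le_Cmod (u - v)). assert (H2 := Rabs_Im_le_Cmod (u - v)).
    assert (H3 := Cmod_ge_0 (b - a)). assert (H4 := Cmod_ge_0 (c - a)). nra.
  - unfold bary. replace (Re (u - v)) with (Re u - Re v) by (unfold Re; simpl; ring).
    replace (Im (u - v)) with (Im u - Im v) by (unfold Im; simpl; ring).
    rewrite !RtoC_minus; ring.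
Qed.

(** Goursat's bisection, performed in the parameter simplex so that degenerate triangles are
    covered. At each step the perimeter halves and the integral loses at most a factor 4, while the
    error of the affine approximation at the limit point contributes [eps] times the square of the
    perimeter. *)
Lemma goursat_triangle (f : C -> C) (a b c : C) :
  (forall u, in_simplex u -> exists l, cdiff f (bary a b c u) l) -> triangle_int f a b c = 0%C.
Proof.
  intros Hf.
  pose (L := bary a b c).
  assert (Hcs : forall u v, in_simplex u -> in_simplex v -> cont_segment f (L u) (L v)).
  { intros u v Hu Hv t Ht. unfold L. rewrite <- bary_affine.
    destruct (Hf (u + RtoC t * (v - u))%C) as [l Hl]; [apply in_simplex_convex; auto |].
    eapply cdiff_cont_at; eauto. }
  pose (J := fun T : C * C * C => let '(u, v, w) := T in triangle_int f (L u) (L v) (L w)).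
  pose (per := fun T : C * C * C => let '(u, v, w) := T in perimeter u v w).
  pose (inT := fun T : C * C * C => let '(u, v, w) := T in in_simplex u /\ in_simplex v /\ in_simplex w).
  (* [inT T] stands under the existential so that a successor function on all triples can be
     chosen. *)
  assert (Hstep : forall T, exists T', inT T -> inT T' /\ Cmod (J T) <= 4 * Cmod (J T') /\
    per T' = / 2 * per T /\ Cmod (fst (fst T') - fst (fst T)) <= per T).
  { intros [[u v] w]. destruct (classic (inT (u, v, w))) as [Hin | Hn];
      [| exists (u, v, w); intros; contradiction].
    destruct Hin as (Hu & Hv & Hw).
    pose (x := midpoint u v). pose (y := midpoint v w). pose (z := midpoint w u).
    assert (Hx : in_simplex x) by (apply in_simplex_midpoint; auto).
    assert (Hy : in_simplex y) by (apply in_simplex_midpoint; auto).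
    assert (Hz : in_simplex z) by (apply in_simplex_midpoint; auto).
    assert (Hhalf : 0 <= / 2 <= 1) by lra.
    assert (HJ : J (u, v, w) = (J (u, x, z) + J (x, v, y) + (J (z, y, w) + J (y, z, x)))%C).
    { unfold J, triangle_int.
      rewrite (SI_split f (L u) (L v) (L x) (/ 2) Hhalf (Hcs u v Hu Hv)) by (apply bary_affine).
      rewrite (SI_split f (L v) (L w) (L y) (/ 2) Hhalf (Hcs v w Hv Hw)) by (apply bary_affine).
      rewrite (SI_split f (L w) (L u) (L z) (/ 2) Hhalf (Hcs w u Hw Hu)) by (apply bary_affine).
      rewrite (SI_reverse f (L x) (L z) (Hcs x z Hx Hz)), (SI_reverse f (L x) (L y) (Hcs x y Hx Hy)),
        (SI_reverse f (L y) (L z) (Hcs y z Hy Hz)).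
      ring. }
    assert (E1 : Cmod (v - u) = 2 * Cmod (x - u) /\ Cmod (v - u) = 2 * Cmod (v - x) /\ Cmod (v - u) = 2 * Cmod (z - y)).
    { repeat split.
      - replace (x - u)%C with (RtoC (/ 2) * (v - u))%C by (unfold x, midpoint; ring).
        rewrite Cmod_half; lra.
      - replace (v - x)%C with (RtoC (/ 2) * (v - u))%C.
        + rewrite Cmod_half; lra.
        + unfold x, midpoint; apply injective_projections; simpl; field.
      - replace (z - y)%C with (- (RtoC (/ 2) * (v - u)))%C.
        + rewrite Cmod_opp, Cmod_half; lra.
        + unfold z, y, midpoint; apply injective_projections; simpl; field. }
    assert (E2 : Cmod (w - v) = 2 * Cmod (y - v) /\ Cmod (w - v) = 2 * Cmod (w - y) /\ Cmod (w - v) = 2 * Cmod (z - x)).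
    { repeat split.
      - replace (y - v)%C with (RtoC (/ 2) * (w - v))%C by (unfold y, midpoint; ring).
        rewrite Cmod_half; lra.
      - replace (w - y)%C with (RtoC (/ 2) * (w - v))%C.
        + rewrite Cmod_half; lra.
        + unfold y, midpoint; apply injective_projections; simpl; field.
      - replace (z - x)%C with (RtoC (/ 2) * (w - v))%C.
        + rewrite Cmod_half; lra.
        + unfold z, x, midpoint; apply injective_projections; simpl; field. }
    assert (E3 : Cmod (u - w) = 2 * Cmod (z - w) /\ Cmod (u - w) = 2 * Cmod (u - z) /\ Cmod (u - w) = 2 * Cmod (y - x)).
    { repeat split.
      - replace (z - w)%C with (RtoC (/ 2) * (u - w))%C by (unfold z, midpoint; ring).
        rewrite Cmod_half; lra.
      - replace (u - z)%C with (RtoC (/ 2) * (u - w))%C.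
        + rewrite Cmod_half; lra.
        + unfold z, midpoint; apply injective_projections; simpl; field.
      - replace (y - x)%C with (- (RtoC (/ 2) * (u - w)))%C.
        + rewrite Cmod_opp, Cmod_half; lra.
        + unfold x, y, midpoint; apply injective_projections; simpl; field. }
    destruct E1 as (E11 & E12 & E13). destruct E2 as (E21 & E22 & E23). destruct E3 as (E31 & E32 & E33).
    assert (P0 := Cmod_ge_0 (v - u)). assert (P1 := Cmod_ge_0 (w - v)). assert (P2 := Cmod_ge_0 (u - w)).
    assert (Hsum : Cmod (J (u, v, w)) <= Cmod (J (u, x, z)) + Cmod (J (x, v, y)) +
      (Cmod (J (z, y, w)) + Cmod (J (y, z, x)))).
    { rewrite HJ. eapply Rle_trans; [apply Cmod_triangle |].
      apply Rplus_le_compat; apply Cmod_triangle. }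
    destruct (Rle_dec (Cmod (J (u, v, w))) (4 * Cmod (J (u, x, z)))) as [D1 | D1].
    { exists (u, x, z). intros _. split; [unfold inT; auto |].
      split; [lra |]. unfold per, perimeter; simpl; split.
      - lra.
      - replace (u - u)%C with (RtoC 0) by ring. rewrite Cmod_0; lra. }
    destruct (Rle_dec (Cmod (J (u, v, w))) (4 * Cmod (J (x, v, y)))) as [D2 | D2].
    { exists (x, v, y). intros _. split; [unfold inT; auto |].
      split; [lra |]. unfold per, perimeter; simpl; split.
      - rewrite (Cmod_minus_sym x y). lra.
      - lra. }
    destruct (Rle_dec (Cmod (J (u, v, w))) (4 * Cmod (J (z, y, w)))) as [D3 | D3].
    { exists (z, y, w). intros _. split; [unfold inT; auto |].
      split; [lra |]. unfold per, perimeter; simpl; split.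
      - rewrite (Cmod_minus_sym y z). lra.
      - rewrite (Cmod_minus_sym z u). lra. }
    exists (y, z, x). intros _. split; [unfold inT; auto |].
      split; [lra |]. unfold per, perimeter; simpl; split.
    - rewrite (Cmod_minus_sym x z). lra.
    - assert (Cmod (y - u) <= Cmod (y - v) + Cmod (v - u)).
      { replace (y - u)%C with ((y - v) + (v - u))%C by ring. apply Cmod_triangle. }
      lra. }
  destruct (exists_choice_function _ _ _ Hstep) as [nxt Hnxt]. clear Hstep.
  pose (T0 := ((RtoC 0, RtoC 1, Ci) : C * C * C)).
  pose (T := fix T n := match n with O => T0 | S k => nxt (T k) end).
  assert (HT0 : inT T0) by (unfold inT, T0, in_simplex; simpl; lra).
  assert (HTin : forall n, inT (T n)) by (induction n as [| n IH]; simpl; [auto | apply Hnxt; auto]).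
  assert (HTper : forall n, per (T n) = per T0 * (/ 2) ^ n).
  { induction n as [| n IH]; [change (per T0 = per T0 * 1); ring |].
    change (per (nxt (T n)) = per T0 * (/ 2 * (/ 2) ^ n)).
    destruct (Hnxt (T n) (HTin n)) as (_ & _ & E & _). rewrite E, IH; ring. }
  assert (HTJ : forall n, Cmod (J T0) <= 4 ^ n * Cmod (J (T n))).
  { induction n as [| n IH]; [change (Cmod (J T0) <= 1 * Cmod (J T0)); lra |].
    change (Cmod (J T0) <= 4 * 4 ^ n * Cmod (J (nxt (T n)))).
    destruct (Hnxt (T n) (HTin n)) as (_ & E & _ & _).
    assert (0 <= 4 ^ n) by (apply pow_le; lra). nra. }
  set (p0 := per T0) in *.
  assert (Hp0 : 0 <= p0).
  { unfold p0, per, T0, perimeter. repeat apply Rplus_le_le_0_compat; apply Cmod_ge_0. }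
  destruct (geometric_limit (fun n => fst (fst (T n))) p0 (/ 2)) as [u0 Hu0].
  { lra. }
  { intros n. simpl. rewrite <- HTper. apply Hnxt; auto. }
  assert (Hsim : in_simplex u0).
  { assert (Hn : forall n, in_simplex (fst (fst (T n)))).
    { intros n. assert (K := HTin n). destruct (T n) as [[u v] w]. apply K. }
    assert (Hsmall : forall eps, 0 < eps -> exists n, Cmod (fst (fst (T n)) - u0) < eps).
    { intros eps Heps.
      destruct (pow_lt_1_zero (/ 2) ltac:(rewrite Rabs_pos_eq; lra) (eps / (4 * p0 + 1))) as [N HN].
      { apply Rdiv_lt_0_compat; lra. }
      exists N. eapply Rle_lt_trans; [apply Hu0 |].
      assert (K := HN N (le_n N)). rewrite Rabs_pos_eq in K by (apply pow_le; lra).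
      apply Rlt_div_r in K; [| lra]. assert (0 <= (/ 2) ^ N) by (apply pow_le; lra).
      replace (2 * (p0 / (1 - / 2))) with (4 * p0) by field. nra. }
    assert (Hre : forall u, Rabs (Re u - Re u0) <= Cmod (u - u0)).
    { intros u. eapply Rle_trans; [| apply (re_le_Cmod (u - u0))]. right; f_equal; unfold Re; simpl; ring. }
    assert (Him : forall u, Rabs (Im u - Im u0) <= Cmod (u - u0)).
    { intros u. eapply Rle_trans; [| apply (Rabs_Im_le_Cmod (u - u0))]. right; f_equal; unfold Im; simpl; ring. }
    repeat split; apply le_epsilon; intros eps Heps; destruct (Hsmall (eps / 2)) as [n K]; try lra;
      assert (K1 := Hre (fst (fst (T n)))); assert (K2 := Him (fst (fst (T n))));
      destruct (Hn n) as (N1 & N2 & N3);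
      apply Rabs_le_between in K1; apply Rabs_le_between in K2; lra. }
  destruct (Hf u0 Hsim) as [l Hl].
  set (z0 := bary a b c u0) in *.
  set (kap := Cmod (b - a) + Cmod (c - a)).
  assert (Hkap : 0 <= kap) by (unfold kap; generalize (Cmod_ge_0 (b - a)) (Cmod_ge_0 (c - a)); lra).
  assert (Hmain : forall eps, 0 < eps -> Cmod (J T0) <= eps * (10 * kap * kap * p0 * p0)).
  { intros eps Heps. destruct (Hl eps Heps) as (d & Hd & Hdl).
    destruct (pow_lt_1_zero (/ 2) ltac:(rewrite Rabs_pos_eq; lra) (d / (5 * kap * p0 + 1))) as [N HN].
    { apply Rdiv_lt_0_compat; auto. assert (0 <= kap * p0) by (apply Rmult_le_pos; auto). lra. }
    assert (K := HN N (le_n N)). clear HN.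
    assert (Hpw : 0 < (/ 2) ^ N) by (apply pow_lt; lra).
    rewrite Rabs_pos_eq in K by lra.
    assert (Hkp : 0 <= kap * p0) by (apply Rmult_le_pos; auto).
    apply Rlt_div_r in K; [| lra].
    set (q := (/ 2) ^ N) in *.
    assert (Hin := HTin N). assert (Hper := HTper N). assert (HJN := HTJ N).
    assert (HuN := Hu0 N). fold q in HuN, Hper.
    replace (2 * (p0 / (1 - / 2)) * q) with (4 * p0 * q) in HuN by field.
    (* The balance of the bisection: the factors 4 lost by the integral against the squared scale of
       the triangle. *)
    assert (Hpos4 : 4 ^ N * (q * q) = 1).
    { unfold q. rewrite <- !Rpow_mult_distr. replace (4 * (/ 2 * / 2)) with 1 by field. apply pow1. }
    destruct (T N) as [[u v] w]. simpl in HuN. destruct Hin as (Hu & Hv & Hw).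
    unfold per, perimeter in Hper.
    assert (C1 := Cmod_ge_0 (v - u)). assert (C2 := Cmod_ge_0 (w - v)). assert (C3 := Cmod_ge_0 (u - w)).
    set (aff := fun z : C => (f z0 + l * (z - z0))%C).
    assert (Haffd : forall z, cdiff aff z l).
    { intros z e He. exists 1; split; [lra |]. intros s _.
      replace (aff s - aff z - l * (s - z))%C with (RtoC 0) by (unfold aff; ring).
      rewrite Cmod_0. apply Rmult_le_pos; [lra | apply Cmod_ge_0]. }
    assert (Haffc : forall x y, cont_segment aff x y)
      by (intros x y t _; eapply cdiff_cont_at; apply Haffd).
    (* The affine approximation of [f] has the primitive [G], so its integral around the triangle
       vanishes and may be subtracted. *)
    pose (G := fun z : C => (f z0 * z + l * (z - z0) * (z - z0) * RtoC (/ 2))%C).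
    assert (HG : forall x y, segment_int aff x y = (G y - G x)%C).
    { intros x y. apply SI_FTC; auto. intros t _.
      apply cdiff_of_quadratic with 1 (Cmod l); [lra |]. intros s _. unfold G, aff.
      set (r := (x + RtoC t * (y - x))%C).
      replace (f z0 * s + l * (s - z0) * (s - z0) * RtoC (/ 2) -
        (f z0 * r + l * (r - z0) * (r - z0) * RtoC (/ 2)) - (f z0 + l * (r - z0)) * (s - r))%C
        with (RtoC (/ 2) * (l * ((s - r) * (s - r))))%C.
      - rewrite Cmod_half, !Cmod_mult.
        assert (0 <= Cmod l * (Cmod (s - r) * Cmod (s - r)))
          by (repeat apply Rmult_le_pos; apply Cmod_ge_0). lra.
      - apply injective_projections; simpl; field. }
    (* In the simplex each edge lies within [p0 q] of the vertex [u], and [u] within [4 p0 q] of the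
       limit [u0]; hence [5 p0 q]. *)
    assert (Hedge : forall x y, in_simplex x -> in_simplex y -> Cmod (x - u) <= p0 * q ->
      Cmod (y - u) <= p0 * q ->
      Cmod (segment_int (fun z => f z - aff z)%C (L x) (L y)) <= 2 * (eps * (kap * (5 * p0 * q))) * (kap * Cmod (y - x))).
    { intros x y Hx Hy Hxu Hyu.
      assert (Hm : 0 <= eps * (kap * (5 * p0 * q))).
      { apply Rmult_le_pos; [lra |]. replace (kap * (5 * p0 * q)) with (5 * (kap * p0) * q) by ring.
        apply Rmult_le_pos; lra. }
      apply Rle_trans with (2 * (eps * (kap * (5 * p0 * q))) * Cmod (L y - L x)).
      - apply SI_bound.
        + intros t Ht. apply cont_at_minus; [apply (Hcs x y); auto | apply (Haffc (L x) (L y)); auto].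
        + intros t Ht. unfold L at 1 2 3 4 5 6. rewrite <- bary_affine.
          set (r := (x + RtoC t * (y - x))%C).
          assert (Hr : Cmod (bary a b c r - z0) <= kap * (5 * p0 * q)).
          { unfold z0. eapply Rle_trans; [apply bary_dist |]. apply Rmult_le_compat_l; auto.
            replace (r - u0)%C with (RtoC (1 - t) * (x - u) + RtoC t * (y - u) + (u - u0))%C
              by (unfold r; rewrite RtoC_minus; ring).
            eapply Rle_trans; [apply Cmod_triangle |].
            assert (Hc : Cmod (RtoC (1 - t) * (x - u) + RtoC t * (y - u)) <= p0 * q).
            { eapply Rle_trans; [apply Cmod_triangle |].
              rewrite !Cmod_mult, !Cmod_R, !Rabs_pos_eq by lra. nra. }
            lra. }
          replace (f (bary a b c r) - aff (bary a b c r))%C with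
            (f (bary a b c r) - f z0 - l * (bary a b c r - z0))%C by (unfold aff; ring).
          eapply Rle_trans; [apply Hdl |].
          * eapply Rle_lt_trans; [exact Hr |]. replace (kap * (5 * p0 * q)) with (q * (5 * kap * p0)) by ring. nra.
          * apply Rmult_le_compat_l; lra.
      - apply Rmult_le_compat_l; [lra |]. apply bary_dist. }
    assert (Huu : Cmod (u - u) <= p0 * q).
    { replace (u - u)%C with (RtoC 0) by ring. rewrite Cmod_0. apply Rmult_le_pos; lra. }
    assert (Hvu : Cmod (v - u) <= p0 * q) by lra.
    assert (Hwu : Cmod (w - u) <= p0 * q) by (rewrite Cmod_minus_sym; lra).
    assert (HJb : Cmod (J (u, v, w)) <= 2 * (eps * (kap * (5 * p0 * q))) * (kap * (p0 * q))).
    { assert (EJ : J (u, v, w) = (segment_int (fun z => f z - aff z) (L u) (L v) +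
        segment_int (fun z => f z - aff z) (L v) (L w) + segment_int (fun z => f z - aff z) (L w) (L u))%C).
      { rewrite !SI_minus by auto. rewrite !HG. unfold J, triangle_int. ring. }
      rewrite EJ. rewrite <- Hper.
      eapply Rle_trans; [apply Cmod_triangle |].
      eapply Rle_trans; [apply Rplus_le_compat_r, Cmod_triangle |].
      rewrite !Rmult_plus_distr_l.
      repeat apply Rplus_le_compat; apply Hedge; auto. }
    eapply Rle_trans; [exact HJN |].
    assert (0 <= 4 ^ N) by (apply pow_le; lra).
    apply Rle_trans with (4 ^ N * (2 * (eps * (kap * (5 * p0 * q))) * (kap * (p0 * q)))).
    - apply Rmult_le_compat_l; auto.
    - right. replace (4 ^ N * _) with ((4 ^ N * (q * q)) * (eps * (10 * kap * kap * p0 * p0))) by ring.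
      rewrite Hpos4; ring. }
  assert (HJ0 : J T0 = triangle_int f a b c).
  { unfold J, T0, L, bary; simpl.
    replace (a + RtoC 0 * (b - a) + RtoC 0 * (c - a))%C with a by ring.
    replace (a + RtoC 1 * (b - a) + RtoC 0 * (c - a))%C with b by ring.
    replace (a + RtoC 0 * (b - a) + RtoC 1 * (c - a))%C with c by ring. auto. }
  rewrite <- HJ0. apply Cmod_eq_0. apply Rle_antisym; [| apply Cmod_ge_0].
  set (S := 10 * kap * kap * p0 * p0) in *.
  assert (HS : 0 <= S).
  { unfold S. replace (10 * kap * kap * p0 * p0) with (10 * ((kap * p0) * (kap * p0))) by ring.
    assert (0 <= kap * p0) by (apply Rmult_le_pos; auto). nra. }
  apply le_epsilon; intros eps Heps. rewrite Rplus_0_l.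
  eapply Rle_trans; [apply (Hmain (eps / (S + 1))); apply Rdiv_lt_0_compat; lra |].
  unfold Rdiv. rewrite Rmult_assoc. rewrite <- (Rmult_1_r eps) at 2. apply Rmult_le_compat_l; [lra |].
  rewrite Rmult_comm. apply Rle_div_l; lra.
Qed.

Definition open_set_C (W : C -> Prop) : Prop :=
  forall z, W z -> exists d, 0 < d /\ forall w, Cmod (w - z) < d -> W w.

Definition convex_set (W : C -> Prop) : Prop :=
  forall z w s, W z -> W w -> 0 <= s <= 1 -> W (z + RtoC s * (w - z))%C.

Lemma convex_bary (W : C -> Prop) (a b c u : C) : convex_set W -> W a -> W b -> W c ->
  in_simplex u -> W (bary a b c u).
Proof.
  intros HW Ha Hb Hc (H1 & H2 & H3).
  destruct (Req_dec (Re u + Im u) 0) as [E | E].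
  - assert (E1 : Re u = 0) by lra. assert (E2 : Im u = 0) by lra.
    unfold bary. rewrite E1, E2. replace (_ + _ + _)%C with a by ring. auto.
  - assert (Hs : 0 < Re u + Im u) by lra. set (s := Re u + Im u) in *.
    assert (Es : s = Re u + Im u) by reflexivity.
    replace (bary a b c u) with (a + RtoC s * ((b + RtoC (Im u / s) * (c - b)) - a))%C.
    + apply HW; auto; [apply HW; auto | lra].
      split; [apply Rdiv_le_0_compat; lra | apply Rle_div_l; lra].
    + unfold bary. replace (Re u) with (s - Im u) by (unfold s; ring).
      rewrite RtoC_minus. unfold Rdiv. rewrite RtoC_mult, RtoC_inv by lra.
      field. intros K; apply (f_equal fst) in K; simpl in K; lra.
Qed.

Lemma convex_cont_segment (W : C -> Prop) (g : C -> C) (a b : C) : convex_set W ->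
  (forall z, W z -> cont_at g z) -> W a -> W b -> cont_segment g a b.
Proof. intros HW Hg Ha Hb t Ht; apply Hg, HW; auto. Qed.

(* Only continuity is required of [g] at the star centre [z0]; this is what makes the
   difference quotient [(v z - v z0) / (z - z0)] admissible. *)
Lemma primitive_star (W : C -> Prop) (g : C -> C) (z0 : C) :
  open_set_C W -> convex_set W -> W z0 -> (forall z, W z -> cont_at g z) ->
  (forall z, W z -> z <> z0 -> exists l, cdiff g z l) ->
  forall z, W z -> z <> z0 -> cdiff (segment_int g z0) z (g z).
Proof.
  intros Wo Wc Wz0 Hg Hd z Wz Hz.
  assert (Hcs : forall a b, W a -> W b -> cont_segment g a b)
    by (intros; apply convex_cont_segment with W; auto).
  assert (Hzn : (z - z0)%C <> RtoC 0).
  { intros K; apply Hz. replace z with ((z - z0) + z0)%C by ring. rewrite K; ring. }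
  assert (Hzp := proj1 (Cmod_gt_0 _) Hzn).
  (* The triangle is cut near its vertex [z0] at ratio [s]. Goursat disposes of the two far pieces,
     which the bound on [h] keeps away from [z0]; the integral around the small piece is at most a
     multiple of [s]. *)
  assert (Htri : forall h, Cmod h < Cmod (z - z0) -> W (z + h)%C -> triangle_int g z0 z (z + h) = 0%C).
  { intros h Hh Wzh.
    destruct (Hg z0 Wz0 1 Rlt_0_1) as (d0 & Hd0 & Hb0).
    set (c := (z + h)%C) in *.
    set (len := Cmod (z - z0) + Cmod (c - z) + Cmod (c - z0)).
    assert (Hlen : 0 < len) by (unfold len; generalize (Cmod_ge_0 (c - z)) (Cmod_ge_0 (c - z0)); lra).
    set (m := Cmod (g z0) + 1).
    assert (Hm : 0 < m) by (unfold m; generalize (Cmod_ge_0 (g z0)); lra).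
    assert (Hsm : forall s, 0 < s < 1 -> s * len < d0 -> Cmod (triangle_int g z0 z c) <= 2 * m * (s * len)).
    { intros s Hs Hsl.
      set (b' := (z0 + RtoC s * (z - z0))%C). set (c' := (z0 + RtoC s * (c - z0))%C).
      assert (Wb' : W b') by (apply Wc; auto; lra).
      assert (Wc' : W c') by (apply Wc; auto; lra).
      assert (Hne : forall x y : R, Rabs y <= x -> 0 < x -> (z0 + (RtoC x * (z - z0) + RtoC y * h))%C <> z0).
      { intros x y Hxy Hx K.
        assert (K0 : (RtoC x * (z - z0))%C = (- (RtoC y * h))%C).
        { replace (RtoC x * (z - z0))%C with
            ((z0 + (RtoC x * (z - z0) + RtoC y * h)) - z0 - RtoC y * h)%C by ring.
          rewrite K; ring. }
        apply (f_equal Cmod) in K0. rewrite Cmod_opp, !Cmod_mult, !Cmod_R, (Rabs_pos_eq x) in K0 by lra.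
        assert (Rabs y * Cmod h <= x * Cmod h) by (apply Rmult_le_compat_r; auto using Cmod_ge_0).
        nra. }
      assert (T1 : triangle_int g b' z c = 0%C).
      { apply goursat_triangle. intros u Hu. apply Hd; [apply convex_bary; auto |].
        destruct Hu as (U1 & U2 & U3).
        replace (bary b' z c u) with (z0 + (RtoC (s * (1 - Re u - Im u) + Re u + Im u) * (z - z0) + RtoC (Im u) * h))%C.
        - apply Hne; [rewrite Rabs_pos_eq |]; nra.
        - unfold bary, b', c. rewrite !RtoC_plus, RtoC_mult, !RtoC_minus. ring. }
      assert (T2 : triangle_int g b' c c' = 0%C).
      { apply goursat_triangle. intros u Hu. apply Hd; [apply convex_bary; auto |].
        destruct Hu as (U1 & U2 & U3).
        replace (bary b' c c' u) with (z0 + (RtoC (s * (1 - Re u - Im u) + Re u + s * Im u) * (z - z0)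
          + RtoC (Re u + s * Im u) * h))%C.
        - apply Hne; [rewrite Rabs_pos_eq |]; nra.
        - unfold bary, b', c', c. rewrite !RtoC_plus, !RtoC_mult, !RtoC_minus. ring. }
      assert (E : triangle_int g z0 z c = triangle_int g z0 b' c').
      { assert (S1 : segment_int g z0 z = (segment_int g z0 b' + segment_int g b' z)%C)
          by (apply (SI_split g z0 z b' s); auto; lra).
        assert (S2 : segment_int g c z0 = (segment_int g c c' + segment_int g c' z0)%C).
        { apply (SI_split g c z0 c' (1 - s)); auto; [lra |]. unfold c'. rewrite RtoC_minus; ring. }
        assert (S3 := SI_reverse g b' c (Hcs b' c Wb' Wzh)).
        assert (S4 := SI_reverse g b' c' (Hcs b' c' Wb' Wc')).
        unfold triangle_int in *. rewrite S1, S2.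
        transitivity (segment_int g z0 b' + segment_int g b' c' + segment_int g c' z0 + (segment_int g b' z + segment_int g z c + segment_int g c b') +
          (segment_int g b' c + segment_int g c c' + segment_int g c' b'))%C.
        - rewrite S3, S4; ring.
        - rewrite T1, T2; ring. }
      rewrite E.
      assert (Bz : Cmod (b' - z0) = s * Cmod (z - z0)).
      { replace (b' - z0)%C with (RtoC s * (z - z0))%C by (unfold b'; ring).
        rewrite Cmod_mult, Cmod_R, Rabs_pos_eq; lra. }
      assert (Cz : Cmod (c' - z0) = s * Cmod (c - z0)).
      { replace (c' - z0)%C with (RtoC s * (c - z0))%C by (unfold c'; ring).
        rewrite Cmod_mult, Cmod_R, Rabs_pos_eq; lra. }
      assert (BC : Cmod (c' - b') = s * Cmod (c - z)).
      { replace (c' - b')%C with (RtoC s * (c - z))%C by (unfold b', c'; ring).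
        rewrite Cmod_mult, Cmod_R, Rabs_pos_eq; lra. }
      assert (P1 := Cmod_ge_0 (c - z)). assert (P2 := Cmod_ge_0 (c - z0)).
      assert (Hedge : forall x y, W x -> W y -> Cmod (x - z0) < d0 -> Cmod (y - z0) < d0 ->
        Cmod (segment_int g x y) <= 2 * m * Cmod (y - x)).
      { intros x y Wx Wy Hx Hy. apply SI_bound; auto. intros t Ht.
        assert (Hr : Cmod (x + RtoC t * (y - x) - z0) < d0).
        { replace (x + RtoC t * (y - x) - z0)%C with (RtoC (1 - t) * (x - z0) + RtoC t * (y - z0))%C
            by (rewrite RtoC_minus; ring).
          eapply Rle_lt_trans; [apply Cmod_triangle |].
          rewrite !Cmod_mult, !Cmod_R, !Rabs_pos_eq by lra.
          destruct (Req_dec t 0) as [-> | Ht0]; [lra |]. nra. }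
        apply Hb0 in Hr. unfold m.
        generalize (Cmod_triangle_rev (g (x + RtoC t * (y - x))%C) (g z0)); lra. }
      assert (Z0 : Cmod (z0 - z0) < d0).
      { replace (z0 - z0)%C with (RtoC 0) by ring. rewrite Cmod_0; auto. }
      assert (Bd : Cmod (b' - z0) < d0) by (unfold len in Hsl; nra).
      assert (Cc0 : Cmod (c' - z0) < d0) by (unfold len in Hsl; nra).
      unfold triangle_int.
      eapply Rle_trans; [apply Cmod_triangle |].
      eapply Rle_trans; [apply Rplus_le_compat_r, Cmod_triangle |].
      assert (G1 := Hedge z0 b' Wz0 Wb' Z0 Bd). assert (G2 := Hedge b' c' Wb' Wc' Bd Cc0).
      assert (G3 := Hedge c' z0 Wc' Wz0 Cc0 Z0). rewrite (Cmod_minus_sym z0 c') in G3.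
      rewrite Bz in G1. rewrite BC in G2. rewrite Cz in G3. unfold len. lra. }
    apply Cmod_eq_0, Rle_antisym; [| apply Cmod_ge_0].
    apply le_epsilon; intros eps Heps. rewrite Rplus_0_l.
    set (s := Rmin (/ 2) (Rmin (d0 / (2 * len)) (eps / (2 * m * len)))).
    assert (Hml : 0 < 2 * m * len) by (repeat apply Rmult_lt_0_compat; lra).
    assert (Hs : 0 < s).
    { repeat apply Rmin_pos; [lra | |]; apply Rdiv_lt_0_compat; lra. }
    assert (Hs1 : s <= / 2) by apply Rmin_l.
    assert (Hs2 : s <= d0 / (2 * len)) by (eapply Rle_trans; [apply Rmin_r | apply Rmin_l]).
    assert (Hs3 : s <= eps / (2 * m * len)) by (eapply Rle_trans; [apply Rmin_r | apply Rmin_r]).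
    apply Rle_div_r in Hs2; [| lra]. apply Rle_div_r in Hs3; [| lra].
    eapply Rle_trans; [apply (Hsm s); lra | lra]. }
  intros eps Heps.
  destruct (Hg z Wz (eps / 2)) as (d1 & Hd1 & Hc1); [lra |].
  destruct (Wo z Wz) as (d2 & Hd2 & Hw2).
  exists (Rmin (Cmod (z - z0)) (Rmin d1 d2)). split; [repeat apply Rmin_pos; auto |].
  intros w Hw.
  assert (L1 := Rmin_l (Cmod (z - z0)) (Rmin d1 d2)). assert (L2 := Rmin_r (Cmod (z - z0)) (Rmin d1 d2)).
  assert (L3 := Rmin_l d1 d2). assert (L4 := Rmin_r d1 d2).
  assert (Ww : W w) by (apply Hw2; lra).
  assert (Ht : triangle_int g z0 z w = 0%C).
  { replace w with (z + (w - z))%C by ring. apply Htri; [lra |].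
    replace (z + (w - z))%C with w by ring; auto. }
  unfold triangle_int in Ht. rewrite (SI_reverse g z0 w (Hcs z0 w Wz0 Ww)) in Ht.
  assert (Hconst : forall q x y, cont_segment (fun _ : C => q) x y).
  { intros q x y t _ e He. exists 1; split; [lra |]. intros; replace (q - q)%C with (RtoC 0) by ring.
    rewrite Cmod_0; auto. }
  replace (segment_int g z0 w - segment_int g z0 z - g z * (w - z))%C with (segment_int (fun r => g r - g z)%C z w).
  - eapply Rle_trans; [apply (SI_bound _ z w (eps / 2)) |].
    + intros t Ht'. apply cont_at_minus; [apply (Hcs z w); auto | apply (Hconst (g z) z w t Ht')].
    + intros t Ht'. left. apply Hc1.
      replace (z + RtoC t * (w - z) - z)%C with (RtoC t * (w - z))%C by ring.
      rewrite Cmod_mult, Cmod_R, Rabs_pos_eq by lra.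
      assert (0 <= Cmod (w - z)) by apply Cmod_ge_0. nra.
    + lra.
  - rewrite (SI_minus g (fun _ => g z)) by auto. unfold segment_int at 2. rewrite CInt_const.
    replace (segment_int g z0 w) with (segment_int g z0 z + segment_int g z w - (segment_int g z0 z + segment_int g z w + - segment_int g z0 w))%C by ring.
    rewrite Ht; ring.
Qed.

(** * Cauchy's formula on a sector *)

(* The boundary of the sector: lower edge, arc, upper edge, each over [0 <= t <= 1]. *)
Definition gam (th rad : R) (i : nat) (t : R) : C :=
  match i with
  | O => (RtoC (t * rad) * cis (- th))%C
  | 1%nat => (RtoC rad * cis (th * (2 * t - 1)))%C
  | _ => (RtoC ((1 - t) * rad) * cis th)%C
  end.

Definition dgam (th rad : R) (i : nat) (t : R) : C :=
  match i with
  | O => (RtoC rad * cis (- th))%C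
  | 1%nat => (RtoC (2 * th * rad) * (Ci * cis (th * (2 * t - 1))))%C
  | _ => (- (RtoC rad * cis th))%C
  end.

Definition contour_int (F : nat -> R -> C) : C := (CInt (F 0%nat) + CInt (F 1%nat) + CInt (F 2%nat))%C.

Lemma rdiff_gam (th rad : R) (i : nat) (t : R) : rdiff (gam th rad i) t (dgam th rad i t).
Proof.
  apply rdiff_is_derive.
  destruct i as [| [| i]]; unfold gam, dgam, cis, Re, Im; simpl; split; auto_derive; auto;
    unfold Rminus; ring.
Qed.

Lemma pcont_gam (th rad : R) (i : nat) (t : R) : pcont (gam th rad i) t.
Proof. eapply rdiff_pcont, rdiff_gam. Qed.

Lemma pcont_cis (h : R -> R) (t : R) : ex_derive h t -> pcont (fun s => cis (h s)) t.
Proof.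
  intros Hh. split; unfold cis, Re, Im; simpl;
    apply (ex_derive_continuous (V := R_NormedModule)); auto_derive; auto.
Qed.

Lemma pcont_dgam (th rad : R) (i : nat) (t : R) : pcont (dgam th rad i) t.
Proof.
  destruct i as [| [| i]]; try apply pcont_const.
  apply pcont_mult; [apply pcont_const |]. apply pcont_mult; [apply pcont_const |].
  apply pcont_cis. auto_derive; auto.
Qed.

Lemma gam_sector (th rad : R) (i : nat) (t : R) : 0 < th < PI / 2 -> 0 < rad -> 0 <= t <= 1 ->
  sector th rad (gam th rad i t).
Proof.
  intros Hth Hrad Ht. destruct i as [| [| i]]; apply sector_cis; auto; try nra; apply Rabs_le; nra.
Qed.

Lemma Cmod_dgam (th rad : R) (i : nat) (t : R) : 0 < th <= PI / 4 -> 0 < rad ->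
  Cmod (dgam th rad i t) <= 2 * rad.
Proof.
  intros Hth Hrad. assert (HPI := PI_bounds).
  destruct i as [| [| i]]; unfold dgam; rewrite ?Cmod_opp, !Cmod_mult, ?Cmod_Ci, Cmod_cis, Cmod_R,
    Rabs_pos_eq; nra.
Qed.

Lemma gam_not_open_sector (th rad : R) (i : nat) (t : R) : 0 < th < PI / 2 -> 0 < rad ->
  0 <= t <= 1 -> ~ open_sector th rad (gam th rad i t).
Proof.
  intros Hth Hrad Ht [H1 H2].
  destruct i as [| [| i]].
  - unfold gam, cis, Re, Im in H1; simpl in H1. rewrite cos_neg, sin_neg in H1.
    assert (0 < sin th) by (apply sin_gt_0; lra).
    replace (t * rad * - sin th + 0 * cos th) with (- (t * rad * sin th)) in H1 by ring.
    rewrite Rabs_Ropp, Rabs_pos_eq in H1 by (apply Rmult_le_pos; nra). lra.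
  - unfold gam in H2. rewrite Cmod_polar in H2; lra.
  - unfold gam, cis, Re, Im in H1; simpl in H1.
    assert (0 < sin th) by (apply sin_gt_0; lra).
    replace ((1 - t) * rad * sin th + 0 * cos th) with ((1 - t) * rad * sin th) in H1 by ring.
    rewrite Rabs_pos_eq in H1 by (apply Rmult_le_pos; nra). lra.
Qed.

Lemma sin_ge_half (x : R) : 0 <= x <= PI / 4 -> x / 2 <= sin x.
Proof.
  intros Hx. assert (HPI := PI_bounds).
  destruct (MVT_gen sin 0 x cos) as (c & Hc & E).
  { intros; auto_derive; auto; ring. }
  { intros; apply continuity_sin. }
  rewrite Rmin_left, Rmax_right in Hc by lra. rewrite sin_0, !Rminus_0_r in E. rewrite E.
  assert (H : cos (PI / 3) <= cos c) by (apply cos_decr_1; lra).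
  rewrite cos_PI3 in H. nra.
Qed.

Lemma Rabs_sin_ge (x : R) : Rabs x <= PI / 2 -> Rabs x / 4 <= Rabs (sin x).
Proof.
  intros Hx. assert (HPI := PI_bounds).
  assert (K : forall y, 0 <= y <= PI / 2 -> y / 4 <= sin y).
  { intros y Hy. replace y with (2 * (y / 2)) at 2 by field. rewrite sin_2a.
    assert (H1 : y / 2 / 2 <= sin (y / 2)) by (apply sin_ge_half; lra).
    assert (H2 : cos (PI / 3) <= cos (y / 2)) by (apply cos_decr_1; lra).
    rewrite cos_PI3 in H2. nra. }
  assert (H := K (Rabs x) (conj (Rabs_pos x) Hx)).
  eapply Rle_trans; [exact H |]. unfold Rabs at 1; destruct (Rcase_abs x).
  - rewrite sin_neg. rewrite <- Rabs_Ropp. apply Rle_abs.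
  - apply Rle_abs.
Qed.

(** The linear lower bound lets functions of [|gam - y|] be integrated in the parameter. On the
    edges it comes from projecting to the edge direction; on the arc from the sine of the angle
    difference, which [th <= PI / 4] keeps within [PI / 2]. *)
Lemma gam_chord (th rad : R) (i : nat) (y : C) : 0 < th <= PI / 4 -> 0 < rad -> sector th rad y ->
  exists t0, forall t, 0 <= t <= 1 -> th * rad / 2 * Rabs (t - t0) <= Cmod (gam th rad i t - y).
Proof.
  intros Hth Hrad Hy. assert (HPI := PI_bounds).
  assert (Hedge : forall (z w : C) s phi, z = (RtoC s * cis phi)%C ->
    Rabs (s - Re (cis (- phi) * w)) <= Cmod (z - w)).
  { intros z w s phi ->.
    replace (s - Re (cis (- phi) * w)) with (Re (cis (- phi) * (RtoC s * cis phi - w))).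
    - eapply Rle_trans; [apply re_le_Cmod |]. rewrite Cmod_mult, Cmod_cis; lra.
    - replace (cis (- phi) * (RtoC s * cis phi - w))%C with (RtoC s * (cis (- phi) * cis phi) - cis (- phi) * w)%C by ring.
      rewrite cis_opp_mult. unfold Re; simpl; ring. }
  destruct i as [| [| i]].
  - exists (Re (cis th * y) / rad). intros t Ht.
    assert (H := Hedge (gam th rad 0 t) y (t * rad) (- th) eq_refl).
    rewrite Ropp_involutive in H. eapply Rle_trans; [| exact H].
    replace (t * rad - Re (cis th * y)) with (rad * (t - Re (cis th * y) / rad)) by (field; lra).
    rewrite Rabs_mult, (Rabs_pos_eq rad) by lra.
    assert (H0 := Rabs_pos (t - Re (cis th * y) / rad)).
    apply Rmult_le_compat_r; auto. nra.
  - apply sector_polar in Hy; [| lra]. destruct Hy as (r & psi & Hr & Hpsi & ->).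
    exists ((psi / th + 1) / 2). intros t Ht.
    apply Rabs_le_between in Hpsi.
    set (d := th * (2 * t - 1) - psi).
    assert (Hd : Rabs d <= PI / 2) by (unfold d; apply Rabs_le; nra).
    assert (K : rad * Rabs (sin d) <= Cmod (gam th rad 1 t - RtoC r * cis psi)).
    { replace (rad * Rabs (sin d)) with (Rabs (Im (cis (- psi) * (gam th rad 1 t - RtoC r * cis psi)))).
      - eapply Rle_trans; [apply Rabs_Im_le_Cmod |]. rewrite Cmod_mult, Cmod_cis; lra.
      - replace (cis (- psi) * (gam th rad 1 t - RtoC r * cis psi))%C with
          (RtoC rad * cis d - RtoC r)%C.
        + rewrite <- (Rabs_pos_eq rad) at 2 by lra. rewrite <- Rabs_mult. f_equal.
          unfold cis, Im; simpl; ring.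
        + unfold gam. replace (cis d) with (cis (- psi) * cis (th * (2 * t - 1)))%C
            by (rewrite <- cis_plus; f_equal; unfold d; ring).
          replace (RtoC r) with (RtoC r * (cis (- psi) * cis psi))%C at 1 by (rewrite cis_opp_mult; ring).
          ring. }
    assert (K2 := Rabs_sin_ge d Hd).
    replace (t - (psi / th + 1) / 2) with (d / (2 * th)) by (unfold d; field; lra).
    unfold Rdiv at 2. rewrite Rabs_mult, Rabs_inv, (Rabs_pos_eq (2 * th)) by lra.
    replace (th * rad / 2 * (Rabs d * / (2 * th))) with (rad * (Rabs d / 4)) by (field; lra).
    nra.
  - exists (1 - Re (cis (- th) * y) / rad). intros t Ht.
    assert (H := Hedge (gam th rad (S (S i)) t) y ((1 - t) * rad) th eq_refl).
    eapply Rle_trans; [| exact H].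
    replace ((1 - t) * rad - Re (cis (- th) * y)) with (rad * - (t - (1 - Re (cis (- th) * y) / rad))) by (field; lra).
    rewrite Rabs_mult, Rabs_Ropp, (Rabs_pos_eq rad) by lra.
    apply Rmult_le_compat_r; [apply Rabs_pos |]. nra.
Qed.

Lemma CI_ext (F K : nat -> R -> C) : (forall i t, 0 <= t <= 1 -> F i t = K i t) -> contour_int F = contour_int K.
Proof. intros H; unfold contour_int; rewrite !(CInt_ext (F _) (K _)) by auto; auto. Qed.

Lemma CI_minus (F K : nat -> R -> C) : (forall i, pcont01 (F i)) -> (forall i, pcont01 (K i)) ->
  contour_int (fun i t => F i t - K i t)%C = (contour_int F - contour_int K)%C.
Proof. intros HF HK; unfold contour_int; rewrite !(CInt_minus (F _) (K _)) by auto; ring. Qed.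

Lemma CI_scal (c : C) (F : nat -> R -> C) : (forall i, pcont01 (F i)) ->
  contour_int (fun i t => c * F i t)%C = (c * contour_int F)%C.
Proof. intros HF; unfold contour_int; rewrite !(CInt_scal c (F _)) by auto; ring. Qed.

Lemma CI_bound_fun (F : nat -> R -> C) (b : nat -> R -> R) (m : R) : (forall i, pcont01 (F i)) ->
  (forall i, ex_RInt (b i) 0 1 /\ RInt (b i) 0 1 <= m) ->
  (forall i t, 0 <= t <= 1 -> Cmod (F i t) <= b i t) -> Cmod (contour_int F) <= 6 * m.
Proof.
  intros HF Hb H. unfold contour_int.
  assert (K : forall i, Cmod (CInt (F i)) <= 2 * m).
  { intros i. destruct (Hb i) as [H1 H2].
    assert (H3 := CInt_bound_fun (F i) (b i) (HF i) H1 (H i)). lra. }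
  eapply Rle_trans; [apply Cmod_triangle |].
  eapply Rle_trans; [apply Rplus_le_compat_r, Cmod_triangle |].
  generalize (K 0%nat) (K 1%nat) (K 2%nat); lra.
Qed.

Lemma CI_bound (F : nat -> R -> C) (m : R) : (forall i, pcont01 (F i)) ->
  (forall i t, 0 <= t <= 1 -> Cmod (F i t) <= m) -> Cmod (contour_int F) <= 6 * m.
Proof.
  intros HF H. apply (CI_bound_fun F (fun _ _ => m)); auto. intros i. split.
  - apply (ex_RInt_const (V := R_NormedModule)).
  - rewrite RInt_const. unfold scal; simpl; unfold mult; simpl. lra.
Qed.

Lemma CI_FTC (th rad : R) (G g : C -> C) :
  (forall i t, 0 <= t <= 1 -> cdiff G (gam th rad i t) (g (gam th rad i t))) ->
  (forall i t, 0 <= t <= 1 -> cont_at g (gam th rad i t)) ->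
  contour_int (fun i t => g (gam th rad i t) * dgam th rad i t)%C = 0%C.
Proof.
  intros HG Hg.
  assert (K : forall i, CInt (fun t => g (gam th rad i t) * dgam th rad i t)%C =
    (G (gam th rad i 1) - G (gam th rad i 0))%C).
  { intros i. apply (CInt_FTC (fun t => G (gam th rad i t))).
    - intros t Ht. apply rdiff_comp; auto. apply rdiff_gam.
    - intros t Ht. apply pcont_mult; [| apply pcont_dgam].
      apply (pcont_comp g); [apply pcont_gam | apply Hg; auto]. }
  unfold contour_int. rewrite !K.
  assert (E1 : gam th rad 0 1 = gam th rad 1 0) by (unfold gam; do 3 f_equal; ring).
  assert (E2 : gam th rad 1 1 = gam th rad 2 0).
  { unfold gam. replace ((1 - 0) * rad) with rad by ring. do 2 f_equal; ring. }
  assert (E3 : gam th rad 2 1 = gam th rad 0 0).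
  { unfold gam. replace ((1 - 1) * rad) with 0 by ring. replace (0 * rad) with 0 by ring. ring. }
  rewrite E1, E2, E3; ring.
Qed.

(** The primitive is known to be differentiable only away from [z0]; this is enough because the
    contour avoids the interior point [z0]. *)
Lemma contour_zero (th rad : R) (W : C -> Prop) (g : C -> C) (z0 : C) :
  0 < th < PI / 2 -> 0 < rad -> open_set_C W -> convex_set W ->
  (forall z, sector th rad z -> W z) -> open_sector th rad z0 ->
  (forall z, W z -> cont_at g z) -> (forall z, W z -> z <> z0 -> exists l, cdiff g z l) ->
  contour_int (fun i t => g (gam th rad i t) * dgam th rad i t)%C = 0%C.
Proof.
  intros Hth Hrad Wo Wc HW Hz0 Hg Hd.
  apply (CI_FTC th rad (segment_int g z0)).
  - intros i t Ht. apply (primitive_star W g z0); auto.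
    + apply HW, open_sector_sector; auto.
    + apply HW, gam_sector; auto.
    + intros E. apply (gam_not_open_sector th rad i t); auto. rewrite E; auto.
  - intros i t Ht. apply Hg, HW, gam_sector; auto.
Qed.

Lemma cdiff_const (c z : C) : cdiff (fun _ => c) z 0%C.
Proof.
  intros eps Heps. exists 1; split; [lra |]. intros w _.
  replace (c - c - 0 * (w - z))%C with (RtoC 0) by ring. rewrite Cmod_0.
  apply Rmult_le_pos; [lra | apply Cmod_ge_0].
Qed.

Lemma cdiff_scal (c : C) (f : C -> C) (z l : C) : cdiff f z l -> cdiff (fun w => c * f w)%C z (c * l)%C.
Proof.
  intros H eps Heps. assert (Hc := Cmod_ge_0 c).
  destruct (H (eps / (Cmod c + 1))) as (d & Hd & K); [apply Rdiv_lt_0_compat; lra |].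
  exists d; split; auto. intros w Hw.
  replace (c * f w - c * f z - c * l * (w - z))%C with (c * (f w - f z - l * (w - z)))%C by ring.
  rewrite Cmod_mult. assert (Q := K w Hw). assert (H0 := Cmod_ge_0 (w - z)).
  apply Rle_trans with ((Cmod c + 1) * (eps / (Cmod c + 1) * Cmod (w - z))).
  - apply Rmult_le_compat; auto using Cmod_ge_0; lra.
  - right; field; lra.
Qed.

Lemma cdiff_inv_shift (a z : C) : z <> a -> cdiff (fun w => / (w - a))%C z (- / ((z - a) * (z - a)))%C.
Proof.
  intros Hz.
  assert (Hn : (z - a)%C <> RtoC 0).
  { intros K; apply Hz. replace z with ((z - a) + a)%C by ring. rewrite K; ring. }
  assert (Hp := proj1 (Cmod_gt_0 _) Hn). set (r := Cmod (z - a)) in *.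
  apply cdiff_of_quadratic with (r / 2) (2 / (r * r * r)); [lra |].
  intros w Hw.
  assert (Hwr : r / 2 <= Cmod (w - a)).
  { assert (T := Cmod_triangle_rev (z - a) (w - a)). replace (z - a - (w - a))%C with (- (w - z))%C in T by ring.
    rewrite Cmod_opp in T. fold r in T. lra. }
  assert (Hwn : (w - a)%C <> RtoC 0) by (apply Cmod_gt_0; lra).
  replace (/ (w - a) - / (z - a) - - / ((z - a) * (z - a)) * (w - z))%C with
    ((w - z) * (w - z) / ((z - a) * (z - a) * (w - a)))%C by (field; auto).
  rewrite Cmod_div, !Cmod_mult by (repeat apply Cmult_neq_0; auto). fold r.
  set (D := Cmod (w - z) * Cmod (w - z)).
  assert (HD : 0 <= D) by (apply Rmult_le_pos; apply Cmod_ge_0).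
  unfold Rdiv. rewrite (Rmult_comm D). apply Rmult_le_compat_r; auto.
  replace (2 * / (r * r * r)) with (/ (r * r * (r / 2))) by (field; lra).
  apply Rinv_le_contravar.
  - repeat apply Rmult_lt_0_compat; lra.
  - apply Rmult_le_compat_l; nra.
Qed.

Lemma cdiff_mult (f g : C -> C) (z l m : C) : cdiff f z l -> cdiff g z m ->
  exists k, cdiff (fun w => f w * g w)%C z k.
Proof.
  intros Hf Hg. exists (l * g z + f z * m)%C. intros eps Heps.
  set (a := Cmod (f z) + Cmod (g z) + Cmod l + 2).
  assert (A1 := Cmod_ge_0 (f z)). assert (A2 := Cmod_ge_0 (g z)). assert (A3 := Cmod_ge_0 l).
  assert (Ha : 0 < a) by (unfold a; lra).
  set (e := Rmin 1 (eps / (2 * a))).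
  assert (He : 0 < e) by (apply Rmin_pos; [lra | apply Rdiv_lt_0_compat; lra]).
  assert (He1 : e <= 1) by apply Rmin_l. assert (He2 : e <= eps / (2 * a)) by apply Rmin_r.
  apply Rle_div_r in He2; [| lra].
  destruct (Hf e He) as (d1 & Hd1 & K1). destruct (Hg e He) as (d2 & Hd2 & K2).
  destruct (cdiff_continuous g z m Hg e He) as (d3 & Hd3 & K3).
  exists (Rmin d1 (Rmin d2 d3)); split; [repeat apply Rmin_pos; auto |]. intros w Hw.
  assert (L1 := Rmin_l d1 (Rmin d2 d3)). assert (L2 := Rmin_r d1 (Rmin d2 d3)).
  assert (L3 := Rmin_l d2 d3). assert (L4 := Rmin_r d2 d3).
  assert (Q1 := K1 w ltac:(lra)). assert (Q2 := K2 w ltac:(lra)). assert (Q3 := K3 w ltac:(lra)).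
  set (D := Cmod (w - z)) in *. assert (HD : 0 <= D) by apply Cmod_ge_0.
  assert (Q4 : Cmod (f w - f z) <= (Cmod l + 1) * D).
  { replace (f w - f z)%C with ((f w - f z - l * (w - z)) + l * (w - z))%C by ring.
    eapply Rle_trans; [apply Cmod_triangle |]. rewrite Cmod_mult. fold D. nra. }
  replace (f w * g w - f z * g z - (l * g z + f z * m) * (w - z))%C with
    ((f w - f z - l * (w - z)) * g z + f z * (g w - g z - m * (w - z)) + (f w - f z) * (g w - g z))%C
    by ring.
  eapply Rle_trans; [apply Cmod_triangle |].
  eapply Rle_trans; [apply Rplus_le_compat_r, Cmod_triangle |]. rewrite !Cmod_mult.
  assert (R1 : Cmod (f w - f z - l * (w - z)) * Cmod (g z) <= e * D * Cmod (g z))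
    by (apply Rmult_le_compat_r; auto).
  assert (R2 : Cmod (f z) * Cmod (g w - g z - m * (w - z)) <= Cmod (f z) * (e * D))
    by (apply Rmult_le_compat_l; auto).
  assert (R3 : Cmod (f w - f z) * Cmod (g w - g z) <= (Cmod l + 1) * D * e)
    by (apply Rmult_le_compat; auto using Cmod_ge_0; lra).
  apply Rle_trans with (e * a * D); [unfold a; nra | nra].
Qed.

Lemma cont_at_mult (f g : C -> C) (z : C) : cont_at f z -> cont_at g z -> cont_at (fun w => f w * g w)%C z.
Proof.
  intros Hf Hg eps Heps.
  set (a := Cmod (f z) + Cmod (g z) + 1).
  assert (Ha : 0 < a) by (unfold a; generalize (Cmod_ge_0 (f z)) (Cmod_ge_0 (g z)); lra).
  set (e := Rmin 1 (eps / (2 * a))).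
  assert (He : 0 < e) by (apply Rmin_pos; [lra | apply Rdiv_lt_0_compat; lra]).
  assert (He1 : e <= 1) by apply Rmin_l. assert (He2 : e <= eps / (2 * a)) by apply Rmin_r.
  apply Rle_div_r in He2; [| lra].
  destruct (Hf e He) as (d & Hd & H1). destruct (Hg e He) as (d' & Hd' & H2).
  exists (Rmin d d'); split; [apply Rmin_pos; auto |]. intros w Hw.
  assert (Q1 := H1 w (Rlt_le_trans _ _ _ Hw (Rmin_l _ _))).
  assert (Q2 := H2 w (Rlt_le_trans _ _ _ Hw (Rmin_r _ _))).
  replace (f w * g w - f z * g z)%C with
    ((f w - f z) * g z + f z * (g w - g z) + (f w - f z) * (g w - g z))%C by ring.
  eapply Rle_lt_trans; [apply Cmod_triangle |].
  eapply Rle_lt_trans; [apply Rplus_le_compat_r, Cmod_triangle |]. rewrite !Cmod_mult.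
  assert (F1 := Cmod_ge_0 (f z)). assert (F2 := Cmod_ge_0 (g z)).
  assert (F3 := Cmod_ge_0 (f w - f z)). assert (F4 := Cmod_ge_0 (g w - g z)).
  assert (Cmod (f w - f z) * Cmod (g z) <= e * Cmod (g z)) by (apply Rmult_le_compat_r; lra).
  assert (Cmod (f z) * Cmod (g w - g z) <= Cmod (f z) * e) by (apply Rmult_le_compat_l; lra).
  assert (Cmod (f w - f z) * Cmod (g w - g z) <= e * 1) by (apply Rmult_le_compat; lra).
  unfold a in *. nra.
Qed.

(** A line separates [zs] from the sector. Cutting [W] by a parallel half-plane leaves a convex open
    set on which [v z / (z - zs)] is holomorphic. *)
Lemma outside_zero (th rad : R) (W : C -> Prop) (v : C -> C) (zs e : C) (d : R) :
  0 < th < PI / 2 -> 0 < rad -> open_set_C W -> convex_set W ->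
  (forall z, sector th rad z -> W z) -> (forall z, W z -> exists l, cdiff v z l) -> 0 < d ->
  (forall z, sector th rad z -> Re (e * (z - zs)) <= - d) ->
  contour_int (fun i t => v (gam th rad i t) * / (gam th rad i t - zs) * dgam th rad i t)%C = 0%C.
Proof.
  intros Hth Hrad Wo Wc HW Hv Hd He.
  set (W' := fun z => W z /\ Re (e * z) < Re (e * zs) - d / 2).
  assert (Hne : forall z, W' z -> z <> zs) by (intros z [_ H] ->; lra).
  assert (Hdiff : forall z, W' z -> exists l, cdiff (fun w => v w * / (w - zs))%C z l).
  { intros z Hz. destruct (Hv z (proj1 Hz)) as [l Hl].
    eapply cdiff_mult; [apply Hl | apply cdiff_inv_shift; auto]. }
  apply (contour_zero th rad W' (fun w => v w * / (w - zs))%C (RtoC (rad / 2))); auto.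
  - intros z [H1 H2]. destruct (Wo z H1) as (d1 & Hd1 & K1).
    destruct (lipschitz_lt_near _ _ _ z (lipschitz_linear e) H2) as (d2 & Hd2 & K2).
    exists (Rmin d1 d2); split; [apply Rmin_pos; auto |]. intros w Hw.
    split; [apply K1 | apply K2]; (eapply Rlt_le_trans; [exact Hw |]); [apply Rmin_l | apply Rmin_r].
  - intros z w s [H1 H2] [H3 H4] Hs. split; [apply Wc; auto |].
    replace (Re (e * (z + RtoC s * (w - z)))) with ((1 - s) * Re (e * z) + s * Re (e * w))
      by (unfold Re; simpl; ring).
    set (m := Re (e * zs) - d / 2) in *.
    destruct (Req_dec s 0) as [-> | Hs0]; [lra |]. nra.
  - intros z Hz. split; auto. assert (Q := He z Hz).
    replace (Re (e * (z - zs))) with (Re (e * z) - Re (e * zs)) in Q by (unfold Re; simpl; ring). lra.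
  - assert (Hs : 0 < sin th) by (apply sin_gt_0; lra).
    split; [simpl; rewrite Rabs_R0; nra |]. rewrite Cmod_R, Rabs_pos_eq; lra.
  - intros z Hz. destruct (Hdiff z Hz) as [l Hl]. eapply cdiff_cont_at; eauto.
Qed.

Definition winding (th rad : R) (z : C) : C :=
  contour_int (fun i t => / (gam th rad i t - z) * dgam th rad i t)%C.

Lemma gam_minus_neq (th rad : R) (i : nat) (t : R) (z : C) : 0 < th < PI / 2 -> 0 < rad ->
  0 <= t <= 1 -> open_sector th rad z -> (gam th rad i t - z)%C <> RtoC 0.
Proof.
  intros Hth Hrad Ht Hz K. apply (gam_not_open_sector th rad i t); auto.
  replace (gam th rad i t) with ((gam th rad i t - z) + z)%C by ring. rewrite K.
  replace (0 + z)%C with z by ring; auto.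
Qed.

(** The difference quotient of [v] at [z], completed by the derivative, is continuous at [z] and
    holomorphic elsewhere, so its contour integral vanishes. [winding] replaces the explicit
    constant of Cauchy's formula. *)
Lemma inside_cauchy (th rad : R) (W : C -> Prop) (v : C -> C) (z : C) :
  0 < th < PI / 2 -> 0 < rad -> open_set_C W -> convex_set W ->
  (forall z, sector th rad z -> W z) -> (forall z, W z -> exists l, cdiff v z l) ->
  open_sector th rad z ->
  contour_int (fun i t => v (gam th rad i t) * / (gam th rad i t - z) * dgam th rad i t)%C =
    (v z * winding th rad z)%C.
Proof.
  intros Hth Hrad Wo Wc HW Hv Hz.
  destruct (Hv z (HW z (open_sector_sector _ _ _ Hz))) as [l Hl].
  set (g := fun w : C => if excluded_middle_informative (w = z) then l else ((v w - v z) * / (w - z))%C).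
  assert (Hgz : g z = l) by (unfold g; destruct (excluded_middle_informative (z = z)); tauto).
  assert (Hgw : forall w, w <> z -> g w = ((v w - v z) * / (w - z))%C).
  { intros w Hw; unfold g; destruct (excluded_middle_informative (w = z)); tauto. }
  assert (Hsub : forall w, w <> z -> (w - z)%C <> RtoC 0).
  { intros w Hw K; apply Hw. replace w with ((w - z) + z)%C by ring. rewrite K; ring. }
  assert (Hgd : forall w, W w -> w <> z -> exists k, cdiff g w k).
  { intros w Ww Hwz. destruct (Hv w Ww) as [m Hm].
    assert (H1 : cdiff (fun u => v u + - v z)%C w (m + 0)%C) by (apply cdiff_plus; [auto | apply cdiff_const]).
    destruct (cdiff_mult _ _ w _ _ H1 (cdiff_inv_shift z w Hwz)) as [k Hk].
    exists k. intros eps Heps. destruct (Hk eps Heps) as (d & Hd & K).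
    assert (Hp := proj1 (Cmod_gt_0 _) (Hsub w Hwz)).
    exists (Rmin d (Cmod (w - z))). split; [apply Rmin_pos; auto |]. intros u Hu.
    assert (Huz : u <> z).
    { intros ->. assert (Q := Rlt_le_trans _ _ _ Hu (Rmin_r _ _)). rewrite Cmod_minus_sym in Q. lra. }
    rewrite (Hgw u Huz), (Hgw w Hwz). apply K. eapply Rlt_le_trans; [exact Hu | apply Rmin_l]. }
  assert (E : contour_int (fun i t => g (gam th rad i t) * dgam th rad i t)%C = 0%C).
  { apply (contour_zero th rad W g z); auto. intros w Ww.
    destruct (classic (w = z)) as [-> | Hwz].
    - intros eps Heps. destruct (Hl (eps / 2)) as (d & Hd & K); [lra |].
      exists d; split; auto. intros w Hw. rewrite Hgz.
      destruct (classic (w = z)) as [-> | Hwz].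
      + rewrite Hgz. replace (l - l)%C with (RtoC 0) by ring. rewrite Cmod_0; auto.
      + rewrite (Hgw w Hwz). assert (Hp := proj1 (Cmod_gt_0 _) (Hsub w Hwz)).
        replace ((v w - v z) * / (w - z) - l)%C with ((v w - v z - l * (w - z)) / (w - z))%C
          by (field; auto).
        rewrite Cmod_div by auto. apply Rlt_div_l; auto.
        eapply Rle_lt_trans; [apply K; auto | nra].
    - destruct (Hgd w Ww Hwz) as [k Hk]. eapply cdiff_cont_at; eauto. }
  assert (P1 : forall i, pcont01 (fun t => v (gam th rad i t) * / (gam th rad i t - z) * dgam th rad i t)%C).
  { intros i t Ht. apply pcont_mult; [apply pcont_mult | apply pcont_dgam].
    - apply (pcont_comp v); [apply pcont_gam |].
      destruct (Hv _ (HW _ (gam_sector th rad i t Hth Hrad Ht))) as [m Hm].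
      exact (cdiff_cont_at _ _ _ Hm).
    - apply pcont_inv; [apply pcont_minus; [apply pcont_gam | apply pcont_const] |].
      apply gam_minus_neq; auto. }
  assert (P2 : forall i, pcont01 (fun t => / (gam th rad i t - z) * dgam th rad i t)%C).
  { intros i t Ht. apply pcont_mult; [| apply pcont_dgam].
    apply pcont_inv; [apply pcont_minus; [apply pcont_gam | apply pcont_const] |].
    apply gam_minus_neq; auto. }
  assert (E2 : contour_int (fun i t => g (gam th rad i t) * dgam th rad i t)%C =
    (contour_int (fun i t => v (gam th rad i t) * / (gam th rad i t - z) * dgam th rad i t)%C - v z * winding th rad z)%C).
  { unfold winding. rewrite <- CI_scal by auto. rewrite <- CI_minus; auto.
    - apply CI_ext. intros i t Ht. rewrite Hgw; [ring |].
      intros K. apply (gam_minus_neq th rad i t z); auto. rewrite K; ring.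
    - intros i t Ht. apply pcont_mult; [apply pcont_const | apply P2; auto]. }
  rewrite E in E2.
  replace (contour_int (fun i t => v (gam th rad i t) * / (gam th rad i t - z) * dgam th rad i t)%C) with
    ((contour_int (fun i t => v (gam th rad i t) * / (gam th rad i t - z) * dgam th rad i t) - v z * winding th rad z)
      + v z * winding th rad z)%C by ring.
  rewrite <- E2; ring.
Qed.

Lemma open_sector_convex (th rad : R) : 0 < th < PI / 2 -> convex_set (open_sector th rad).
Proof.
  intros Hth z w s Hz Hw Hs. apply open_sector_linear; auto.
  apply open_sector_linear in Hz; auto. apply open_sector_linear in Hw; auto.
  destruct Hz as [[Z1 Z2] Z3]. destruct Hw as [[W1 W2] W3].
  assert (L : forall a, Re (a * (z + RtoC s * (w - z))) = (1 - s) * Re (a * z) + s * Re (a * w))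
    by (intros; unfold Re; simpl; ring).
  assert (K : forall x y m : R, x < m -> y < m -> (1 - s) * x + s * y < m).
  { intros x y m Hx Hy. destruct (Req_dec s 0) as [-> | Hs0]; [lra |]. nra. }
  rewrite !L. repeat split; auto.
  replace (z + RtoC s * (w - z))%C with (RtoC (1 - s) * z + RtoC s * w)%C by (rewrite RtoC_minus; ring).
  eapply Rle_lt_trans; [apply Cmod_triangle |].
  rewrite !Cmod_mult, !Cmod_R, !Rabs_pos_eq by lra. auto.
Qed.

Lemma open_sector_mid (th rad : R) : 0 < th < PI / 2 -> 0 < rad -> open_sector th rad (RtoC (rad / 2)).
Proof.
  intros Hth Hrad. assert (Hs : 0 < sin th) by (apply sin_gt_0; lra).
  split; [simpl; rewrite Rabs_R0; nra |]. rewrite Cmod_R, Rabs_pos_eq; lra.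
Qed.

Ltac pc :=
  match goal with
  | |- pcont01 _ => intros ? ?; pc
  | |- pcont (fun _ => ?c) _ => apply pcont_const
  | |- pcont (fun s => gam ?a ?b ?i s) _ => apply pcont_gam
  | |- pcont (fun s => dgam ?a ?b ?i s) _ => apply pcont_dgam
  | |- pcont (gam ?a ?b ?i) _ => apply pcont_gam
  | |- pcont (dgam ?a ?b ?i) _ => apply pcont_dgam
  | |- pcont (fun s => (@?f s + @?g s)%C) ?t => apply (pcont_plus f g t); pc
  | |- pcont (fun s => (@?f s - @?g s)%C) ?t => apply (pcont_minus f g t); pc
  | |- pcont (fun s => (@?f s * @?g s)%C) ?t => apply (pcont_mult f g t); pc
  | |- pcont (fun s => (- @?f s)%C) ?t => apply (pcont_opp f t); pc
  | |- pcont (fun s => (/ @?f s)%C) ?t =>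
      apply (pcont_inv f t); [pc | repeat apply Cmult_neq_0; auto]
  | _ => idtac
  end.

(** The derivative is the contour integral of [1 / (zeta - p)^2], which vanishes because that
    function has the primitive [- 1 / (zeta - p)] along the whole closed contour. *)
Lemma cdiff_winding (th rad : R) (p : C) : 0 < th < PI / 2 -> 0 < rad -> open_sector th rad p ->
  cdiff (winding th rad) p 0%C.
Proof.
  intros Hth Hrad Hp.
  destruct (open_sector_open th rad p Hth Hp) as (d & Hd & Hball).
  assert (Hfar : forall i t w, 0 <= t <= 1 -> Cmod (w - p) < d / 2 -> d / 2 <= Cmod (gam th rad i t - w)).
  { intros i t w Ht Hw. apply Rnot_lt_le; intros K.
    apply (gam_not_open_sector th rad i t); auto. apply Hball.
    replace (gam th rad i t - p)%C with ((gam th rad i t - w) + (w - p))%C by ring.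
    eapply Rle_lt_trans; [apply Cmod_triangle | lra]. }
  assert (Hpp : Cmod (p - p) < d / 2).
  { replace (p - p)%C with (RtoC 0) by ring. rewrite Cmod_0; lra. }
  assert (Hm : exists m, 0 <= m /\ forall i t, 0 <= t <= 1 -> Cmod (dgam th rad i t) <= m).
  { exists (rad + 2 * th * rad). split; [nra |]. intros i t _.
    destruct i as [| [| i]]; unfold dgam; rewrite ?Cmod_opp, !Cmod_mult, ?Cmod_Ci, Cmod_cis, Cmod_R,
      Rabs_pos_eq; nra. }
  destruct Hm as (m & Hm0 & Hm).
  apply cdiff_of_quadratic with (d / 2) (6 * (8 / (d * d * d) * m)); [lra |].
  intros w Hw.
  assert (Hn : forall i t v, 0 <= t <= 1 -> Cmod (v - p) < d / 2 -> (gam th rad i t - v)%C <> RtoC 0).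
  { intros i t v Ht Hv. apply Cmod_gt_0. assert (Q := Hfar i t v Ht Hv). lra. }
  assert (Z : contour_int (fun i t => / ((gam th rad i t - p) * (gam th rad i t - p)) * dgam th rad i t)%C = 0%C).
  { assert (Hnp : forall i t, 0 <= t <= 1 -> gam th rad i t <> p).
    { intros i t Ht K. apply (Hn i t p Ht Hpp). rewrite K; ring. }
    assert (Q : contour_int (fun i t => (- / ((gam th rad i t - p) * (gam th rad i t - p))) * dgam th rad i t)%C = 0%C).
    { apply (CI_FTC th rad (fun z => / (z - p))%C (fun z => - / ((z - p) * (z - p)))%C).
      - intros i t Ht. apply cdiff_inv_shift; auto.
      - intros i t Ht.
        assert (C1 : cont_at (fun z => / (z - p))%C (gam th rad i t))
          by (eapply cdiff_cont_at; apply cdiff_inv_shift; auto).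
        assert (C2 := cont_at_mult _ _ _ C1 C1).
        intros eps Heps. destruct (C2 eps Heps) as (d1 & Hd1 & K1).
        assert (Hpos := proj1 (Cmod_gt_0 _) (Hn i t p Ht Hpp)).
        exists (Rmin d1 (Cmod (gam th rad i t - p))); split; [apply Rmin_pos; auto |].
        intros v Hv. assert (Hvn : (v - p)%C <> RtoC 0).
        { intros K. assert (Q := Rlt_le_trans _ _ _ Hv (Rmin_r _ _)).
          replace v with ((v - p) + p)%C in Q by ring. rewrite K in Q.
          replace (0 + p - gam th rad i t)%C with (- (gam th rad i t - p))%C in Q by ring.
          rewrite Cmod_opp in Q. lra. }
        replace (- / ((v - p) * (v - p)) - - / ((gam th rad i t - p) * (gam th rad i t - p)))%C with
          (- (/ (v - p) * / (v - p) - / (gam th rad i t - p) * / (gam th rad i t - p)))%C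
          by (field; auto).
        rewrite Cmod_opp. apply K1. eapply Rlt_le_trans; [exact Hv | apply Rmin_l]. }
    transitivity (contour_int (fun i t => (- (1)) * ((- / ((gam th rad i t - p) * (gam th rad i t - p))) * dgam th rad i t))%C).
    - apply CI_ext; intros; ring.
    - rewrite CI_scal, Q by (intros i; pc). ring. }
  assert (E : (winding th rad w - winding th rad p - 0 * (w - p))%C =
    ((w - p) * (w - p) * contour_int (fun i t => / (gam th rad i t - w) * (/ (gam th rad i t - p) * / (gam th rad i t - p)) * dgam th rad i t))%C).
  { rewrite <- CI_scal by (intros i; pc).
    transitivity (contour_int (fun i t => / (gam th rad i t - w) * dgam th rad i t)%C -
      contour_int (fun i t => / (gam th rad i t - p) * dgam th rad i t)%C -
      (w - p) * contour_int (fun i t => / ((gam th rad i t - p) * (gam th rad i t - p)) * dgam th rad i t)%C)%C.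
    - rewrite Z. unfold winding; ring.
    - rewrite <- CI_scal by (intros i; pc). rewrite <- !CI_minus by (intros i; pc).
      apply CI_ext. intros i t Ht.
      assert (N1 := Hn i t w Ht Hw). assert (N2 := Hn i t p Ht Hpp). field; auto. }
  rewrite E, !Cmod_mult, Rmult_comm. apply Rmult_le_compat_r; [apply Rmult_le_pos; apply Cmod_ge_0 |].
  apply CI_bound.
  - intros i; pc.
  - intros i t Ht. rewrite !Cmod_mult, !Cmod_inv by auto.
    assert (F1 := Hfar i t w Ht Hw). assert (F2 := Hfar i t p Ht Hpp).
    assert (I1 : / Cmod (gam th rad i t - w) <= / (d / 2)) by (apply Rinv_le_contravar; lra).
    assert (I2 : / Cmod (gam th rad i t - p) <= / (d / 2)) by (apply Rinv_le_contravar; lra).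
    assert (I3 : 0 < / Cmod (gam th rad i t - w)) by (apply Rinv_0_lt_compat; lra).
    assert (I4 : 0 < / Cmod (gam th rad i t - p)) by (apply Rinv_0_lt_compat; lra).
    apply Rmult_le_compat; auto using Cmod_ge_0.
    + apply Rmult_le_pos; [lra | apply Rmult_le_pos; lra].
    + replace (8 / (d * d * d)) with (/ (d / 2) * (/ (d / 2) * / (d / 2))) by (field; lra).
      apply Rmult_le_compat; try lra; [apply Rmult_le_pos; lra |].
      apply Rmult_le_compat; lra.
Qed.

(** Constancy lets one number be divided out of the contour integrals for all [z] at once, so that a
    polynomial in [z] remains a polynomial. *)
Lemma winding_const (th rad : R) (z w : C) : 0 < th < PI / 2 -> 0 < rad ->
  open_sector th rad z -> open_sector th rad w -> winding th rad z = winding th rad w.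
Proof.
  intros Hth Hrad Hz Hw.
  assert (E : CInt (fun _ => 0%C) = (winding th rad (z + RtoC 1 * (w - z)) - winding th rad (z + RtoC 0 * (w - z)))%C).
  { apply (CInt_FTC (fun s => winding th rad (z + RtoC s * (w - z))%C)).
    - intros t Ht.
      assert (Hzt : open_sector th rad (z + RtoC t * (w - z))) by (apply open_sector_convex; auto).
      assert (Q := rdiff_comp _ _ t _ _ (cdiff_winding th rad _ Hth Hrad Hzt) (rdiff_segment z w t)).
      rewrite Cmult_0_l in Q. exact Q.
    - intros t _. apply pcont_const. }
  rewrite CInt_const in E.
  replace (z + RtoC 1 * (w - z))%C with w in E by ring.
  replace (z + RtoC 0 * (w - z))%C with z in E by ring.
  replace (winding th rad w) with ((winding th rad w - winding th rad z) + winding th rad z)%C by ring.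
  rewrite <- E; ring.
Qed.

Lemma Im_inv_mult (w d : C) : w <> RtoC 0 ->
  Im (/ w * d) = (Re w * Im d - Im w * Re d) / (Re w * Re w + Im w * Im w).
Proof.
  intros Hw. assert (Hp := proj1 (Cmod_gt_0 _) Hw). assert (Hs := Cmod_sqr w).
  destruct w as [x y]. unfold Re, Im in *; simpl in *. field. nra.
Qed.

(* The boundary turns around interior points counterclockwise, so every integrand has a
   positive imaginary part; the actual value [2 pi i] is not needed. *)
Lemma winding_neq_0 (th rad : R) : 0 < th < PI / 2 -> 0 < rad ->
  winding th rad (RtoC (rad / 2)) <> 0%C.
Proof.
  intros Hth Hrad K.
  assert (Hs : 0 < sin th) by (apply sin_gt_0; lra).
  assert (Hn : forall i t, 0 <= t <= 1 -> (gam th rad i t - RtoC (rad / 2))%C <> RtoC 0).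
  { intros i t Ht. apply gam_minus_neq; auto. apply open_sector_mid; auto. }
  assert (P : forall i, 0 < Im (CInt (fun t => / (gam th rad i t - RtoC (rad / 2)) * dgam th rad i t)%C)).
  { intros i.
    change (0 < RInt (fun t => Im (/ (gam th rad i t - RtoC (rad / 2)) * dgam th rad i t)) 0 1).
    apply RInt_gt_0; [lra | |].
    - intros t Ht. assert (Ht' : 0 <= t <= 1) by lra. rewrite Im_inv_mult by auto.
      assert (Hp := proj1 (Cmod_gt_0 _) (Hn i t Ht')).
      assert (Hq := Cmod_sqr (gam th rad i t - RtoC (rad / 2))).
      apply Rdiv_lt_0_compat; [| nra].
      destruct i as [| [| i]]; unfold gam, dgam, cis, Re, Im; simpl.
      + rewrite cos_neg, sin_neg. match goal with |- 0 < ?e =>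
          replace e with (rad * rad * sin th / 2) by field end.
        apply Rdiv_lt_0_compat; [repeat apply Rmult_lt_0_compat |]; lra.
      + set (u := th * (2 * t - 1)).
        match goal with |- 0 < ?e =>
          replace e with (2 * th * rad * rad * ((sin u * sin u + cos u * cos u) - cos u / 2)) by field end.
        assert (Hu := sin2_cos2 u). unfold Rsqr in Hu. rewrite Hu.
        assert (0 < 2 * th * rad * rad) by (repeat apply Rmult_lt_0_compat; lra).
        generalize (COS_bound u); nra.
      + match goal with |- 0 < ?e =>
          replace e with (rad * rad * sin th / 2) by field end.
        apply Rdiv_lt_0_compat; [repeat apply Rmult_lt_0_compat |]; lra.
    - intros t Ht.
      assert (Q : pcont (fun t => / (gam th rad i t - RtoC (rad / 2)) * dgam th rad i t)%C t).
      { apply pcont_mult; [| apply pcont_dgam].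
        apply pcont_inv; [apply pcont_minus; [apply pcont_gam | apply pcont_const] | auto]. }
      exact (proj2 Q). }
  apply (f_equal Im) in K. unfold winding, contour_int in K. rewrite !im_plus in K. simpl (Im 0) in K.
  generalize (P 0%nat) (P 1%nat) (P 2%nat); lra.
Qed.

(** * Finite sums *)

Fixpoint Csum (u : nat -> C) (n : nat) : C :=
  match n with O => 0%C | S k => (Csum u k + u k)%C end.

Lemma Cmod_Csum_le (u : nat -> C) (m : R) (n : nat) :
  (forall k, (k < n)%nat -> Cmod (u k) <= m) -> Cmod (Csum u n) <= INR n * m.
Proof.
  induction n as [| n IH]; intros H; [simpl; rewrite Cmod_0; lra |].
  rewrite S_INR. simpl Csum. eapply Rle_trans; [apply Cmod_triangle |].
  assert (H1 := IH ltac:(auto)). assert (H2 := H n ltac:(lia)). lra.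
Qed.

Lemma Csum_geometric (q : C) (n : nat) : ((1 - q) * Csum (fun k => q ^ k) n)%C = (1 - q ^ n)%C.
Proof. induction n as [| n IH]; simpl; [ring |]. rewrite Cmult_plus_distr_l, IH; ring. Qed.

Lemma Csum_plus_scal (a : C) (u v : nat -> C) (n : nat) : (forall k, (a * u k)%C = v k) ->
  (a * Csum u n)%C = Csum v n.
Proof. intros H; induction n as [| n IH]; simpl; [ring |]. rewrite <- IH, <- H; ring. Qed.

Lemma pcont_Csum (u : nat -> R -> C) (n : nat) (t : R) : (forall k, pcont (u k) t) ->
  pcont (fun s => Csum (fun k => u k s) n) t.
Proof. intros H; induction n as [| n IH]; simpl; [apply pcont_const | apply pcont_plus; auto]. Qed.

Lemma poly_le_Csum (d : nat) (u : nat -> C -> C) (n : nat) :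
  (forall k, (k < n)%nat -> poly_le d (u k)) -> poly_le d (fun z => Csum (fun k => u k z) n).
Proof.
  induction n as [| n IH]; intros H; simpl; [apply poly_le_const | apply poly_le_plus; auto].
Qed.

(** * The polynomial Cauchy kernel *)

(* Mean of [q^n, ..., q^(2n-1)]: a de la Vallee Poussin type mean, so that [vp] decays like
   [1 / (n |1 - q|)] although the powers of [q] do not decay where [|q| = 1]. *)
Definition vp (n : nat) (q : C) : C := (RtoC (/ INR n) * (q ^ n * Csum (fun k => q ^ k) n))%C.

(** The polynomial [(1 - vp n q) / (1 - q)], as the mean of the geometric sums
    [(1 - q^(n+k)) / (1 - q)]. *)
Definition vp_quot (n : nat) (q : C) : C :=
  (RtoC (/ INR n) * Csum (fun k => Csum (fun j => q ^ j) (n + k)) n)%C.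

Lemma one_minus_vp (n : nat) (q : C) : (1 <= n)%nat -> (1 - vp n q)%C = ((1 - q) * vp_quot n q)%C.
Proof.
  intros Hn. unfold vp, vp_quot.
  assert (HnR : INR n <> 0) by (apply not_0_INR; lia).
  assert (K : forall m, Csum (fun k => 1 - q ^ n * q ^ k)%C m = (RtoC (INR m) - q ^ n * Csum (fun k => q ^ k) m)%C).
  { induction m as [| m IH]; [simpl; ring |].
    rewrite S_INR, RtoC_plus. simpl Csum. rewrite IH; ring. }
  replace ((1 - q) * (RtoC (/ INR n) * Csum (fun k => Csum (fun j => q ^ j) (n + k)) n))%C with
    (RtoC (/ INR n) * ((1 - q) * Csum (fun k => Csum (fun j => q ^ j) (n + k)) n))%C by ring.
  rewrite (Csum_plus_scal (1 - q) _ (fun k => 1 - q ^ n * q ^ k)%C).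
  - rewrite K. replace (RtoC 1) with (RtoC (/ INR n) * RtoC (INR n))%C at 1.
    + ring.
    + rewrite <- RtoC_mult. f_equal. field; auto.
  - intros k. rewrite Csum_geometric, Cpow_add_r; auto.
Qed.

Lemma Cmod_pow_le_1 (q : C) (k : nat) : Cmod q <= 1 -> Cmod (q ^ k) <= 1.
Proof.
  intros Hq. rewrite Cmod_pow, <- (pow1 k). apply pow_incr; split; [apply Cmod_ge_0 | auto].
Qed.

Lemma Cmod_vp_le (n : nat) (q : C) : (1 <= n)%nat -> Cmod q <= 1 -> Cmod (vp n q) <= Cmod q ^ n.
Proof.
  intros Hn Hq. unfold vp. assert (HnR : 0 < INR n) by (apply lt_0_INR; lia).
  rewrite !Cmod_mult, Cmod_R, Rabs_pos_eq, Cmod_pow by (left; apply Rinv_0_lt_compat; auto).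
  assert (H : Cmod (Csum (fun k => q ^ k)%C n) <= INR n * 1)
    by (apply Cmod_Csum_le; intros; apply Cmod_pow_le_1; auto).
  assert (H0 : 0 <= Cmod q ^ n) by (apply pow_le, Cmod_ge_0).
  apply Rle_trans with (/ INR n * (Cmod q ^ n * (INR n * 1))).
  - apply Rmult_le_compat_l; [left; apply Rinv_0_lt_compat; auto |]. apply Rmult_le_compat_l; auto.
  - right; field; lra.
Qed.

(** Multiplication by [1 - q] telescopes the geometric sum to [1 - q^n], which leaves only the
    averaging factor [1 / n]. *)
Lemma Cmod_vp_decay (n : nat) (q : C) : (1 <= n)%nat -> Cmod q <= 1 ->
  INR n * (Cmod (1 - q) * Cmod (vp n q)) <= 2.
Proof.
  intros Hn Hq. assert (HnR : 0 < INR n) by (apply lt_0_INR; lia).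
  rewrite <- Cmod_mult.
  replace ((1 - q) * vp n q)%C with (RtoC (/ INR n) * (q ^ n * ((1 - q) * Csum (fun k => q ^ k) n)))%C
    by (unfold vp; ring).
  rewrite Csum_geometric, !Cmod_mult, Cmod_R, Rabs_pos_eq by (left; apply Rinv_0_lt_compat; auto).
  rewrite <- Rmult_assoc, Rinv_r, Rmult_1_l by lra.
  assert (H1 := Cmod_pow_le_1 q n Hq). assert (H2 := Cmod_minus_le 1 (q ^ n)). rewrite Cmod_1 in H2.
  assert (H3 := Cmod_ge_0 (q ^ n)). assert (H4 := Cmod_ge_0 (1 - q ^ n)). nra.
Qed.

Lemma Cmod_vp_quot_le (n : nat) (q : C) : (1 <= n)%nat -> Cmod q <= 1 -> Cmod (vp_quot n q) <= 2 * INR n.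
Proof.
  intros Hn Hq. unfold vp_quot. assert (HnR : 0 < INR n) by (apply lt_0_INR; lia).
  rewrite Cmod_mult, Cmod_R, Rabs_pos_eq by (left; apply Rinv_0_lt_compat; auto).
  assert (H : Cmod (Csum (fun k => Csum (fun j => q ^ j)%C (n + k)) n) <= INR n * (2 * INR n)).
  { apply (Cmod_Csum_le (fun k => Csum (fun j => q ^ j)%C (n + k))). intros k Hk.
    apply Rle_trans with (INR (n + k) * 1); [apply Cmod_Csum_le; intros; apply Cmod_pow_le_1; auto |].
    rewrite plus_INR. apply lt_INR in Hk. lra. }
  apply Rle_trans with (/ INR n * (INR n * (2 * INR n))).
  - apply Rmult_le_compat_l; auto. left; apply Rinv_0_lt_compat; auto.
  - right; field; lra.
Qed.

(* On the imaginary axis [|1 + x + x^2|^2 = 1 - t^2 + t^4], whence [|1 + x + x^2| <= 1]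
   on a half-disc: a polynomial substitute for [exp]. *)
Lemma quadratic_contraction (X : C) (m : R) : 0 <= m -> Cmod X <= / 2 -> Re X <= - m ->
  Cmod (1 + X + X * X) <= 1 - m / 2.
Proof.
  intros Hm HX HR. assert (HS := Cmod_sqr X). assert (H0 := Cmod_ge_0 X).
  assert (HR1 := re_le_Cmod X). apply Rabs_le_between in HR1.
  set (a := - Re X) in *. set (t := Im X) in *.
  assert (Ha : m <= a <= / 2) by (unfold a; lra).
  assert (Ht : t * t <= / 4).
  { assert (Cmod X * Cmod X <= / 2 * / 2) by (apply Rmult_le_compat; lra).
    assert (0 <= Re X * Re X) by nra. lra. }
  assert (E1 : Re (1 + X + X * X) = 1 - a + a * a - t * t) by (unfold a, t, Re, Im; simpl; ring).
  assert (E2 : Im (1 + X + X * X) = t - 2 * a * t) by (unfold a, t, Re, Im; simpl; ring).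
  apply Rle_trans with (1 - a / 2); [| lra].
  apply Cmod_le_of_sqr; [lra |]. rewrite E1, E2.
  assert (Ht0 : 0 <= t * t) by nra.
  assert (A : 0 <= 1 - a + a * a <= 1 - a / 2) by nra.
  assert (A2 : (1 - a + a * a) * (1 - a + a * a) <= (1 - a / 2) * (1 - a / 2))
    by (apply Rmult_le_compat; lra).
  assert (B : t * t * (1 + 2 * a - 2 * a * a - t * t) >= 0) by (apply Rle_ge, Rmult_le_pos; nra).
  nra.
Qed.

(* The conjugate of the outward unit normal of the squared sector at the square of the boundary
   point.  The squared sector is convex when [2 th <= PI / 2], hence [Re Xk <= 0] on the sector. *)
Definition nu (th : R) (i : nat) (t : R) : C :=
  match i with
  | O => (Ci * cis (2 * th))%C
  | 1%nat => cis (- (2 * (th * (2 * t - 1))))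
  | _ => (- Ci * cis (- (2 * th)))%C
  end.

(** The factor [1 / (4 rad^2)] makes [|Xk| <= 1 / 2] on the double sector, as
    [quadratic_contraction] requires. *)
Definition Xk (th rad : R) (i : nat) (t : R) (z : C) : C :=
  (RtoC (/ (4 * (rad * rad))) * nu th i t * (z * z - gam th rad i t * gam th rad i t))%C.

Definition qk (th rad : R) (i : nat) (t : R) (z : C) : C :=
  (1 + Xk th rad i t z + Xk th rad i t z * Xk th rad i t z)%C.

(* [(1 - vp n qk) / (zeta - z)] with the division carried out; see [ker_spec]. *)
Definition ker (th rad : R) (n i : nat) (t : R) (z : C) : C :=
  (RtoC (/ (4 * (rad * rad))) * nu th i t * (gam th rad i t + z) * (1 + Xk th rad i t z)
     * vp_quot n (qk th rad i t z))%C.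

Lemma ker_spec (th rad : R) (n i : nat) (t : R) (z : C) : (1 <= n)%nat ->
  (ker th rad n i t z * (gam th rad i t - z))%C = (1 - vp n (qk th rad i t z))%C.
Proof.
  intros Hn. rewrite one_minus_vp by auto. unfold ker.
  replace (1 - qk th rad i t z)%C with (- Xk th rad i t z * (1 + Xk th rad i t z))%C by (unfold qk; ring).
  unfold Xk at 2. ring.
Qed.

Lemma Cmod_nu (th : R) (i : nat) (t : R) : Cmod (nu th i t) = 1.
Proof.
  destruct i as [| [| i]]; unfold nu; rewrite ?Cmod_mult, ?Cmod_opp, ?Cmod_Ci, ?Cmod_cis; ring.
Qed.

Lemma pcont_nu (th : R) (i : nat) (t : R) : pcont (nu th i) t.
Proof.
  destruct i as [| [| i]]; try apply pcont_const. apply pcont_cis. auto_derive; auto.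
Qed.

Lemma pcont_ker (th rad : R) (n i : nat) (z : C) (t : R) : pcont (fun s => ker th rad n i s z) t.
Proof.
  assert (PX : pcont (fun s => Xk th rad i s z) t).
  { apply pcont_mult.
    - apply pcont_mult; [apply pcont_const | apply pcont_nu].
    - apply pcont_minus; [apply pcont_const | apply pcont_mult; apply pcont_gam]. }
  assert (PQ : pcont (fun s => qk th rad i s z) t).
  { apply pcont_plus; [apply pcont_plus; [apply pcont_const | auto] | apply pcont_mult; auto]. }
  apply pcont_mult; [apply pcont_mult; [apply pcont_mult; [apply pcont_mult |] |] |].
  - apply pcont_const.
  - apply pcont_nu.
  - apply pcont_plus; [apply pcont_gam | apply pcont_const].
  - apply pcont_plus; [apply pcont_const | auto].
  - apply pcont_mult; [apply pcont_const |].
    apply (pcont_Csum (fun k s => Csum (fun j => qk th rad i s z ^ j) (n + k))%C). intros k.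
    apply (pcont_Csum (fun j s => qk th rad i s z ^ j)%C). intros j. apply pcont_pow; auto.
Qed.

(** The quotient has degree below [2 n] in [qk], which has degree 4 in [z]; the two remaining
    factors add 3. *)
Lemma poly_le_ker (th rad : R) (n i : nat) (t : R) : poly_le (8 * n + 3) (ker th rad n i t).
Proof.
  assert (Pid : poly_le 1 (fun z => z)).
  { apply poly_le_ext with (fun z => 0 + 1 * z)%C; [intros; ring | apply poly_le_affine]. }
  assert (PX : poly_le 2 (Xk th rad i t)).
  { apply poly_le_scal. apply poly_le_minus; [apply (poly_le_mult 1 1); auto | apply poly_le_const]. }
  assert (PX1 : poly_le 2 (fun z => 1 + Xk th rad i t z)%C)
    by (apply poly_le_plus; [apply poly_le_const | auto]).
  assert (PQ : poly_le 4 (qk th rad i t)).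
  { apply poly_le_plus; [apply poly_le_mono with 2%nat; auto | apply (poly_le_mult 2 2); auto]. }
  apply poly_le_mono with (1 + 2 + 8 * n)%nat; [lia |].
  apply (poly_le_mult (1 + 2)); [apply (poly_le_mult 1 2); auto |].
  - apply poly_le_scal. apply poly_le_plus; [apply poly_le_const | auto].
  - apply poly_le_scal. apply (poly_le_Csum _ (fun k z => Csum (fun j => qk th rad i t z ^ j) (n + k))%C).
    intros k Hk. apply (poly_le_Csum _ (fun j z => qk th rad i t z ^ j)%C). intros j Hj.
    apply poly_le_mono with (j * 4)%nat; [lia |]. apply poly_le_pow; auto.
Qed.

(** [nu] turns [zeta^2] into a purely imaginary number on the edges and into [rad^2] on the arc;
    what remains is the equation of a half-plane bounding the squared sector. *)
Lemma Re_nu (th rad : R) (i : nat) (t : R) (z : C) :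
  Re (nu th i t * (z * z - gam th rad i t * gam th rad i t)) =
  match i with
  | O => - Im (cis (2 * th) * (z * z))
  | 1%nat => Re (cis (- (2 * (th * (2 * t - 1)))) * (z * z)) - rad * rad
  | _ => Im (cis (- (2 * th)) * (z * z))
  end.
Proof.
  destruct i as [| [| i]]; unfold nu, gam.
  - assert (E : (cis (2 * th) * (cis (- th) * cis (- th)))%C = 1%C).
    { rewrite <- !cis_plus, <- cis_0. f_equal; ring. }
    replace (Ci * cis (2 * th) * (z * z - RtoC (t * rad) * cis (- th) * (RtoC (t * rad) * cis (- th))))%C
      with (Ci * (cis (2 * th) * (z * z)) - Ci * (RtoC (t * rad) * RtoC (t * rad)) * (cis (2 * th) * (cis (- th) * cis (- th))))%C
      by ring.
    rewrite E. generalize (cis (2 * th) * (z * z))%C; intros w. unfold Re, Im; simpl; ring.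
  - set (u := th * (2 * t - 1)).
    assert (E : (cis (- (2 * u)) * (cis u * cis u))%C = 1%C).
    { rewrite <- !cis_plus, <- cis_0. f_equal; ring. }
    replace (cis (- (2 * u)) * (z * z - RtoC rad * cis u * (RtoC rad * cis u)))%C with
      (cis (- (2 * u)) * (z * z) - RtoC rad * RtoC rad * (cis (- (2 * u)) * (cis u * cis u)))%C by ring.
    rewrite E. generalize (cis (- (2 * u)) * (z * z))%C; intros w. unfold Re, Im; simpl; ring.
  - assert (E : (cis (- (2 * th)) * (cis th * cis th))%C = 1%C).
    { rewrite <- !cis_plus, <- cis_0. f_equal; ring. }
    replace (- Ci * cis (- (2 * th)) * (z * z - RtoC ((1 - t) * rad) * cis th * (RtoC ((1 - t) * rad) * cis th)))%C
      with (- Ci * (cis (- (2 * th)) * (z * z)) + Ci * (RtoC ((1 - t) * rad) * RtoC ((1 - t) * rad)) * (cis (- (2 * th)) * (cis th * cis th)))%C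
      by ring.
    rewrite E. generalize (cis (- (2 * th)) * (z * z))%C; intros w. unfold Re, Im; simpl; ring.
Qed.

(** Signed distance at least [m] of [z^2] from the three sides of the squared sector. Depending on
    [z^2] only, it treats the two lobes alike. *)
Definition margin (th rad m : R) (z : C) : Prop :=
  m <= Im (cis (2 * th) * (z * z)) /\ Im (cis (- (2 * th)) * (z * z)) <= - m /\
  Cmod z * Cmod z <= rad * rad - m.

Lemma margin_Re_nu (th rad m : R) (i : nat) (t : R) (z : C) : margin th rad m z ->
  Re (nu th i t * (z * z - gam th rad i t * gam th rad i t)) <= - m.
Proof.
  intros (H1 & H2 & H3). rewrite Re_nu. destruct i as [| [| i]]; try lra.
  assert (K := Re_le_Cmod (cis (- (2 * (th * (2 * t - 1)))) * (z * z))).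
  rewrite !Cmod_mult, Cmod_cis in K. lra.
Qed.

Lemma Im_sqr_cis (th : R) (z : C) : Im (cis (2 * th) * (z * z)) =
  2 * (Re z * cos th - Im z * sin th) * (Re z * sin th + Im z * cos th).
Proof.
  unfold cis, Re, Im; simpl. rewrite cos_2a, sin_2a. ring.
Qed.

Lemma sector_quarter (th rad : R) (z : C) : 0 < th <= PI / 4 -> sector th rad z ->
  Rabs (Im z) <= Re z /\ Rabs (Im z) * sin th <= Re z * cos th.
Proof.
  intros Hth [H _]. assert (HPI := PI_RGT_0).
  assert (Hc : 0 < cos th) by (apply cos_gt_0; lra).
  assert (Hs : 0 < sin th) by (apply sin_gt_0; lra).
  assert (Hsc : sin th <= cos th).
  { rewrite <- sin_shift. apply sin_incr_1; lra. }
  assert (H0 := Rabs_pos (Im z)).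
  assert (Hx : 0 <= Re z).
  { apply Rnot_lt_le; intros K. nra. }
  assert (H1 : Rabs (Im z) <= Re z).
  { apply Rmult_le_reg_r with (cos th); auto. nra. }
  split; auto. nra.
Qed.

(** Convexity of the squared sector enters here: by [Im_sqr_cis] each edge condition is the product
    of the linear form of an edge of the sector and of a form that is nonnegative because
    [th <= PI / 4]. *)
Lemma sector_margin_0 (th rad : R) (z : C) : 0 < th <= PI / 4 -> 0 < rad -> sector th rad z ->
  margin th rad 0 z.
Proof.
  intros Hth Hrad Hz. destruct (sector_quarter th rad z Hth Hz) as [H1 H2]. destruct Hz as [H3 H4].
  assert (HPI := PI_RGT_0).
  assert (Hc : 0 < cos th) by (apply cos_gt_0; lra).
  assert (Hs : 0 < sin th) by (apply sin_gt_0; lra).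
  assert (K1 : - (Rabs (Im z) * sin th) <= Im z * sin th <= Rabs (Im z) * sin th).
  { unfold Rabs; destruct (Rcase_abs (Im z)); nra. }
  assert (K2 : - (Rabs (Im z) * cos th) <= Im z * cos th <= Rabs (Im z) * cos th).
  { unfold Rabs; destruct (Rcase_abs (Im z)); nra. }
  assert (H0 := Cmod_ge_0 z).
  repeat split.
  - rewrite Im_sqr_cis. apply Rmult_le_pos; lra.
  - replace (- (2 * th)) with (2 * - th) by ring. rewrite Im_sqr_cis, cos_neg, sin_neg. nra.
  - nra.
Qed.

Lemma margin_opp (th rad m : R) (z : C) : margin th rad m (- z) -> margin th rad m z.
Proof.
  unfold margin. replace (- z * - z)%C with (z * z)%C by ring. rewrite Cmod_opp; auto.
Qed.

Lemma Xk_bounds (th rad m : R) (i : nat) (t : R) (z : C) : 0 < th < PI / 2 -> 0 < rad -> 0 <= t <= 1 ->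
  0 <= m -> margin th rad m z ->
  Cmod (Xk th rad i t z) <= / 2 /\ Re (Xk th rad i t z) <= - (m / (4 * (rad * rad))) /\
  Cmod (Xk th rad i t z) = / (4 * (rad * rad)) * (Cmod (gam th rad i t - z) * Cmod (gam th rad i t + z)).
Proof.
  intros Hth Hrad Ht Hm Hz.
  assert (He : 0 < / (4 * (rad * rad))) by (apply Rinv_0_lt_compat; nra).
  assert (HX : Cmod (Xk th rad i t z) =
    / (4 * (rad * rad)) * Cmod (z * z - gam th rad i t * gam th rad i t)).
  { unfold Xk. rewrite !Cmod_mult, Cmod_R, Cmod_nu, Rabs_pos_eq; lra. }
  assert (Hg : Cmod (gam th rad i t) <= rad) by (apply gam_sector; auto).
  assert (Hz2 : Cmod z * Cmod z <= rad * rad) by (destruct Hz as (_ & _ & H); lra).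
  repeat split.
  - rewrite HX. apply Rle_trans with (/ (4 * (rad * rad)) * (2 * (rad * rad))).
    + apply Rmult_le_compat_l; [lra |]. eapply Rle_trans; [apply Cmod_minus_le |].
      rewrite !Cmod_mult. assert (H0 := Cmod_ge_0 (gam th rad i t)).
      assert (Cmod (gam th rad i t) * Cmod (gam th rad i t) <= rad * rad)
        by (apply Rmult_le_compat; auto). lra.
    + right; field; lra.
  - unfold Xk. rewrite <- Cmult_assoc, re_scal_l.
    assert (K := margin_Re_nu th rad m i t z Hz). unfold Rdiv. rewrite (Rmult_comm m).
    rewrite <- Ropp_mult_distr_r_reverse. apply Rmult_le_compat_l; lra.
  - rewrite HX, <- Cmod_mult. f_equal.
    replace (z * z - gam th rad i t * gam th rad i t)%C with
      (- ((gam th rad i t - z) * (gam th rad i t + z)))%C by ring.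
    apply Cmod_opp.
Qed.

(** Two directions of the sector differ by at most [PI / 2]. In the kernel estimate this gives
    [|g - y| <= |g + y|] and [|y| <= |g + y|]. *)
Lemma Re_sector_mult (th rad : R) (z w : C) : 0 < th <= PI / 4 -> sector th rad z -> sector th rad w ->
  0 <= Re z * Re w + Im z * Im w.
Proof.
  intros Hth Hz Hw. destruct (sector_quarter th rad z Hth Hz) as [H1 _].
  destruct (sector_quarter th rad w Hth Hw) as [H2 _].
  assert (K : Rabs (Im z * Im w) <= Re z * Re w).
  { rewrite Rabs_mult. apply Rmult_le_compat; auto using Rabs_pos. }
  apply Rabs_le_between in K. lra.
Qed.

(** The kernel is compared with the Cauchy kernel at [zs], which is [z] pushed across its supporting
    line by the local scale [rho]. That is the scale at which [n |Xk|] has order 1, that is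
    [|zeta - z| |zeta + z|] has order [1 / n]. The bound is expressed through [y], the
    representative of [z] in the lobe where the contour runs, so that one chord estimate serves both
    lobes. *)
Lemma ker_estimate (th rad : R) (n i : nat) (t : R) (z y e : C) : 0 < th <= PI / 4 -> 0 < rad ->
  (1 <= n)%nat -> 0 <= t <= 1 -> sector th rad y -> z = y \/ z = (- y)%C -> Cmod e = 1 ->
  (forall w, sector th rad w -> Re (e * (w - z)) <= 0) ->
  let eps := / (4 * (rad * rad)) in
  let rho := / (INR n * Cmod z + sqrt (INR n)) in
  let zs := (z + RtoC rho * Cconj e)%C in
  0 < rho /\ (forall w, sector th rad w -> Re (e * (w - zs)) <= - rho) /\
  rho <= Cmod (gam th rad i t - zs) /\
  Cmod (ker th rad n i t z - / (gam th rad i t - zs)) <=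
    (2 * (6 * eps + 1) + 2 * (2 + 12 / eps)) *
    (rho / (rho * rho + Cmod (gam th rad i t - y) * Cmod (gam th rad i t - y))).
Proof.
  intros Hth Hrad Hn Ht Hy Hzy He Hsup eps rho zs. assert (HPI := PI_RGT_0).
  assert (Hth2 : 0 < th < PI / 2) by lra.
  set (N := INR n) in *. set (g := gam th rad i t).
  assert (HN : 1 <= N) by (apply (le_INR 1); auto).
  assert (HsN : sqrt N * sqrt N = N) by (apply sqrt_sqrt; lra).
  assert (Hs1 : 1 <= sqrt N) by (rewrite <- sqrt_1; apply sqrt_le_1; lra).
  assert (Hr0 := Cmod_ge_0 z). set (r := Cmod z) in *.
  assert (Hden : 0 < N * r + sqrt N) by nra.
  assert (Hrho : 0 < rho) by (apply Rinv_0_lt_compat; auto).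
  assert (Hrho1 : rho * (N * r + sqrt N) = 1) by (unfold rho; apply Rinv_l; lra).
  assert (Heps : 0 < eps) by (apply Rinv_0_lt_compat; nra).
  assert (Hee : (e * Cconj e)%C = 1%C).
  { rewrite <- Cmod2_conj, He. apply injective_projections; simpl; ring. }
  assert (Hsup' : forall w, sector th rad w -> Re (e * (w - zs)) <= - rho).
  { intros w Hw. replace (e * (w - zs))%C with (e * (w - z) - RtoC rho * (e * Cconj e))%C
      by (unfold zs; ring).
    rewrite Hee. assert (K := Hsup w Hw).
    replace (Re (e * (w - z) - RtoC rho * 1)) with (Re (e * (w - z)) - rho) by (unfold Re; simpl; ring).
    lra. }
  assert (Hg : sector th rad g) by (apply gam_sector; auto).
  assert (Hzs : rho <= Cmod (g - zs)).
  { assert (K := Hsup' g Hg). assert (K2 := re_le_Cmod (e * (g - zs))).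
    rewrite Cmod_mult, He in K2. apply Rabs_le_between in K2. lra. }
  split; auto. split; auto. split; auto.
  assert (Hm : margin th rad 0 z).
  { destruct Hzy as [-> | ->]; [apply sector_margin_0; auto |].
    apply margin_opp. replace (- - y)%C with y by ring. apply sector_margin_0; auto. }
  destruct (Xk_bounds th rad 0 i t z Hth2 Hrad Ht (Rle_refl 0) Hm) as (X1 & X2 & X3).
  fold g eps in X3. replace (- (0 / (4 * (rad * rad)))) with (- 0) in X2 by (field; lra).
  assert (Hq := quadratic_contraction _ 0 (Rle_refl 0) X1 X2).
  replace (1 - 0 / 2) with 1 in Hq by field. fold (qk th rad i t z) in Hq.
  assert (S1 := Cmod_vp_decay n _ Hn Hq). fold N in S1.
  assert (S2 := Cmod_vp_quot_le n _ Hn Hq). fold N in S2.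
  assert (HK := ker_spec th rad n i t z Hn). fold g in HK.
  set (S := vp n (qk th rad i t z)) in *.
  set (X := Xk th rad i t z) in *.
  assert (S3 : Cmod (1 - qk th rad i t z) >= Cmod X / 2).
  { replace (1 - qk th rad i t z)%C with (- (X * (1 + X)))%C by (unfold qk; fold X; ring).
    rewrite Cmod_opp, Cmod_mult.
    assert (K := Cmod_triangle_rev 1 (- X)). rewrite Cmod_1, Cmod_opp in K.
    replace (1 - - X)%C with (1 + X)%C in K by ring.
    assert (H0 := Cmod_ge_0 X). nra. }
  set (A := Cmod (g - z)) in *. set (B := Cmod (g + z)) in *.
  assert (HA0 : 0 <= A) by apply Cmod_ge_0. assert (HB0 : 0 <= B) by apply Cmod_ge_0.
  assert (HS0 := Cmod_ge_0 S).
  (* The decay of the mean combined with [|1 - q| >= |X| / 2]. *)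
  assert (S4 : N * eps * (A * B) * Cmod S <= 4).
  { assert (N * (Cmod X / 2 * Cmod S) <= N * (Cmod (1 - qk th rad i t z) * Cmod S)).
    { apply Rmult_le_compat_l; [lra |]. apply Rmult_le_compat_r; lra. }
    rewrite X3 in H. nra. }
  assert (Kb : Cmod (ker th rad n i t z) <= 3 * eps * (N * B)).
  { unfold ker. fold g X eps. rewrite !Cmod_mult, Cmod_R, Cmod_nu, Rabs_pos_eq by lra.
    fold B. assert (Q := Cmod_triangle 1 X). rewrite Cmod_1 in Q.
    assert (Q1 := Cmod_ge_0 (1 + X)). assert (Q2 := Cmod_ge_0 (vp_quot n (qk th rad i t z))).
    assert (Q3 : Cmod (1 + X) * Cmod (vp_quot n (qk th rad i t z)) <= 3 / 2 * (2 * N))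
      by (apply Rmult_le_compat; lra).
    rewrite Rmult_1_r, Rmult_assoc.
    apply Rle_trans with (eps * B * (3 / 2 * (2 * N))); [| right; field].
    apply Rmult_le_compat_l; [apply Rmult_le_pos; lra | auto]. }
  set (D := Cmod (g - y)) in *. set (E := Cmod (g + y)).
  assert (HD0 : 0 <= D) by apply Cmod_ge_0.
  assert (Hry : Cmod y = r).
  { unfold r. destruct Hzy as [-> | ->]; [auto | rewrite Cmod_opp; auto]. }
  assert (Hpos := Re_sector_mult th rad g y Hth Hg Hy).
  assert (HED : D <= E).
  { apply Cmod_ge_of_sqr. unfold D. rewrite Cmod_sqr.
    replace (Re (g - y)) with (Re g - Re y) by (unfold Re; simpl; ring).
    replace (Im (g - y)) with (Im g - Im y) by (unfold Im; simpl; ring).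
    rewrite re_plus, im_plus. nra. }
  assert (HEr : r <= E).
  { rewrite <- Hry. apply Cmod_ge_of_sqr. rewrite Cmod_sqr, re_plus, im_plus. nra. }
  assert (HAB : D <= A /\ A * B = D * E /\ B <= 2 * r + D).
  { unfold A, B. destruct Hzy as [-> | ->].
    - fold D E. split; [lra |]. split; [ring |].
      unfold E. replace (g + y)%C with (g - y + 2 * y)%C by ring.
      eapply Rle_trans; [apply Cmod_triangle |]. rewrite Cmod_mult, Cmod_R, Rabs_pos_eq, Hry by lra.
      fold D. lra.
    - replace (g - - y)%C with (g + y)%C by ring. replace (g + - y)%C with (g - y)%C by ring.
      fold D E. split; [lra |]. split; [ring | lra]. }
  destruct HAB as (HDA & HAB & HBr).
  assert (HNs : forall x, N * x = sqrt N * (sqrt N * x)) by (intros x; rewrite <- HsN at 1; ring).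
  assert (HNrho : N * rho <= sqrt N).
  { assert (rho * sqrt N <= 1) by nra. rewrite HNs. nra. }
  set (C1 := 2 * (6 * eps + 1)). set (C2 := 2 * (2 + 12 / eps)).
  assert (H12 : 0 < 12 / eps) by (apply Rdiv_lt_0_compat; lra).
  assert (HQ : 0 < rho * rho + D * D) by nra.
  assert (HQ2 : 0 < rho / (rho * rho + D * D)) by (apply Rdiv_lt_0_compat; auto).
  destruct (Rle_dec D rho) as [Hnear | Hfar].
  (* Within distance [rho] both kernels are separately at most a constant times [1 / rho], which is
     the height of the Poisson kernel there. *)
  - apply Rle_trans with (C1 * (rho / (rho * rho + D * D))).
    2:{ apply Rmult_le_compat_r; [lra |]. unfold C2; lra. }
    apply Rle_trans with ((6 * eps + 1) * / rho).
    + eapply Rle_trans; [apply Cmod_minus_le |].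
      rewrite Cmod_inv by (apply Cmod_gt_0; lra).
      assert (I1 : / Cmod (g - zs) <= / rho) by (apply Rinv_le_contravar; lra).
      assert (I2 : N * B <= 2 * / rho).
      { unfold rho at 1. rewrite Rinv_inv. nra. }
      nra.
    + unfold C1. replace (2 * (6 * eps + 1) * (rho / (rho * rho + D * D))) with
        ((6 * eps + 1) * (2 * rho / (rho * rho + D * D))) by (field; lra).
      apply Rmult_le_compat_l; [lra |].
      apply Rmult_le_reg_r with (rho * (rho * rho + D * D)); [apply Rmult_lt_0_compat; auto |].
      field_simplify; nra.
  - apply Rnot_le_lt in Hfar.
    apply Rle_trans with (C2 * (rho / (rho * rho + D * D))).
    2:{ apply Rmult_le_compat_r; [lra |]. unfold C1; lra. }
    (* If [r sqrt N >= 1], the term [N r] dominates in [1 / rho] and [r <= E]. Otherwise [rho]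
       exceeds [1 / (2 sqrt N)], and [rho < D <= E]. *)
    assert (HE3 : 1 <= 3 * rho * (N * E)).
    { rewrite <- Hrho1. replace (3 * rho * (N * E)) with (rho * (3 * (N * E))) by ring.
      apply Rmult_le_compat_l; [lra |].
      assert (N * r <= N * E) by (apply Rmult_le_compat_l; lra).
      assert (sqrt N <= 2 * (N * E)); [| lra].
      destruct (Rle_dec 1 (r * sqrt N)) as [L | L].
      - assert (sqrt N <= N * r) by (rewrite HNs; nra). lra.
      - assert (N * r < sqrt N) by (rewrite HNs; nra).
        assert (1 < 2 * (rho * sqrt N)) by nra.
        assert (sqrt N <= 2 * (N * rho)) by (rewrite HNs; nra).
        assert (N * rho <= N * E) by (apply Rmult_le_compat_l; lra). lra. }
    assert (HAp : 0 < A) by lra.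
    assert (Hgz : (g - z)%C <> RtoC 0) by (apply Cmod_gt_0; auto).
    assert (Hgs : (g - zs)%C <> RtoC 0) by (apply Cmod_gt_0; lra).
    assert (HA2 : A <= 2 * Cmod (g - zs)).
    { unfold A. replace (g - z)%C with ((g - zs) + RtoC rho * Cconj e)%C by (unfold zs; ring).
      eapply Rle_trans; [apply Cmod_triangle |].
      rewrite Cmod_mult, Cmod_R, Cmod_conj, He, Rabs_pos_eq by lra. lra. }
    (* Two errors of size [rho / D^2]: the displacement from [z] to [zs], and the part [S / (g - z)]
       by which the kernel misses the Cauchy kernel at [z]. *)
    assert (Ek : (ker th rad n i t z - / (g - zs))%C =
      (- (RtoC rho * Cconj e) / ((g - z) * (g - zs)) - S / (g - z))%C).
    { replace (ker th rad n i t z) with ((1 - S) / (g - z))%C by (rewrite <- HK; field; auto).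
      unfold zs in *. field. auto. }
    rewrite Ek.
    eapply Rle_trans; [apply Cmod_minus_le |].
    rewrite !Cmod_div, Cmod_opp, !Cmod_mult, Cmod_R, Cmod_conj, He, Rabs_pos_eq by (try apply Cmult_neq_0; auto; lra).
    fold A. set (Z := Cmod (g - zs)) in *.
    assert (HDp : 0 < D) by lra.
    assert (B1 : rho * 1 / (A * Z) <= 2 * rho / (D * D)).
    { apply Rle_div_l; [apply Rmult_lt_0_compat; lra |].
      replace (2 * rho / (D * D) * (A * Z)) with (rho * (A * (2 * Z)) / (D * D)) by (field; lra).
      rewrite Rmult_1_r. apply Rle_div_r; [nra |]. apply Rmult_le_compat_l; [lra |]. apply Rmult_le_compat; lra. }
    assert (B2 : Cmod S / A <= 12 / eps * rho / (D * D)).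
    { apply Rle_div_l; auto.
      replace (12 / eps * rho / (D * D) * A) with (12 * rho * A / (eps * (D * D))) by (field; lra).
      apply Rle_div_r; [apply Rmult_lt_0_compat; nra |].
      assert (T1 : N * eps * (D * E) * Cmod S <= 4) by (rewrite <- HAB; auto).
      assert (T2 : Cmod S * eps * D * 1 <= Cmod S * eps * D * (3 * rho * (N * E))).
      { apply Rmult_le_compat_l; auto. apply Rmult_le_pos; [apply Rmult_le_pos; lra | lra]. }
      assert (T3 : Cmod S * eps * D <= 12 * rho) by nra.
      replace (Cmod S * (eps * (D * D))) with (Cmod S * eps * D * D) by ring.
      apply Rle_trans with (12 * rho * D); [apply Rmult_le_compat_r; lra |].
      apply Rmult_le_compat_l; lra. }
    apply Rle_trans with ((2 + 12 / eps) * (rho / (D * D))).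
    + replace ((2 + 12 / eps) * (rho / (D * D))) with (2 * rho / (D * D) + 12 / eps * rho / (D * D))
        by (field; lra). lra.
    + unfold C2. rewrite (Rmult_comm 2), Rmult_assoc. apply Rmult_le_compat_l; [lra |].
      replace (2 * (rho / (rho * rho + D * D))) with (rho * (2 / (rho * rho + D * D))) by (field; lra).
      unfold Rdiv at 1. apply Rmult_le_compat_l; [lra |].
      apply Rle_div_r; auto. apply Rmult_le_reg_l with (D * D); [nra |].
      rewrite <- Rmult_assoc, Rinv_r by nra. nra.
Qed.

(** The arctangent bounds the mass whatever the width [rho]; since [rho] is the only quantity that
    varies with the degree, this is the source of uniformity in [n]. *)
Lemma RInt_poisson_le (rho k t0 : R) : 0 < rho -> 0 < k ->
  ex_RInt (fun t => rho / (rho * rho + (k * (t - t0)) * (k * (t - t0)))) 0 1 /\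
  RInt (fun t => rho / (rho * rho + (k * (t - t0)) * (k * (t - t0)))) 0 1 <= PI / k.
Proof.
  intros Hrho Hk.
  assert (HD : is_RInt (fun t => rho / (rho * rho + (k * (t - t0)) * (k * (t - t0)))) 0 1
    (minus (/ k * atan (k * (1 - t0) / rho)) (/ k * atan (k * (0 - t0) / rho)))).
  { apply (is_RInt_derive (V := R_CompleteNormedModule) (fun t => / k * atan (k * (t - t0) / rho))).
    - intros t _. auto_derive; auto. field. repeat split; try nra.
      assert (0 <= (k * (t + - t0)) * (k * (t + - t0))) by apply Rle_0_sqr. nra.
    - intros t _. apply (ex_derive_continuous (V := R_NormedModule)). auto_derive.
      assert (0 <= (k * (t + - t0)) * (k * (t + - t0))) by apply Rle_0_sqr. nra. }
  split; [eexists; exact HD |].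
  rewrite (is_RInt_unique _ _ _ _ HD). unfold minus, plus, opp; simpl.
  assert (A1 := atan_bound (k * (1 - t0) / rho)). assert (A2 := atan_bound (k * (0 - t0) / rho)).
  assert (Hk' : 0 < / k) by (apply Rinv_0_lt_compat; auto).
  unfold Rdiv at 3. rewrite (Rmult_comm PI). rewrite <- Ropp_mult_distr_r_reverse, <- Rmult_plus_distr_l.
  apply Rmult_le_compat_l; lra.
Qed.

(** * The approximating operator *)

Definition Lop (th rad : R) (n : nat) (v : C -> C) (z : C) : C :=
  contour_int (fun i t => v (gam th rad i t) * ker th rad n i t z * dgam th rad i t)%C.

(** Holomorphy on a convex neighbourhood of the closed sector. The constants below do not depend on
    [W], so the neighbourhood may be as thin as desired. *)
Definition holo_near (th rad : R) (W : C -> Prop) (v : C -> C) : Prop :=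
  open_set_C W /\ convex_set W /\ (forall z, sector th rad z -> W z) /\
  (forall z, W z -> exists l, cdiff v z l).

Lemma pcont_v_gam (th rad : R) (W : C -> Prop) (v : C -> C) (i : nat) (t : R) :
  0 < th < PI / 2 -> 0 < rad -> holo_near th rad W v -> 0 <= t <= 1 ->
  pcont (fun s => v (gam th rad i s)) t.
Proof.
  intros Hth Hrad (_ & _ & HW & Hv) Ht. apply (pcont_comp v); [apply pcont_gam |].
  destruct (Hv _ (HW _ (gam_sector th rad i t Hth Hrad Ht))) as [m Hm].
  exact (cdiff_cont_at _ _ _ Hm).
Qed.

(** The Cauchy kernel at the outer point [zs] integrates to 0 against [v], so it may be subtracted.
    The difference is dominated by a Poisson kernel, of bounded mass along each piece by the chord
    estimate. *)
Lemma Lop_support_bound (th rad : R) (n : nat) (W : C -> Prop) (v : C -> C) (M : R) (z y e : C) :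
  0 < th <= PI / 4 -> 0 < rad -> (1 <= n)%nat -> holo_near th rad W v ->
  (forall w, sector th rad w -> Cmod (v w) <= M) ->
  sector th rad y -> z = y \/ z = (- y)%C -> Cmod e = 1 ->
  (forall w, sector th rad w -> Re (e * (w - z)) <= 0) ->
  let eps := / (4 * (rad * rad)) in
  Cmod (Lop th rad n v z) <=
    6 * (M * (2 * (6 * eps + 1) + 2 * (2 + 12 / eps)) * (2 * rad) * (PI / (th * rad / 2))).
Proof.
  intros Hth Hrad Hn Hv HM Hy Hzy He Hsup eps. assert (HPI := PI_RGT_0).
  assert (Hth2 : 0 < th < PI / 2) by lra.
  set (C0 := 2 * (6 * eps + 1) + 2 * (2 + 12 / eps)).
  assert (Heps : 0 < eps) by (apply Rinv_0_lt_compat; nra).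
  assert (HC0 : 0 < C0).
  { unfold C0. assert (0 < 12 / eps) by (apply Rdiv_lt_0_compat; lra). lra. }
  assert (HM0 : 0 <= M) by (eapply Rle_trans; [apply Cmod_ge_0 | apply (HM y Hy)]).
  set (rho := / (INR n * Cmod z + sqrt (INR n))).
  set (zs := (z + RtoC rho * Cconj e)%C).
  assert (HE := fun i t Ht => ker_estimate th rad n i t z y e Hth Hrad Hn Ht Hy Hzy He Hsup).
  cbv zeta in HE. fold eps rho zs C0 in HE.
  destruct (HE 0%nat 0 ltac:(lra)) as (Hrho & Hzs & _ & _).
  assert (Hgs : forall i t, 0 <= t <= 1 -> (gam th rad i t - zs)%C <> RtoC 0).
  { intros i t Ht. apply Cmod_gt_0. destruct (HE i t Ht) as (_ & _ & K & _). lra. }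
  assert (Hz0 : contour_int (fun i t => v (gam th rad i t) * / (gam th rad i t - zs) * dgam th rad i t)%C = 0%C).
  { destruct Hv as (V1 & V2 & V3 & V4). apply (outside_zero th rad W v zs e rho); auto. }
  assert (Hpv := fun i t => pcont_v_gam th rad W v i t Hth2 Hrad Hv).
  assert (Hpk := pcont_ker th rad n).
  assert (EL : Lop th rad n v z =
    contour_int (fun i t => v (gam th rad i t) * (ker th rad n i t z - / (gam th rad i t - zs)) * dgam th rad i t)%C).
  { unfold Lop. transitivity (contour_int (fun i t => v (gam th rad i t) * ker th rad n i t z * dgam th rad i t)%C -
      contour_int (fun i t => v (gam th rad i t) * / (gam th rad i t - zs) * dgam th rad i t)%C)%C.
    - rewrite Hz0; ring.
    - rewrite <- CI_minus by (intros i; pc; auto). apply CI_ext; intros; ring. }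
  rewrite EL.
  assert (Hk : 0 < th * rad / 2) by nra.
  set (k := th * rad / 2) in *.
  assert (Hchord : forall i, exists t0, forall t, 0 <= t <= 1 -> k * Rabs (t - t0) <= Cmod (gam th rad i t - y))
    by (intros i; apply gam_chord; auto).
  destruct (exists_choice_function _ _ _ Hchord) as [t0 Ht0].
  apply (CI_bound_fun _ (fun i t => (M * C0 * (2 * rad)) *
    (rho / (rho * rho + (k * (t - t0 i)) * (k * (t - t0 i)))))).
  - intros i; pc; auto.
  - intros i. destruct (RInt_poisson_le rho k (t0 i) Hrho Hk) as [I1 I2]. split.
    + apply (ex_RInt_scal (V := R_NormedModule)); auto.
    + rewrite (RInt_scal (V := R_CompleteNormedModule)) by auto.
      unfold scal; simpl; unfold mult; simpl. apply Rmult_le_compat_l; auto.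
      apply Rmult_le_pos; [apply Rmult_le_pos; lra | lra].
  - intros i t Ht. rewrite !Cmod_mult.
    destruct (HE i t Ht) as (_ & _ & _ & K).
    assert (K1 := HM _ (gam_sector th rad i t Hth2 Hrad Ht)).
    assert (K2 := Cmod_dgam th rad i t Hth Hrad).
    assert (K3 := Ht0 i t Ht).
    set (D := Cmod (gam th rad i t - y)) in *.
    assert (HD : (k * (t - t0 i)) * (k * (t - t0 i)) <= D * D).
    { replace ((k * (t - t0 i)) * (k * (t - t0 i))) with ((k * Rabs (t - t0 i)) * (k * Rabs (t - t0 i))).
      - assert (0 <= k * Rabs (t - t0 i)) by (apply Rmult_le_pos; [lra | apply Rabs_pos]).
        apply Rmult_le_compat; auto.
      - unfold Rabs; destruct (Rcase_abs (t - t0 i)); ring. }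
    assert (HQ : rho / (rho * rho + D * D) <= rho / (rho * rho + (k * (t - t0 i)) * (k * (t - t0 i)))).
    { assert (0 <= (k * (t - t0 i)) * (k * (t - t0 i))) by apply Rle_0_sqr.
      apply Rmult_le_compat_l; [lra |]. apply Rinv_le_contravar; nra. }
    assert (HQ0 : 0 < rho / (rho * rho + D * D)).
    { apply Rdiv_lt_0_compat; auto. assert (0 <= D * D) by apply Rle_0_sqr. nra. }
    set (P := rho / (rho * rho + (k * (t - t0 i)) * (k * (t - t0 i)))) in *.
    replace (M * C0 * (2 * rad) * P) with (M * (C0 * P) * (2 * rad)) by ring.
    apply Rmult_le_compat; auto using Cmod_ge_0.
    + apply Rmult_le_pos; apply Cmod_ge_0.
    + apply Rmult_le_compat; auto using Cmod_ge_0.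
      eapply Rle_trans; [exact K |]. apply Rmult_le_compat_l; lra.
Qed.

Lemma CInt_sum_n (u : nat -> R -> C) (n : nat) : (forall j, pcont01 (u j)) ->
  CInt (fun t => sum_n (fun j => u j t) n) = sum_n (fun j => CInt (u j)) n /\
  pcont01 (fun t => sum_n (fun j => u j t) n).
Proof.
  intros H. induction n as [| n [IH1 IH2]].
  - split.
    + rewrite sum_n_C_0. apply CInt_ext; intros; rewrite sum_n_C_0; auto.
    + intros t Ht. apply pcont_ext with (u 0%nat); [intros; rewrite sum_n_C_0; auto | apply H; auto].
  - split.
    + rewrite sum_n_C_S, <- IH1. rewrite <- CInt_plus by auto.
      apply CInt_ext; intros; rewrite sum_n_C_S; auto.
    + intros t Ht. apply pcont_ext with (fun s => sum_n (fun j => u j s) n + u (S n) s)%C.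
      * intros; rewrite sum_n_C_S; auto.
      * apply pcont_plus; [apply IH2; auto | apply H; auto].
Qed.

(** Interpolation at the nodes [0] to [N] expresses the integral through integrals of finitely many
    values, so the dependence of the coefficients on [t] never has to be studied. *)
Lemma poly_le_CInt (N : nat) (F : R -> C -> C) : (forall t, poly_le N (F t)) ->
  (forall z, pcont01 (fun t => F t z)) -> poly_le N (fun z => CInt (fun t => F t z)).
Proof.
  intros HF Hc.
  destruct (poly_le_interpolation (fun j => RtoC (INR j)) N) as (l & Hl & HI).
  { intros i j Hij K. apply Hij, INR_eq. exact (f_equal fst K). }
  apply poly_le_ext with (fun z => sum_n (fun j => CInt (fun t => F t (RtoC (INR j))) * l j z)%C N).
  - intros z. symmetry.
    rewrite (CInt_ext _ (fun t => sum_n (fun j => F t (RtoC (INR j)) * l j z)%C N))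
      by (intros; apply HI; auto).
    destruct (CInt_sum_n (fun j t => F t (RtoC (INR j)) * l j z)%C N) as [E _].
    { intros j t Ht. apply pcont_mult; [apply Hc; auto | apply pcont_const]. }
    rewrite E. apply sum_n_C_ext. intros j _.
    rewrite (CInt_ext _ (fun t => l j z * F t (RtoC (INR j)))%C) by (intros; ring).
    rewrite CInt_scal by auto. ring.
  - assert (K : forall m, poly_le N (fun z => sum_n (fun j => CInt (fun t => F t (RtoC (INR j))) * l j z)%C m)).
    { induction m as [| m IH].
      - apply poly_le_ext with (fun z => CInt (fun t => F t (RtoC (INR 0))) * l 0%nat z)%C;
          [intros; rewrite sum_n_C_0; auto | apply poly_le_scal; auto].
      - apply poly_le_ext with (fun z => sum_n (fun j => CInt (fun t => F t (RtoC (INR j))) * l j z)%C m +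
          CInt (fun t => F t (RtoC (INR (S m)))) * l (S m) z)%C;
          [intros; rewrite sum_n_C_S; auto | apply poly_le_plus; auto using poly_le_scal]. }
    apply K.
Qed.

Lemma poly_le_Lop (th rad : R) (n : nat) (W : C -> Prop) (v : C -> C) : 0 < th < PI / 2 -> 0 < rad ->
  holo_near th rad W v -> poly_le (8 * n + 3) (Lop th rad n v).
Proof.
  intros Hth Hrad Hv.
  assert (Hpv := fun i t => pcont_v_gam th rad W v i t Hth Hrad Hv).
  assert (Hpk := pcont_ker th rad n).
  assert (K : forall i, poly_le (8 * n + 3)
    (fun z => CInt (fun t => v (gam th rad i t) * ker th rad n i t z * dgam th rad i t)%C)).
  { intros i. apply (poly_le_CInt _ (fun t z => v (gam th rad i t) * ker th rad n i t z * dgam th rad i t)%C).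
    - intros t. apply poly_le_ext with (fun z => (v (gam th rad i t) * dgam th rad i t) * ker th rad n i t z)%C;
        [intros; ring | apply poly_le_scal, poly_le_ker].
    - intros z; pc; auto. }
  apply poly_le_plus; [apply poly_le_plus |]; apply K.
Qed.

(** The sector is convex: the normal of an edge serves on that edge and at the vertex, the radial
    direction on the arc. *)
Lemma sector_support (th rad : R) (z : C) : 0 < th < PI / 2 -> 0 < rad -> sector th rad z ->
  ~ open_sector th rad z ->
  exists e, Cmod e = 1 /\ forall w, sector th rad w -> Re (e * (w - z)) <= 0.
Proof.
  intros Hth Hrad Hz Hno.
  assert (Hu : forall a b : R, a * a + b * b = 1 -> Cmod (a, b) = 1).
  { intros a b H. apply Rle_antisym; [apply Cmod_le_of_sqr | apply Cmod_ge_of_sqr]; simpl; lra. }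
  assert (Hsc := sin2_cos2 th). unfold Rsqr in Hsc.
  assert (Hz' := Hz). apply sector_linear in Hz'; auto. destruct Hz' as [[H1 H2] H3].
  assert (L : forall a w, Re (a * (w - z)) = Re (a * w) - Re (a * z)) by (intros; unfold Re; simpl; ring).
  destruct (Req_dec (Re ((- sin th, cos th) * z)) 0) as [E1 | E1].
  { exists (- sin th, cos th). split; [apply Hu; lra |]. intros w Hw.
    apply sector_linear in Hw; auto. rewrite L, E1. lra. }
  destruct (Req_dec (Re ((- sin th, - cos th) * z)) 0) as [E2 | E2].
  { exists (- sin th, - cos th). split; [apply Hu; lra |]. intros w Hw.
    apply sector_linear in Hw; auto. rewrite L, E2. lra. }
  destruct (Req_dec (Cmod z) rad) as [E3 | E3].
  2:{ exfalso. apply Hno. apply open_sector_linear; auto. lra. }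
  exists (RtoC (/ rad) * Cconj z)%C.
  assert (Hrad' : 0 < / rad) by (apply Rinv_0_lt_compat; auto).
  split.
  - rewrite Cmod_mult, Cmod_R, Cmod_conj, E3, Rabs_pos_eq by lra. field; lra.
  - intros w [_ Hw].
    replace (RtoC (/ rad) * Cconj z * (w - z))%C with (RtoC (/ rad) * (Cconj z * w - z * Cconj z))%C by ring.
    rewrite re_scal_l, <- Cmod2_conj, E3.
    replace (Re (Cconj z * w - (rad ^ 2)%R)) with (Re (Cconj z * w) - rad * rad) by (unfold Re; simpl; ring).
    assert (K := Re_le_Cmod (Cconj z * w)). rewrite Cmod_mult, Cmod_conj, E3 in K.
    assert (rad * Cmod w <= rad * rad) by (apply Rmult_le_compat_l; lra).
    assert (Re (Cconj z * w) - rad * rad <= 0) by lra. nra.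
Qed.

(** Boundary points of the right lobe have a supporting line; its interior follows from the maximum
    principle, as [Lop] is a polynomial in [z]. *)
Lemma Lop_bound (th rad : R) : 0 < th <= PI / 4 -> 0 < rad -> exists k, 0 < k /\
  forall (n : nat) (W : C -> Prop) (v : C -> C) (M : R), (1 <= n)%nat -> holo_near th rad W v ->
    (forall w, sector th rad w -> Cmod (v w) <= M) ->
    forall z, sector th rad z \/ sector th rad (- z) -> Cmod (Lop th rad n v z) <= k * M.
Proof.
  intros Hth Hrad. assert (HPI := PI_RGT_0). assert (Hth2 : 0 < th < PI / 2) by lra.
  set (eps := / (4 * (rad * rad))).
  set (C0 := 2 * (6 * eps + 1) + 2 * (2 + 12 / eps)).
  assert (Heps : 0 < eps) by (apply Rinv_0_lt_compat; nra).
  assert (HC0 : 0 < C0).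
  { unfold C0. assert (0 < 12 / eps) by (apply Rdiv_lt_0_compat; lra). lra. }
  set (k := 6 * (C0 * (2 * rad) * (PI / (th * rad / 2)))).
  exists k. split.
  { unfold k. assert (0 < PI / (th * rad / 2)) by (apply Rdiv_lt_0_compat; nra).
    apply Rmult_lt_0_compat; [lra |]. apply Rmult_lt_0_compat; [nra | auto]. }
  intros n W v M Hn Hv HM.
  assert (Hb : forall z y e, sector th rad y -> z = y \/ z = (- y)%C -> Cmod e = 1 ->
    (forall w, sector th rad w -> Re (e * (w - z)) <= 0) -> Cmod (Lop th rad n v z) <= k * M).
  { intros z y e Hy Hzy He Hsup.
    assert (K := Lop_support_bound th rad n W v M z y e Hth Hrad Hn Hv HM Hy Hzy He Hsup).
    cbv zeta in K. fold eps C0 in K. eapply Rle_trans; [exact K |]. unfold k. right; ring. }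
  intros z [Hz | Hz].
  - apply (maximum_principle (sector th rad) rad); auto.
    + apply sector_closed; auto.
    + apply sector_bounded.
    + intros w. apply (poly_le_taylor3 (fun u => u) w (8 * n + 3)); [eapply poly_le_Lop; eauto | apply taylor3_id].
    + intros w Hw. destruct (classic (open_sector th rad w)) as [Ho | Hno].
      * right. destruct (open_sector_open th rad w Hth2 Ho) as (d & Hd & K).
        exists d; split; auto. intros u Hu; apply open_sector_sector; auto.
      * left. destruct (sector_support th rad w Hth2 Hrad Hw Hno) as (e & He & Hsup).
        apply (Hb w w e); auto.
  (* On the opposite lobe a vertical line through [z] supports the right lobe from outside, so every
     point is treated directly. *)
  - apply (Hb z (- z)%C (RtoC (-1))); auto.
    + right; ring.
    + rewrite Cmod_R, Rabs_left; lra.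
    + intros w Hw.
      assert (Q1 := proj1 (sector_quarter th rad w Hth Hw)).
      assert (Q2 := proj1 (sector_quarter th rad (- z) Hth Hz)).
      assert (P1 := Rabs_pos (Im w)). assert (P2 := Rabs_pos (Im (- z))).
      rewrite re_opp in Q2. unfold Re in *; simpl. lra.
Qed.

(** The kernel differs from the Cauchy kernel by [vp / (zeta - z)]. At margin [m],
    [|qk| <= 1 - m / (8 rad^2)] makes [vp] exponentially small and [|zeta - z| >= m / (2 rad)]. The
    margin sees only [z^2], so both lobes are included. *)
Lemma Lop_remainder (th rad m : R) (n : nat) (W : C -> Prop) (v : C -> C) (M : R) (z : C) :
  0 < th <= PI / 4 -> 0 < rad -> (1 <= n)%nat -> holo_near th rad W v ->
  (forall w, sector th rad w -> Cmod (v w) <= M) -> 0 < m -> margin th rad m z -> Cmod z <= rad ->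
  (forall i t, 0 <= t <= 1 -> (gam th rad i t - z)%C <> RtoC 0) ->
  Cmod (Lop th rad n v z -
      contour_int (fun i t => v (gam th rad i t) * / (gam th rad i t - z) * dgam th rad i t)%C) <=
    24 * (rad * rad) / m * M * (1 - m / (8 * (rad * rad))) ^ n.
Proof.
  intros Hth Hrad Hn Hv HM Hm Hz Hzr Hgz. assert (HPI := PI_RGT_0).
  assert (Hth2 : 0 < th < PI / 2) by lra.
  assert (Hpv := fun i t => pcont_v_gam th rad W v i t Hth2 Hrad Hv).
  assert (Hpk := pcont_ker th rad n).
  unfold Lop. rewrite <- CI_minus by (intros i; pc; auto).
  assert (HM0 : 0 <= M).
  { eapply Rle_trans; [apply Cmod_ge_0 | apply (HM (gam th rad 0 0))]. apply gam_sector; auto; lra. }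
  set (q := 1 - m / (8 * (rad * rad))).
  replace (24 * (rad * rad) / m * M * q ^ n) with (6 * (M * (q ^ n * (2 * rad / m)) * (2 * rad))) by (field; lra).
  apply CI_bound.
  - intros i; pc; auto.
  - intros i t Ht.
    destruct (Xk_bounds th rad m i t z Hth2 Hrad Ht ltac:(lra) Hz) as (X1 & X2 & X3).
    assert (He : 0 < 4 * (rad * rad)) by nra.
    assert (Hm' : 0 <= m / (4 * (rad * rad))) by (apply Rdiv_le_0_compat; lra).
    assert (Hq := quadratic_contraction _ _ Hm' X1 X2). fold (qk th rad i t z) in Hq.
    replace (1 - m / (4 * (rad * rad)) / 2) with q in Hq by (unfold q; field; lra).
    assert (Hq1 : q <= 1).
    { unfold q. assert (0 <= m / (8 * (rad * rad))) by (apply Rdiv_le_0_compat; lra). lra. }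
    assert (HS := Cmod_vp_le n _ Hn ltac:(eapply Rle_trans; [exact Hq | exact Hq1])).
    assert (HS2 : Cmod (vp n (qk th rad i t z)) <= q ^ n).
    { eapply Rle_trans; [exact HS |]. apply pow_incr; split; [apply Cmod_ge_0 | auto]. }
    assert (HK := ker_spec th rad n i t z Hn).
    assert (Hg := Hgz i t Ht). assert (Hgp := proj1 (Cmod_gt_0 _) Hg).
    replace (v (gam th rad i t) * ker th rad n i t z * dgam th rad i t -
      v (gam th rad i t) * / (gam th rad i t - z) * dgam th rad i t)%C with
      (v (gam th rad i t) * (- vp n (qk th rad i t z) / (gam th rad i t - z)) * dgam th rad i t)%C.
    2:{ replace (ker th rad n i t z) with ((1 - vp n (qk th rad i t z)) / (gam th rad i t - z))%C
          by (rewrite <- HK; field; auto). field; auto. }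
    rewrite !Cmod_mult, Cmod_div, Cmod_opp by auto.
    assert (Hgs := gam_sector th rad i t Hth2 Hrad Ht).
    assert (Hfar : m / (2 * rad) <= Cmod (gam th rad i t - z)).
    { apply Rle_div_l; [lra |].
      assert (K := margin_Re_nu th rad m i t z Hz).
      assert (K2 := re_le_Cmod (nu th i t * (z * z - gam th rad i t * gam th rad i t))).
      rewrite Cmod_mult, Cmod_nu in K2. apply Rabs_le_between in K2.
      replace (z * z - gam th rad i t * gam th rad i t)%C with
        (- ((gam th rad i t - z) * (gam th rad i t + z)))%C in K2 by ring.
      rewrite Cmod_opp, Cmod_mult in K2.
      replace (z * z - gam th rad i t * gam th rad i t)%C with
        (- ((gam th rad i t - z) * (gam th rad i t + z)))%C in K by ring.
      assert (K3 : Cmod (gam th rad i t + z) <= 2 * rad).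
      { eapply Rle_trans; [apply Cmod_triangle |]. destruct Hgs as [_ Hgs]. lra. }
      nra. }
    apply Rmult_le_compat; auto using Cmod_ge_0, Cmod_dgam.
    + apply Rmult_le_pos; [apply Cmod_ge_0 |]. apply Rdiv_le_0_compat; [apply Cmod_ge_0 | auto].
    + apply Rmult_le_compat; auto using Cmod_ge_0.
      * apply Rdiv_le_0_compat; [apply Cmod_ge_0 | auto].
      * apply Rmult_le_compat; auto using Cmod_ge_0; [left; apply Rinv_0_lt_compat; auto |].
        replace (2 * rad / m) with (/ (m / (2 * rad))) by (field; lra).
        apply Rinv_le_contravar; auto. apply Rdiv_lt_0_compat; lra.
Qed.

(** Divided by the winding number, the Cauchy integral is [v z] inside the right lobe and 0 inside
    the left one. Each lobe operator is thus nearly invisible inside the other lobe, and two of them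
    can simply be added. *)
Lemma lobe_operator (th rad : R) : 0 < th <= PI / 4 -> 0 < rad -> exists k, 0 < k /\
  forall (n : nat) (W : C -> Prop) (v : C -> C) (M : R), (1 <= n)%nat -> holo_near th rad W v ->
    (forall w, sector th rad w -> Cmod (v w) <= M) ->
    exists P, poly_le (8 * n + 3) P /\
      (forall z, sector th rad z \/ sector th rad (- z) -> Cmod (P z) <= k * M) /\
      forall m z, 0 < m -> margin th rad m z ->
        (open_sector th rad z -> Cmod (P z - v z) <= k / m * M * (1 - m / (8 * (rad * rad))) ^ n) /\
        (open_sector th rad (- z) -> Cmod (P z) <= k / m * M * (1 - m / (8 * (rad * rad))) ^ n).
Proof.
  intros Hth Hrad. assert (HPI := PI_RGT_0). assert (Hth2 : 0 < th < PI / 2) by lra.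
  destruct (Lop_bound th rad Hth Hrad) as (k0 & Hk0 & HB).
  set (c := winding th rad (RtoC (rad / 2))).
  assert (Hc : c <> RtoC 0) by (apply winding_neq_0; auto).
  assert (Hcp := proj1 (Cmod_gt_0 _) Hc).
  set (ic := / Cmod c). assert (Hic : 0 < ic) by (apply Rinv_0_lt_compat; auto).
  set (k := ic * (k0 + 24 * (rad * rad))).
  assert (Hrr : 0 < rad * rad) by nra.
  exists k. split; [apply Rmult_lt_0_compat; lra |].
  intros n W v M Hn Hv HM.
  assert (HM0 : 0 <= M).
  { eapply Rle_trans; [apply Cmod_ge_0 | apply (HM (gam th rad 0 0))]. apply gam_sector; auto; lra. }
  exists (fun z => / c * Lop th rad n v z)%C. split; [| split].
  - apply poly_le_scal. eapply poly_le_Lop; eauto.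
  - intros z Hz. rewrite Cmod_mult, Cmod_inv by auto. fold ic.
    assert (K := HB n W v M Hn Hv HM z Hz). unfold k. rewrite Rmult_assoc. apply Rmult_le_compat_l; [lra |].
    nra.
  - intros m z Hm Hz.
    assert (Hfin : forall x, Cmod x <= 24 * (rad * rad) / m * M * (1 - m / (8 * (rad * rad))) ^ n ->
      Cmod (/ c * x) <= k / m * M * (1 - m / (8 * (rad * rad))) ^ n).
    { intros x Hx. rewrite Cmod_mult, Cmod_inv by auto. fold ic.
      assert (Hq : 0 <= (1 - m / (8 * (rad * rad))) ^ n).
      { apply pow_le. destruct Hz as (_ & _ & H3). assert (H0 := Cmod_ge_0 z).
        assert (m / (8 * (rad * rad)) <= 1); [| lra]. apply Rle_div_l; nra. }
      eapply Rle_trans; [apply Rmult_le_compat_l; [lra | exact Hx] |].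
      set (q := (1 - m / (8 * (rad * rad))) ^ n) in *.
      replace (ic * (24 * (rad * rad) / m * M * q)) with (ic * (24 * (rad * rad)) / m * M * q) by (field; lra).
      apply Rmult_le_compat_r; auto. apply Rmult_le_compat_r; auto.
      apply Rmult_le_compat_r; [left; apply Rinv_0_lt_compat; auto |].
      unfold k. apply Rmult_le_compat_l; lra. }
    split; intros Ho.
    + assert (Hgz : forall i t, 0 <= t <= 1 -> (gam th rad i t - z)%C <> RtoC 0)
        by (intros; apply gam_minus_neq; auto).
      assert (K := Lop_remainder th rad m n W v M z Hth Hrad Hn Hv HM Hm Hz ltac:(destruct Ho; lra) Hgz).
      assert (V := Hv). destruct V as (V1 & V2 & V3 & V4).
      rewrite (inside_cauchy th rad W v z) in K by auto.
      rewrite (winding_const th rad z (RtoC (rad / 2))) in K by auto using open_sector_mid.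
      fold c in K.
      replace (/ c * Lop th rad n v z - v z)%C with (/ c * (Lop th rad n v z - v z * c))%C by (field; auto).
      auto.
    + assert (Hx : Re z < 0).
      { assert (Q := proj1 (sector_quarter th rad (- z) Hth (open_sector_sector _ _ _ Ho))).
        destruct Ho as [Q1 _]. assert (Hs : 0 < sin th) by (apply sin_gt_0; lra).
        assert (Hcs : 0 < cos th) by (apply cos_gt_0; lra).
        assert (P := Rabs_pos (Im (- z))). rewrite re_opp in Q, Q1. nra. }
      assert (Hd : forall w, sector th rad w -> Re (RtoC (-1) * (w - z)) <= - - Re z).
      { intros w Hw. assert (Q := proj1 (sector_quarter th rad w Hth Hw)).
        assert (P := Rabs_pos (Im w)). unfold Re in *; simpl. lra. }
      assert (Hgz : forall i t, 0 <= t <= 1 -> (gam th rad i t - z)%C <> RtoC 0).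
      { intros i t Ht K. assert (Q := Hd _ (gam_sector th rad i t Hth2 Hrad Ht)). rewrite K in Q.
        simpl in Q. lra. }
      assert (Hzr : Cmod z <= rad) by (destruct Ho as [_ Ho]; rewrite Cmod_opp in Ho; lra).
      assert (K := Lop_remainder th rad m n W v M z Hth Hrad Hn Hv HM Hm Hz Hzr Hgz).
      assert (V := Hv). destruct V as (V1 & V2 & V3 & V4).
      rewrite (outside_zero th rad W v z (RtoC (-1)) (- Re z)) in K by (auto; lra).
      replace (Lop th rad n v z - 0)%C with (Lop th rad n v z) in K by ring. auto.
Qed.

(** * Part (i) *)

Lemma cont_uniform (K : C -> Prop) (B : R) (u : C -> C) (eta : R) :
  closed_set K -> bounded_set B K -> contC K u -> 0 < eta ->
  exists d, 0 < d /\ forall z w, K z -> K w -> Cmod (w - z) < d -> Cmod (u w - u z) <= eta.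
Proof.
  intros Hc Hb Hu Heta.
  destruct (lebesgue_number K B (fun z d => forall w, K w -> Cmod (w - z) < 2 * d ->
    Cmod (u w - u z) <= eta / 2) Hc Hb) as (d0 & Hd0 & H).
  { intros z Hz. destruct (Hu z Hz (eta / 2)) as (d & Hd & Hw); [lra |].
    exists (d / 2); split; [lra |]. intros w Kw Hwz. left; apply Hw; auto; lra. }
  exists d0; split; auto. intros z w Hz Hw Hzw.
  destruct (H z Hz) as (z0 & d & H1 & H2 & H3 & H4).
  assert (Q1 := H3 z Hz ltac:(lra)).
  assert (Q2 : Cmod (u w - u z0) <= eta / 2).
  { apply H3; auto. replace (w - z0)%C with ((w - z) + (z - z0))%C by ring.
    eapply Rle_lt_trans; [apply Cmod_triangle | lra]. }
  replace (u w - u z)%C with ((u w - u z0) - (u z - u z0))%C by ring.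
  eapply Rle_trans; [apply Cmod_minus_le | lra].
Qed.

(** If the best error were 0, the interpolant of [f] at [n + 1] points of [K] would be the limit of
    the approximating polynomials, so [f] would coincide on [K] with a polynomial and be analytic at
    0. *)
Lemma best_error_pos (alpha rad : R) (f : C -> C) (n : nat) : 0 < alpha < 1 -> 0 < rad ->
  contC (double_sector alpha rad) f -> ~ analytic_at (double_sector alpha rad) f (RtoC 0) ->
  0 < best_error (double_sector alpha rad) f n.
Proof.
  intros Ha Hrad Hf Hna. assert (HPI := PI_RGT_0).
  set (K := double_sector alpha rad) in *.
  destruct (best_error_spec K f n) as (B1 & B2 & B3).
  destruct (Rle_lt_or_eq_dec _ _ B1) as [|E0]; auto. exfalso. apply Hna.
  set (x := fun j : nat => RtoC (rad / (INR j + 1))).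
  assert (Hj : forall j, 0 < INR j + 1) by (intros j; generalize (pos_INR j); lra).
  assert (HxK : forall j, K (x j)).
  { intros j. apply double_sector_iff; auto. left.
    assert (H0 : 0 < rad / (INR j + 1)) by (apply Rdiv_lt_0_compat; auto).
    assert (Hs : 0 < sin (alpha * PI / 2)) by (apply sin_gt_0; nra).
    unfold x; split; [simpl; rewrite Rabs_R0; nra |]. rewrite Cmod_R, Rabs_pos_eq by lra.
    apply (proj2 (Rle_div_l _ _ _ (Hj j))). generalize (pos_INR j); nra. }
  destruct (poly_le_interpolation x n) as (l & Hl & HI).
  { intros i j Hij Q. apply Hij, INR_eq. apply (f_equal fst) in Q. simpl in Q.
    assert (Q' : / (INR i + 1) = / (INR j + 1)) by (apply (Rmult_eq_reg_l rad); [exact Q | lra]).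
    apply Rinv_eq_reg in Q'. lra. }
  set (g := fun z => sum_n (fun j => f (x j) * l j z)%C n : C).
  assert (Hg : poly_le n g).
  { unfold g. generalize n at 2; intros m. induction m as [| m IH].
    - apply poly_le_ext with (fun z => f (x 0%nat) * l 0%nat z)%C;
        [intros; rewrite sum_n_C_0; auto | apply poly_le_scal; auto].
    - apply poly_le_ext with (fun z => sum_n (fun j => f (x j) * l j z)%C m + f (x (S m)) * l (S m) z)%C;
        [intros; rewrite sum_n_C_S; auto | apply poly_le_plus; auto using poly_le_scal]. }
  assert (Hfg : forall z, K z -> g z = f z).
  { intros z Hz.
    assert (HB : forall m, exists b, 0 <= b /\ forall (P : C -> C) eta,
      (forall j, Cmod (f (x j) - P (x j)) <= eta) ->
      Cmod (sum_n (fun j => f (x j) * l j z)%C m - sum_n (fun j => P (x j) * l j z)%C m) <= b * eta).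
    { induction m as [| m (b & Hb & IH)].
      - exists (Cmod (l 0%nat z)); split; [apply Cmod_ge_0 |]. intros P eta HP.
        rewrite !sum_n_C_0. replace (f (x 0%nat) * l 0%nat z - P (x 0%nat) * l 0%nat z)%C with
          (l 0%nat z * (f (x 0%nat) - P (x 0%nat)))%C by ring.
        rewrite Cmod_mult. apply Rmult_le_compat_l; auto using Cmod_ge_0.
      - exists (b + Cmod (l (S m) z)); split; [generalize (Cmod_ge_0 (l (S m) z)); lra |].
        intros P eta HP. rewrite !sum_n_C_S.
        set (s1 := sum_n (fun j => f (x j) * l j z)%C m : C) in *.
        assert (Q := IH P eta HP). set (s2 := sum_n (fun j => P (x j) * l j z)%C m : C) in *.
        replace (s1 + f (x (S m)) * l (S m) z - (s2 + P (x (S m)) * l (S m) z))%C with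
          ((s1 - s2) + l (S m) z * (f (x (S m)) - P (x (S m))))%C by ring.
        eapply Rle_trans; [apply Cmod_triangle |]. rewrite Cmod_mult, Rmult_plus_distr_r.
        apply Rplus_le_compat; auto. apply Rmult_le_compat_l; auto using Cmod_ge_0. }
    destruct (HB n) as (b & Hb & Hbb).
    assert (H0 : Cmod (g z - f z) = 0).
    { apply Rle_antisym; [| apply Cmod_ge_0]. apply le_epsilon; intros eps Heps. rewrite Rplus_0_l.
      destruct (B3 (eps / (b + 1))) as (P & HP & HPd); [apply Rdiv_lt_0_compat; lra |].
      rewrite <- E0, Rplus_0_l in HPd. set (eta := eps / (b + 1)) in *.
      assert (Hd : forall w, K w -> Cmod (f w - P w) <= eta).
      { intros w Hw. eapply Rle_trans; [| left; exact HPd].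
        apply (dist_on_ge alpha rad f P n K w); auto. }
      assert (Q1 := Hbb P eta (fun j => Hd (x j) (HxK j))). rewrite <- (HI P z HP) in Q1.
      replace (g z - f z)%C with ((g z - P z) - (f z - P z))%C by ring.
      eapply Rle_trans; [apply Cmod_minus_le |].
      assert (Q2 := Hd z Hz). assert (Eeta : eta * (b + 1) = eps) by (unfold eta; field; lra).
      unfold g in *. lra. }
    apply Cmod_eq_0 in H0. replace (g z) with ((g z - f z) + f z)%C by ring. rewrite H0; ring. }
  exists (fun _ => True), g. repeat split; auto.
  - intros z _. apply locally_C_Cmod. exists 1; split; [lra | auto].
  - intros z _. destruct (cdiff_poly n g z Hg) as [d Hd]. exists d. apply is_derive_cdiff; auto.
Qed.

Lemma cdiff_comp_affine (u : C -> C) (a b z l : C) : cdiff u (a * z + b)%C l ->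
  cdiff (fun w => u (a * w + b)%C) z (l * a)%C.
Proof.
  intros H eps Heps. assert (Ha := Cmod_ge_0 a).
  destruct (H (eps / (Cmod a + 1))) as (d & Hd & K); [apply Rdiv_lt_0_compat; lra |].
  exists (d / (Cmod a + 1)); split; [apply Rdiv_lt_0_compat; lra |]. intros w Hw.
  apply Rlt_div_r in Hw; [| lra]. assert (H0 := Cmod_ge_0 (w - z)).
  assert (E : Cmod (a * w + b - (a * z + b)) = Cmod a * Cmod (w - z)).
  { rewrite <- Cmod_mult; f_equal; ring. }
  assert (Q := K (a * w + b)%C ltac:(rewrite E; nra)). rewrite E in Q.
  replace (u (a * w + b) - u (a * z + b) - l * a * (w - z))%C with
    (u (a * w + b) - u (a * z + b) - l * (a * w + b - (a * z + b)))%C by ring.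
  eapply Rle_trans; [exact Q |].
  replace (eps / (Cmod a + 1) * (Cmod a * Cmod (w - z))) with (eps * Cmod (w - z) * (Cmod a / (Cmod a + 1)))
    by (field; lra).
  rewrite <- (Rmult_1_r (eps * Cmod (w - z))) at 2. apply Rmult_le_compat_l; [nra |].
  apply Rle_div_l; lra.
Qed.

Lemma holo_near_shrink (th rad s : R) (u : C -> C) : 0 < th < PI / 2 -> 0 < rad -> 0 < s <= 1 ->
  (forall z, open_sector th rad z -> exists l, cdiff u z l) ->
  holo_near th rad (fun z => open_sector th rad (RtoC (1 - s) * z + RtoC s * RtoC (rad / 2)))
    (fun z => u (RtoC (1 - s) * z + RtoC s * RtoC (rad / 2))%C).
Proof.
  intros Hth Hrad Hs Hu. split; [| split; [| split]].
  - intros z Hz. destruct (open_sector_open th rad _ Hth Hz) as (d & Hd & K).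
    exists d; split; auto. intros w Hw. apply K.
    replace (RtoC (1 - s) * w + RtoC s * RtoC (rad / 2) - (RtoC (1 - s) * z + RtoC s * RtoC (rad / 2)))%C
      with (RtoC (1 - s) * (w - z))%C by ring.
    rewrite Cmod_mult, Cmod_R, Rabs_pos_eq by lra. generalize (Cmod_ge_0 (w - z)); nra.
  - intros z w q Hz Hw Hq.
    replace (RtoC (1 - s) * (z + RtoC q * (w - z)) + RtoC s * RtoC (rad / 2))%C with
      ((RtoC (1 - s) * z + RtoC s * RtoC (rad / 2)) + RtoC q * ((RtoC (1 - s) * w + RtoC s * RtoC (rad / 2)) -
        (RtoC (1 - s) * z + RtoC s * RtoC (rad / 2))))%C by ring.
    apply open_sector_convex; auto.
  - intros z Hz. apply sector_shrink; auto.
  - intros z Hz. destruct (Hu _ Hz) as [l Hl]. exists (l * RtoC (1 - s))%C.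
    apply (cdiff_comp_affine u (RtoC (1 - s)) (RtoC s * RtoC (rad / 2))%C); auto.
Qed.

(** As [u] is only continuous up to the boundary, the lobe operators are applied to [u] composed
    with a contraction [T] into the open sector. Uniform continuity makes the resulting error as
    small as desired, and the modulus of continuity influences [T] but not [k]. *)
Lemma double_lobe_operator (alpha rad : R) : 0 < alpha <= / 2 -> 0 < rad -> exists k, 0 < k /\
  forall (n : nat) (u : C -> C) (M : R), (1 <= n)%nat -> 0 < M ->
    contC (double_sector alpha rad) u ->
    (forall z, interior_C (double_sector alpha rad) z -> exists l, cdiff u z l) ->
    (forall z, double_sector alpha rad z -> Cmod (u z) <= M) ->
    exists P, poly_le (8 * n + 3) P /\
      (forall z, double_sector alpha rad z -> Cmod (P z) <= k * M) /\
      forall m z, 0 < m -> margin (alpha * PI / 2) rad m z -> interior_C (double_sector alpha rad) z ->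
        Cmod (u z - P z) <= k / m * M * (1 - m / (8 * (rad * rad))) ^ n + M * exp (- INR (8 * n + 11)).
Proof.
  intros Ha Hrad. assert (HPI := PI_RGT_0). assert (Ha' : 0 < alpha < 1) by lra.
  set (th := alpha * PI / 2).
  assert (Hth : 0 < th <= PI / 4) by (unfold th; nra).
  assert (Hth2 : 0 < th < PI / 2) by lra.
  destruct (lobe_operator th rad Hth Hrad) as (k & Hk & Hop).
  exists (2 * k). split; [lra |].
  intros n u M Hn HM Hu Hd Hb. set (K := double_sector alpha rad) in *.
  assert (Hin : forall z, open_sector th rad z -> interior_C K z)
    by (intros z Hz; apply interior_double_sector; auto).
  assert (Hin' : forall z, open_sector th rad z -> interior_C K (- z)%C).
  { intros z Hz; apply interior_double_sector; auto. right. replace (- - z)%C with z by ring; auto. }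
  assert (HKp : forall z, sector th rad z -> K z) by (intros z Hz; apply double_sector_iff; auto).
  assert (HKm : forall z, sector th rad z -> K (- z)%C).
  { intros z Hz; apply double_sector_iff; auto. right. replace (- - z)%C with z by ring; auto. }
  (* A degree [N] whose quotient [(N - 3) / 8] is [n] satisfies [N < 8 n + 11], so
     [eta <= M exp (- N)]. *)
  set (eta := M * exp (- INR (8 * n + 11))).
  assert (Heta : 0 < eta) by (apply Rmult_lt_0_compat; [auto | apply exp_pos]).
  destruct (cont_uniform K rad u eta) as (d & Hd0 & Hunif); auto.
  { apply double_sector_closed; auto. } { apply double_sector_bounded; auto. }
  set (s := Rmin 1 (d / (4 * rad))).
  assert (Hs : 0 < s <= 1).
  { split; [apply Rmin_pos; [lra | apply Rdiv_lt_0_compat; lra] | apply Rmin_l]. }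
  assert (Hs2 : s <= d / (4 * rad)) by apply Rmin_r.
  apply Rle_div_r in Hs2; [| lra].
  set (T := fun z : C => (RtoC (1 - s) * z + RtoC s * RtoC (rad / 2))%C).
  assert (HT : forall z, sector th rad z -> open_sector th rad (T z))
    by (intros z Hz; apply sector_shrink; auto).
  assert (HTd : forall z, sector th rad z -> Cmod (T z - z) < d).
  { intros z [_ Hz]. replace (T z - z)%C with (RtoC s * (RtoC (rad / 2) - z))%C
      by (unfold T; rewrite RtoC_minus; ring).
    rewrite Cmod_mult, Cmod_R, Rabs_pos_eq by lra.
    assert (Cmod (RtoC (rad / 2) - z) <= 2 * rad).
    { eapply Rle_trans; [apply Cmod_minus_le |]. rewrite Cmod_R, Rabs_pos_eq; lra. }
    nra. }
  assert (Hum : forall z, open_sector th rad z -> exists l, cdiff (fun w => u (- w)%C) z l).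
  { intros z Hz. destruct (Hd _ (Hin' z Hz)) as [l Hl]. exists (l * - (1))%C.
    intros eps Heps.
    replace (- z)%C with (- (1) * z + 0)%C in Hl by ring.
    destruct (cdiff_comp_affine u (- (1))%C 0%C z l Hl eps Heps) as (e & He & Q).
    exists e; split; auto. intros w Hw. assert (Q' := Q w Hw).
    replace (- (1) * w + 0)%C with (- w)%C in Q' by ring.
    replace (- (1) * z + 0)%C with (- z)%C in Q' by ring. exact Q'. }
  destruct (Hop n _ (fun z => u (T z)) M Hn (holo_near_shrink th rad s u Hth2 Hrad Hs (fun z Hz => Hd z (Hin z Hz))))
    as (P1 & HP1 & HB1 & HC1).
  { intros w Hw. apply Hb, HKp, open_sector_sector, HT; auto. }
  destruct (Hop n _ (fun z => u (- T z)%C) M Hn (holo_near_shrink th rad s (fun w => u (- w)%C) Hth2 Hrad Hs Hum))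
    as (P2 & HP2 & HB2 & HC2).
  { intros w Hw. apply Hb, HKm, open_sector_sector, HT; auto. }
  (* The left lobe is treated by the same operator applied to the reflected function, and [P2] is
     reflected back. *)
  exists (fun z => P1 z + P2 (- z))%C. split; [| split].
  - apply poly_le_plus; auto using poly_le_opp.
  - intros z Hz. apply double_sector_iff in Hz; auto.
    assert (Q1 := HB1 z Hz).
    assert (Hz' : sector th rad (- z) \/ sector th rad (- - z)).
    { replace (- - z)%C with z by ring. tauto. }
    assert (Q2 := HB2 _ Hz'). eapply Rle_trans; [apply Cmod_triangle | lra].
  - intros m z Hm Hmz Hz.
    assert (Hmz' : margin th rad m (- z)).
    { apply margin_opp. replace (- - z)%C with z by ring; auto. }
    destruct (HC1 m z Hm Hmz) as [C1 C2]. destruct (HC2 m (- z)%C Hm Hmz') as [C3 C4].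
    replace (- - z)%C with z in C4 by ring.
    set (X := k / m * M * (1 - m / (8 * (rad * rad))) ^ n) in *.
    replace (2 * k / m * M * (1 - m / (8 * (rad * rad))) ^ n) with (X + X) by (unfold X; field; nra).
    fold eta. apply interior_double_sector in Hz; auto. destruct Hz as [Hz | Hz].
    + assert (Q1 := C1 Hz). assert (Q2 := C4 Hz).
      assert (Hzs := open_sector_sector _ _ _ Hz).
      assert (Q3 := Hunif z (T z) (HKp z Hzs) (HKp _ (open_sector_sector _ _ _ (HT z Hzs))) (HTd z Hzs)).
      replace (u z - (P1 z + P2 (- z)))%C with (- ((P1 z - u (T z)) + P2 (- z) + (u (T z) - u z)))%C by ring.
      rewrite Cmod_opp. eapply Rle_trans; [apply Cmod_triangle |].
      apply Rplus_le_compat; auto. eapply Rle_trans; [apply Cmod_triangle | lra].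
    + assert (Q1 := C3 Hz). assert (Q2 := C2 Hz).
      assert (Hzs := open_sector_sector _ _ _ Hz).
      assert (Kz : K z) by (replace z with (- - z)%C by ring; apply HKm; auto).
      assert (Q3 : Cmod (u (- T (- z))%C - u z) <= eta).
      { apply Hunif; auto.
        - apply HKm, open_sector_sector, HT; auto.
        - replace (- T (- z) - z)%C with (- (T (- z) - - z))%C by ring. rewrite Cmod_opp. apply HTd; auto. }
      replace (u z - (P1 z + P2 (- z)))%C with
        (- ((P2 (- z) - u (- T (- z))) + P1 z + (u (- T (- z)) - u z)))%C by ring.
      rewrite Cmod_opp. eapply Rle_trans; [apply Cmod_triangle |].
      apply Rplus_le_compat; auto. eapply Rle_trans; [apply Cmod_triangle | lra].
Qed.

Lemma open_sector_margin_pos (th rad : R) (z : C) : 0 < th <= PI / 4 -> 0 < rad -> open_sector th rad z ->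
  0 < Im (cis (2 * th) * (z * z)) /\ Im (cis (- (2 * th)) * (z * z)) < 0 /\
  Cmod z * Cmod z < rad * rad.
Proof.
  intros Hth Hrad [H3 H4]. assert (HPI := PI_RGT_0).
  assert (Hc : 0 < cos th) by (apply cos_gt_0; lra).
  assert (Hs : 0 < sin th) by (apply sin_gt_0; lra).
  assert (Hsc : sin th <= cos th).
  { rewrite <- sin_shift. apply sin_incr_1; lra. }
  assert (H0 := Rabs_pos (Im z)).
  assert (Hx : 0 < Re z) by (apply Rnot_le_lt; intros K; nra).
  assert (H2 : Rabs (Im z) * sin th < Re z * cos th).
  { apply Rmult_lt_reg_r with (cos th); auto.
    assert (Rabs (Im z) * cos th * sin th < Re z * sin th * sin th) by (apply Rmult_lt_compat_r; auto).
    assert (sin th * sin th <= cos th * cos th) by (apply Rmult_le_compat; lra).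
    nra. }
  assert (K1 : - (Rabs (Im z) * sin th) <= Im z * sin th <= Rabs (Im z) * sin th).
  { unfold Rabs; destruct (Rcase_abs (Im z)); nra. }
  assert (K2 : - (Rabs (Im z) * cos th) <= Im z * cos th <= Rabs (Im z) * cos th).
  { unfold Rabs; destruct (Rcase_abs (Im z)); nra. }
  assert (H5 := Cmod_ge_0 z).
  repeat split.
  - rewrite Im_sqr_cis. apply Rmult_lt_0_compat; lra.
  - replace (- (2 * th)) with (2 * - th) by ring. rewrite Im_sqr_cis, cos_neg, sin_neg.
    assert (0 < (Re z * cos th - Im z * - sin th) * (Re z * sin th - Im z * cos th))
      by (apply Rmult_lt_0_compat; lra).
    lra.
  - nra.
Qed.

(** The interior is covered by the open sets of margin greater than [1 / (k + 1)]; a finite subcover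
    gives one margin for all of [E]. The cap [rad^2] keeps the ratio [1 - m / (8 rad^2)]
    positive. *)
Lemma compact_margin (alpha rad : R) (E : C -> Prop) : 0 < alpha <= / 2 -> 0 < rad -> compact_C E ->
  (forall z, E z -> interior_C (double_sector alpha rad) z) ->
  exists m, 0 < m <= rad * rad /\ forall z, E z -> margin (alpha * PI / 2) rad m z.
Proof.
  intros Ha Hrad HE HEi. assert (HPI := PI_RGT_0). assert (Ha' : 0 < alpha < 1) by lra.
  set (th := alpha * PI / 2).
  assert (Hth : 0 < th <= PI / 4) by (unfold th; nra).
  set (dl := fun k : nat => / (INR k + 1)).
  assert (Hdl : forall k, 0 < dl k) by (intros k; apply Rinv_0_lt_compat; generalize (pos_INR k); lra).
  set (U := fun (k : nat) (z : C) => dl k < Im (cis (2 * th) * (z * z)) /\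
    Im (cis (- (2 * th)) * (z * z)) < - dl k /\ Cmod z * Cmod z < rad * rad - dl k).
  assert (Pid : poly_le 1 (fun z => z)).
  { apply poly_le_ext with (fun z => 0 + 1 * z)%C; [intros; ring | apply poly_le_affine]. }
  assert (Hpoly : forall c, poly_le 2 (fun z => c * (z * z))%C)
    by (intros c; apply poly_le_scal, (poly_le_mult 1 1); auto).
  assert (Him : forall c z e, 0 < e -> exists d, 0 < d /\ forall w, Cmod (w - z) < d ->
    Rabs (Im (c * (w * w)) - Im (c * (z * z))) < e).
  { intros c z e He. destruct (poly_le_continuous 2 _ z (Hpoly c) e He) as (d & Hd & H).
    exists d; split; auto. intros w Hw. eapply Rle_lt_trans; [| apply (H w Hw)].
    eapply Rle_trans; [| apply Rabs_Im_le_Cmod]. right; f_equal. }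
  destruct (HE nat U) as [l Hl].
  - intros k z (H1 & H2 & H3). apply locally_C_Cmod.
    destruct (Him (cis (2 * th)) z (Im (cis (2 * th) * (z * z)) - dl k)) as (d1 & D1 & N1); [lra |].
    destruct (Him (cis (- (2 * th))) z (- dl k - Im (cis (- (2 * th)) * (z * z)))) as (d2 & D2 & N2); [lra |].
    destruct (poly_le_continuous 2 _ z (Hpoly 1%C) (rad * rad - dl k - Cmod z * Cmod z)) as (d3 & D3 & N3); [lra |].
    exists (Rmin d1 (Rmin d2 d3)); split; [repeat apply Rmin_pos; auto |]. intros w Hw.
    assert (L1 := Rmin_l d1 (Rmin d2 d3)). assert (L2 := Rmin_r d1 (Rmin d2 d3)).
    assert (L3 := Rmin_l d2 d3). assert (L4 := Rmin_r d2 d3).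
    assert (Q1 := N1 w ltac:(lra)). assert (Q2 := N2 w ltac:(lra)). assert (Q3 := N3 w ltac:(lra)).
    apply Rabs_lt_between in Q1. apply Rabs_lt_between in Q2.
    assert (Q4 := Cmod_triangle_rev (1 * (w * w)) (1 * (z * z))).
    rewrite !Cmod_mult, Cmod_1 in Q4. unfold U; lra.
  - intros z Hz.
    assert (Hp : exists p, (p = z \/ p = (- z)%C) /\ open_sector th rad p).
    { apply HEi, interior_double_sector in Hz; auto. destruct Hz; eauto. }
    destruct Hp as (p & Hp & Hpo).
    destruct (open_sector_margin_pos th rad p Hth Hrad Hpo) as (H1 & H2 & H3).
    assert (E1 : (p * p)%C = (z * z)%C) by (destruct Hp as [-> | ->]; ring).
    assert (E2 : Cmod p = Cmod z) by (destruct Hp as [-> | ->]; [auto | apply Cmod_opp]).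
    rewrite E1 in H1, H2. rewrite E2 in H3.
    set (e := Rmin (Im (cis (2 * th) * (z * z))) (Rmin (- Im (cis (- (2 * th)) * (z * z)))
      (rad * rad - Cmod z * Cmod z))).
    assert (He : 0 < e) by (repeat apply Rmin_pos; lra).
    destruct (archimed_cor1 e He) as (k & Hk1 & Hk2).
    assert (Hk3 : dl k < e).
    { eapply Rlt_trans; [| exact Hk1]. apply Rinv_lt_contravar.
      - apply Rmult_lt_0_compat; [apply lt_0_INR; auto | generalize (pos_INR k); lra].
      - lra. }
    assert (L1 : e <= Im (cis (2 * th) * (z * z))) by apply Rmin_l.
    assert (L2 : e <= - Im (cis (- (2 * th)) * (z * z))) by (eapply Rle_trans; [apply Rmin_r | apply Rmin_l]).
    assert (L3 : e <= rad * rad - Cmod z * Cmod z) by (eapply Rle_trans; [apply Rmin_r | apply Rmin_r]).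
    exists k. unfold U; lra.
  - assert (Hm : exists m, 0 < m <= rad * rad /\ forall k, In k l -> m <= dl k).
    { clear Hl. induction l as [| k l (m & Hm & IH)].
      - exists (rad * rad); split; [nra | intros k []].
      - exists (Rmin m (dl k)). split.
        + split; [apply Rmin_pos; auto; lra | eapply Rle_trans; [apply Rmin_l | lra]].
        + intros j [-> | Hj]; [apply Rmin_r | eapply Rle_trans; [apply Rmin_l | auto]]. }
    destruct Hm as (m & Hm & Hml). exists m; split; auto.
    intros z Hz. destruct (Hl z Hz) as (k & Hk & H1 & H2 & H3).
    assert (Q := Hml k Hk). unfold margin; fold th. repeat split; lra.
Qed.

Lemma near_best_geometric (alpha rad : R) (f : C -> C) : 0 < alpha <= / 2 -> 0 < rad ->
  class_A (double_sector alpha rad) f -> ~ analytic_at (double_sector alpha rad) f (RtoC 0) ->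
  exists p, near_best (double_sector alpha rad) f p /\ geometric_rate (double_sector alpha rad) f p.
Proof.
  intros Ha Hrad [Hf Hfa] Hna. assert (Ha' : 0 < alpha < 1) by lra.
  apply continuous_on_contC in Hf. set (K := double_sector alpha rad) in *.
  assert (HE0 : forall n, 0 < best_error K f n) by (intros n; apply best_error_pos; auto).
  destruct (double_lobe_operator alpha rad Ha Hrad) as (k & Hk & Hop).
  destruct (contC_minus_bounded alpha rad f (fun _ => 0%C) 0 Ha' Hf (poly_le_const 0 0%C))
    as (Mf & HMf & Hfb).
  assert (HEb : forall n, best_error K f n <= Mf).
  { intros n. eapply Rle_trans; [apply best_error_spec, (poly_le_const n 0%C) |].
    apply supnorm_le; auto. }
  assert (Hp : forall n, exists P, poly_le n P /\
    (forall z, K z -> Cmod (f z - P z) <= 2 * (1 + k) * best_error K f n) /\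
    forall m z, (11 <= n)%nat -> 0 < m -> margin (alpha * PI / 2) rad m z -> interior_C K z ->
      Cmod (f z - P z) <= 2 * best_error K f n *
        (k / m * (1 - m / (8 * (rad * rad))) ^ ((n - 3) / 8) + exp (- INR n))).
  { intros n. set (E := best_error K f n). assert (HE : 0 < E) by apply HE0.
    destruct (best_error_spec K f n) as (_ & _ & B3).
    (* Positivity of the best error provides a polynomial within twice that error, so the existence
       of best approximants is not at stake. *)
    destruct (B3 E HE) as (Q & HQ & HQd). fold E in HQd.
    assert (Hu : forall z, K z -> Cmod (f z - Q z) <= 2 * E).
    { intros z Hz. eapply Rle_trans; [apply (dist_on_ge alpha rad f Q n K z); auto |]. lra. }
    destruct (Nat.le_gt_cases 11 n) as [Hn | Hn].
    (* The correction then has degree [8 j + 3], at most [n]. The operators ask for [j >= 1], that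
       is [n >= 11]; for the smaller [n] the polynomial [Q] is kept as it is. *)
    - set (j := ((n - 3) / 8)%nat).
      assert (Hj : (8 * j + 3 <= n < 8 * j + 11)%nat).
      { assert (J1 := Nat.div_mod_eq (n - 3) 8). assert (J2 := Nat.mod_upper_bound (n - 3) 8). lia. }
      destruct (Hop j (fun z => f z - Q z)%C (2 * E)) as (P & HP & HPb & HPc); auto; try lia; try lra.
      + eapply contC_minus_poly; eauto.
      + intros z Hz. destruct (Hfa z Hz) as [l Hl]. apply is_derive_cdiff in Hl.
        destruct (cdiff_poly n Q z HQ) as [l' Hl'].
        assert (H2 := cdiff_plus _ _ z _ _ Hl (cdiff_scal (- (1))%C _ _ _ Hl')).
        exists (l + - (1) * l')%C. intros eps Heps. destruct (H2 eps Heps) as (d & Hd & H3).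
        exists d; split; auto. intros w Hw. assert (H4 := H3 w Hw).
        replace (f w - Q w - (f z - Q z) - (l + - (1) * l') * (w - z))%C with
          (f w + - (1) * Q w - (f z + - (1) * Q z) - (l + - (1) * l') * (w - z))%C by ring.
        exact H4.
      + exists (fun z => Q z + P z)%C. split; [| split].
        * apply poly_le_plus; auto. apply poly_le_mono with (8 * j + 3)%nat; auto; lia.
        * intros z Hz. replace (f z - (Q z + P z))%C with ((f z - Q z) - P z)%C by ring.
          eapply Rle_trans; [apply Cmod_minus_le |].
          assert (H1 := Hu z Hz). assert (H2 := HPb z Hz). lra.
        * intros m z _ Hm Hmz Hz. replace (f z - (Q z + P z))%C with (f z - Q z - P z)%C by ring.
          eapply Rle_trans; [apply (HPc m z Hm Hmz Hz) |].
          assert (Hexp : exp (- INR (8 * j + 11)) <= exp (- INR n)).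
          { apply exp_mono, Ropp_le_contravar, le_INR. lia. }
          fold E. nra.
    - exists Q. split; [auto |]. split; [intros z Hz; assert (H1 := Hu z Hz); nra | intros; lia]. }
  destruct (exists_choice_function _ _ _ Hp) as [p Hps]. clear Hp.
  exists p. split.
  - split; [intros n _; apply Hps |].
    exists (2 * (1 + k)). split; [lra |]. intros n _. apply supnorm_le.
    + assert (Q := HE0 n). apply Rmult_le_pos; lra.
    + intros z Hz. apply Hps; auto.
  - intros E HEc HEi.
    destruct (compact_margin alpha rad E Ha Hrad HEc HEi) as (m & Hm & HmE).
    set (q := 1 - m / (8 * (rad * rad))) in *.
    assert (Hrr : 0 < rad * rad) by nra.
    assert (Hq : 0 < q < 1).
    { assert (0 < m / (8 * (rad * rad))) by (apply Rdiv_lt_0_compat; lra).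
      assert (m / (8 * (rad * rad)) <= / 8) by (apply Rle_div_l; lra). unfold q; lra. }
    set (a := - ln q).
    assert (Hlq : 0 < a) by (unfold a; assert (ln q < ln 1) by (apply ln_increasing; lra); rewrite ln_1 in *; lra).
    (* With [j] about [n / 8], [q^j] decays like [exp (- a n / 8)], and the error of the contraction
       like [exp (- n)]. *)
    set (b := Rmin (a / 8) 1).
    assert (Hb : 0 < b) by (apply Rmin_pos; lra).
    assert (Hb1 : b <= a / 8) by apply Rmin_l. assert (Hb2 : b <= 1) by apply Rmin_r.
    (* [exp (2 a)] covers the rounding in [j > (n - 11) / 8], as [11 / 8 < 2]. *)
    set (A := 2 * Mf * (k / m * exp (2 * a) + 1)).
    assert (HA : 0 <= A).
    { unfold A. assert (0 < k / m * exp (2 * a)) by (apply Rmult_lt_0_compat; [apply Rdiv_lt_0_compat; lra | apply exp_pos]).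
      nra. }
    assert (Hdist : forall n, (11 <= n)%nat -> dist_on E f (p n) <= A * exp (- b * INR n)).
    { intros n Hn. apply supnorm_le.
      - apply Rmult_le_pos; auto. left; apply exp_pos.
      - intros z Hz. destruct (Hps n) as (_ & _ & H3).
        eapply Rle_trans; [apply (H3 m z Hn (proj1 Hm) (HmE z Hz) (HEi z Hz)) |]. fold q.
        set (j := ((n - 3) / 8)%nat).
        assert (Hj : (n < 8 * j + 11)%nat).
        { assert (J1 := Nat.div_mod_eq (n - 3) 8). assert (J2 := Nat.mod_upper_bound (n - 3) 8). lia. }
        assert (Hqj : q ^ j <= exp (2 * a) * exp (- b * INR n)).
        { rewrite <- (exp_ln q) by lra. rewrite exp_pow_INR, <- exp_plus. apply exp_mono.
          replace (ln q) with (- a) by (unfold a; ring).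
          apply lt_INR in Hj. rewrite plus_INR, mult_INR in Hj. simpl in Hj.
          assert (Hn0 := pos_INR n). nra. }
        assert (Hen : exp (- INR n) <= exp (- b * INR n)).
        { apply exp_mono. generalize (pos_INR n); nra. }
        assert (Hkm : 0 < k / m) by (apply Rdiv_lt_0_compat; lra).
        assert (S1 : k / m * q ^ j + exp (- INR n) <= (k / m * exp (2 * a) + 1) * exp (- b * INR n)).
        { rewrite Rmult_plus_distr_r, Rmult_1_l, Rmult_assoc. apply Rplus_le_compat; auto.
          apply Rmult_le_compat_l; lra. }
        unfold A. rewrite (Rmult_assoc (2 * Mf)). apply Rmult_le_compat; auto.
        + assert (Q := HE0 n). lra.
        + assert (0 <= q ^ j) by (apply pow_le; lra). assert (0 < exp (- INR n)) by apply exp_pos.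
          assert (0 <= k / m * q ^ j) by (apply Rmult_le_pos; lra). lra.
        + assert (Q := HEb n). lra. }
    (* Half of the rate is given up so that the upper limit is 0 and not merely finite. *)
    exists (b / 2). split; [lra |].
    apply is_LimSup_seq_unique. intros eps. simpl. split.
    + intros N. exists N. split; [lia |]. assert (H0 := supnorm_ge_0 E (fun z => f z - p N z)%C).
      assert (H1 := exp_pos (b / 2 * INR N)). assert (H2 := cond_pos eps).
      assert (0 <= dist_on E f (p N) * exp (b / 2 * INR N)) by (apply Rmult_le_pos; [exact H0 | lra]). lra.
    + assert (Hx : 0 <= exp (- (b / 2)) < 1).
      { split; [left; apply exp_pos |]. rewrite <- exp_0. apply exp_increasing; lra. }
      destruct (pow_lt_1_zero (exp (- (b / 2))) ltac:(rewrite Rabs_pos_eq; lra) (eps / (A + 1))) as [N HN].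
      { apply Rdiv_lt_0_compat; [apply cond_pos | lra]. }
      exists (N + 11)%nat. intros n Hn. rewrite Rplus_0_l.
      assert (Q := HN n ltac:(lia)). rewrite Rabs_pos_eq in Q by (apply pow_le; lra).
      rewrite exp_pow_INR in Q. apply Rlt_div_r in Q; [| lra].
      assert (E2 : exp (- b * INR n) * exp (b / 2 * INR n) = exp (INR n * - (b / 2))).
      { rewrite <- exp_plus; f_equal; field. }
      assert (Hd := Hdist n ltac:(lia)).
      assert (Q2 := exp_pos (INR n * - (b / 2))).
      apply Rle_lt_trans with (A * exp (INR n * - (b / 2))); [| nra].
      rewrite <- E2, <- Rmult_assoc. apply Rmult_le_compat_r; [left; apply exp_pos | auto].
Qed.

Theorem theorem2 :
  forall (alpha beta rad : R) (f : C -> C),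
    0 < alpha < 1 ->
    0 < rad ->
    beta = 1 - alpha ->
    class_A (double_sector alpha rad) f ->
    ~ analytic_at (double_sector alpha rad) f (RtoC 0) ->
    (alpha <= beta ->
       exists p : nat -> C -> C,
         near_best (double_sector alpha rad) f p /\
         geometric_rate (double_sector alpha rad) f p) /\
    (beta < alpha ->
       forall p : nat -> C -> C,
         near_best (double_sector alpha rad) f p ->
         ~ geometric_rate (double_sector alpha rad) f p).
Proof.
  intros alpha beta rad f Ha Hrad Hb HA Hna. split.
  - intros Hab. apply near_best_geometric; auto. lra.
  - intros Hab p Hnb Hg. apply Hna.
    apply (geometric_rate_analytic alpha rad f p); auto; [lra |].
    apply continuous_on_contC, HA.
Qed.
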